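(* Let $(M,c,\sigma)$ be Poincar\'e--Einstein, let $w_0\neq -k,\ k-n$ be a weight and $h_0:=d+2w_0$. Suppose $\mathcal A\in\Gamma\mathcal T^kM[-w_0-n]$ solves $$y\mathcal A=O(\sigma^\ell),\qquad \mathscr I^\star\mathcal A=\widehat{\mathscr D}^\star\mathcal A=\mathscr X^\star\mathcal A=0 .$$ Then $\overline{\mathcal A}=\sigma^{h_0-1}\,\Pi\mathcal A$ (of weight $w_0$) solves, off $\Sigma$, $$y\overline{\mathcal A}=O(\sigma^{\ell+h_0-1}),\qquad \mathscr I^\star\overline{\mathcal A}=\widehat{\mathscr D}^\star\overline{\mathcal A}=\mathscr X^\star\overline{\mathcal A}=0 .$$
   Context: Conformal conventions. $M$ is a smooth manifold of dimension $d=n+1\ge3$ with boundary $\Sigma$ and conformal class $c$. $\mathcal EM[w]$: conformal densities of weight $w$ (families $\mu_g$, $g\in c$, with $\mu_{\Omega^2g}=\Omega^w\mu_g$); each scale $g\in c$ trivialises them; indices are moved with the conformal metric $\boldsymbol g$. $\mathcal E^kM[w]=\Lambda^kT^*M\otimes\mathcal EM[w]$. In a scale $g$: $\varepsilon,\iota$ are exterior/interior multiplication, $\mathbf d=\varepsilon(\nabla)$, $\boldsymbol\delta=\iota(\nabla)$, $\boldsymbol\Delta=\mathbf d\boldsymbol\delta+\boldsymbol\delta\mathbf d$; $\mathrm{Ric}=(d-2)P+Jg$, $J=P^a{}_a$, and $\mathbb P$ is the endomorphism $P^a{}_b$ extended to forms as a derivation. Poincar\'e--Einstein: $\sigma\in\Gamma\mathcal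 EM[1]$ is positive in the interior, vanishes exactly on $\Sigma$ with $\nabla\sigma\ne0$ there, and $g^o=\sigma^{-2}\boldsymbol g$ satisfies $\mathrm{Ric}(g^o)=-n g^o$. In a scale $g$: $\nu=\nabla\sigma$, $\rho=-\frac1d(\nabla^a\nabla_a\sigma+J\sigma)$. $O(\sigma^\alpha)$ means $\sigma^\alpha$ times a smooth section. Tractor forms. For $g\in c$, $\mathcal T^kM[w]\cong\mathcal E^{k-1}M[w+k]\oplus\mathcal E^kM[w+k]\oplus\mathcal E^{k-2}M[w+k-2]\oplus\mathcal E^{k-1}M[w+k-2]$; sections are $\mathcal F=(F^+,F,F^{+-},F^-)$ (north, west, east, south slots). Under $\hat g=\Omega^2g$, $\Upsilon=\mathbf d\log\Omega$: $\hat F^+=F^+$, $\hat F=F+\varepsilon(\Upsilon)F^+$, $\hat F^{+-}=F^{+-}-\iota(\Upsilon)F^+$, $\hat F^-=F^-+\frac12(\varepsilon(\Upsilon)\iota(\Upsilon)-\iota(\Upsilon)\varepsilon(\Upsilon))F^+-\iota(\Upsilon)F-\varepsilon(\Upsilon)F^{+-}$. Invariant operators on $\mathcal T^kM[w]$: $\mathscr X^\star\mathcal F=(0,F^+,0,F^{+-})$; $\mathscr I^\star\mathcal F=(-\iota(\nu)F^+-\sigma F^{+-},\ \rho F^++\iota(\nu)F+\sigma F^-,\ \iota(\nu)F^{+-},\ \rho F^{+-}-\iota(\nu)F^-)$; $\mathscr D:\Gamma\mathcal T^kM[w]\to\Gamma\mathcal T^{k+1}M[w-1]$ with slots north: $(d+2w-2)\big((w+k)F-\mathbf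 dF^+\big)$; west: $(d+2w-2)\mathbf dF$; east: $\big(\boldsymbol\Delta+(w+k-2)(J-2\mathbb P)\big)F^+-2\boldsymbol\delta F+(d+2w)\big(\mathbf dF^{+-}+(w+k-2)F^-\big)$; south: $[J-2\mathbb P,\mathbf d]F^+-\big(\boldsymbol\Delta+(w+k)(J-2\mathbb P)\big)F-(d+2w)\mathbf dF^-$. $y:=-(\mathscr I^\star\mathscr D+\mathscr D\mathscr I^\star):\Gamma\mathcal T^kM[w]\to\Gamma\mathcal T^kM[w-1]$. On $\ker\mathscr X^\star$, $\widehat{\mathscr D}^\star(0,A,0,\phi)=(0,\ \boldsymbol\delta A+(d+w-k)\phi,\ 0,\ -\boldsymbol\delta\phi)$. Holographic projector. On $A\in\Gamma\mathcal E^kM[w']$: $\tilde\varepsilon A=[w'\varepsilon(\nu)-\sigma\mathbf d]A$, $\tilde\iota A=[(d+w'-2k)\iota(\nu)-\sigma\boldsymbol\delta]A$. On $\mathcal T^kM[w]$, $w\ne-k,k-n$: $\mathscr D_{[3]}\mathcal F=(0,0,-\varepsilon(\nu)\mathbf dF^++\tilde\varepsilon F,\ \varepsilon(\nu)\mathbf dF)\in\Gamma\mathcal T^{k+3}M[w]$, $\mathscr D^\star_{[3]}\mathcal F=(0,-\boldsymbol\delta\iota(\nu)F^++\tilde\iota F^{+-},0,\boldsymbol\delta\iota(\nu)F^{+-})\in\Gamma\mathcal T^{k-3}M[w]$, and $\Pi:=\frac1{(w+k)(n+w-k)}\mathscr D^\star_{[3]}\mathscr D_{[3]}$.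
   Formalization: The south slot of D*_[3] is taken as −δι(ν)F^{+-} instead of the printed +δι(ν)F^{+-}; with the printed sign I*Π𝒜 = 0 fails, e.g. for k=1 on the flat half-space with σ=x, A=−x dx+(2−d−w)y₁dy₁, F^-=1, where w=−w₀−n. *)

(* Defs.v *)
From HB Require Import structures.
From mathcomp Require Import all_boot all_order all_algebra.
From mathcomp Require Import all_classical all_reals all_analysis.
Import Order.TTheory GRing.Theory Num.Theory numFieldNormedType.Exports.

Set Implicit Arguments.
Unset Strict Implicit.
Unset Printing Implicit Defensive.

Local Open Scope classical_set_scope.
Local Open Scope ring_scope.

(* Conventions.  d = n.+1.  A manifold with boundary is given by an atlas with
   values in the half-space {x | 0 <= x_0}; tensors are given by their
   components in every chart, tied together by the usual transformation laws.
   A component function is a total function on R^d of which only the values on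
   the (relatively open) image of the chart are relevant.  All weights are real,
   and metrics are Riemannian.  A section of a weighted bundle is a family
   indexed by the scales g of c, every slot being trivialised by the scale g
   in which the tractor bundle is split. *)

(* Exterior algebra of (R^d)^*: the value at S = {i_1 < ... < i_k} is the
   coefficient of dx^{i_1} /\ ... /\ dx^{i_k}. *)
Notation ext R n := {ffun {set 'I_n.+1} -> R^o}.
Notation lform R n := ('rV[R]_n.+1 -> ext R n).

Section Local.
Variables (R : realType) (n : nat).
Local Notation pt := 'rV[R]_n.+1.
Local Notation idx := 'I_n.+1.
Local Notation ext := (ext R n).
Local Notation lform := (lform R n).
Implicit Types (i j l m : idx) (x : pt) (f s : pt -> R) (g : pt -> 'M[R]_n.+1).

Definition half_space : set pt := [set x | 0 <= x ord0 ord0].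

(* Partial derivative relative to the half-space: two-sided, except that it is
   one-sided for i = 0 at a boundary point. *)
Definition diff_quot i f x (h : R) : R :=
  h^-1 * (f (x + h *: delta_mx ord0 i) - f x).

Definition diff_filter i x : set_system R :=
  within [set h | half_space (x + h *: delta_mx ord0 i)] 0^'.

Definition pdable i f x : Prop := cvg (diff_quot i f x @ diff_filter i x).

Definition pd i f x : R := lim (diff_quot i f x @ diff_filter i x).

(* V is meant to be relatively open in the half-space; then smooth_on V f is
   smoothness up to the boundary. *)
Fixpoint Ck_on (k : nat) (V : set pt) f : Prop :=
  {within V, continuous f} /\
  (if k is k'.+1 then
     forall i, (forall x, V x -> pdable i f x) /\ Ck_on k' V (pd i f)
   else True).

Definition smooth_on (V : set pt) f : Prop := forall k, Ck_on k V f.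

Definition dcov f (x : pt) : 'rV[R]_n.+1 := \row_i pd i f x.

(* dx^i /\ _ and the contraction with d/dx^i *)
Definition eps i (A : ext) : ext :=
  [ffun S : {set idx} => if i \in S
     then (-1) ^+ #|[pred j in S | (j < i)%N]| * A (S :\ i) else 0].

Definition iot i (A : ext) : ext :=
  [ffun S : {set idx} => if i \notin S
     then (-1) ^+ #|[pred j in S | (j < i)%N]| * A (i |: S) else 0].

Definition ext1 : ext := [ffun S : {set idx} => (#|S| == 0%N)%:R].

(* Pull-back by the linear map whose matrix J i j is the coefficient of dx^i in
   the pull-back of dy^j. *)
Definition pullback (J : 'M[R]_n.+1) (A : ext) : ext :=
  \sum_(S : {set idx})
    A S *: foldr (fun j B => \sum_i J i j *: eps i B) ext1 (enum S).

(* (g x)^{-1} holds the components g^{ij}. *)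
Definition ginv g (x : pt) : 'M[R]_n.+1 := invmx (g x).

(* Gamma^l_{ij} *)
Definition christoffel g l i j (x : pt) : R :=
  2^-1 * \sum_m ginv g x l m *
    (pd i (fun z => g z m j) x + pd j (fun z => g z m i) x
     - pd m (fun z => g z i j) x).

(* R_{ij}; positive for round spheres *)
Definition ricci g (x : pt) : 'M[R]_n.+1 :=
  \matrix_(i, j)
    (\sum_l (pd l (christoffel g l i j) x - pd j (christoffel g l l i) x)
     + \sum_l \sum_m
         (christoffel g l l m x * christoffel g m i j x
          - christoffel g l j m x * christoffel g m l i x)).

(* J and P solve Ric = (d-2) P + J g, J = tr P. *)
Definition Jtrace g (x : pt) : R :=
  (2 * n%:R)^-1 * \sum_i \sum_j ginv g x i j * ricci g x i j.

Definition schouten g (x : pt) : 'M[R]_n.+1 :=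
  (n.+1%:R - 2)^-1 *: (ricci g x - Jtrace g x *: g x).

Definition nabla g i (A : lform) : lform := fun x =>
  ([ffun S : {set idx} => pd i (fun z => A z S) x] : ext)
  - \sum_j \sum_l christoffel g l i j x *: eps j (iot l (A x)).

Definition ext_d g (A : lform) : lform := fun x =>
  \sum_i eps i (nabla g i A x).

Definition codiff g (A : lform) : lform := fun x =>
  \sum_i \sum_j ginv g x i j *: iot i (nabla g j A x).

Definition form_lap g (A : lform) : lform := fun x =>
  ext_d g (codiff g A) x + codiff g (ext_d g A) x.

(* the derivation induced by P^a_b *)
Definition schouten_ext g (A : lform) : lform := fun x =>
  \sum_i \sum_j (ginv g x *m schouten g x) i j *: eps j (iot i (A x)).

(* J - 2 P acting on forms *)
Definition JmP g (A : lform) : lform := fun x =>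
  Jtrace g x *: A x - 2 *: schouten_ext g A x.

Definition epsv (u : pt -> 'rV[R]_n.+1) (A : lform) : lform := fun x =>
  \sum_i u x ord0 i *: eps i (A x).

Definition iotv g (u : pt -> 'rV[R]_n.+1) (A : lform) : lform := fun x =>
  \sum_i \sum_j (ginv g x i j * u x ord0 j) *: iot i (A x).

Definition rho g s (x : pt) : R :=
  - n.+1%:R^-1 *
  (\sum_i \sum_j ginv g x i j *
     (pd i (pd j s) x - \sum_l christoffel g l i j x * pd l s x)
   + Jtrace g x * s x).

(* Tractor forms in a scale, with slots F^+, F, F^{+-}, F^-. *)
Record slots : Type :=
  Slots { north : lform; west : lform; east : lform; south : lform }.

Definition slots_at (F : slots) (x : pt) : ext * ext * ext * ext :=
  (north F x, west F x, east F x, south F x).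

Definition slots_add (F G : slots) : slots :=
  Slots (fun x => north F x + north G x) (fun x => west F x + west G x)
        (fun x => east F x + east G x) (fun x => south F x + south G x).

Definition slots_scale f (F : slots) : slots :=
  Slots (fun x => f x *: north F x) (fun x => f x *: west F x)
        (fun x => f x *: east F x) (fun x => f x *: south F x).

(* Passage from the scale g to Om^2 g for T^k M[w], with Upsilon = d log Om;
   the powers of Om come from the weights w + k and w + k - 2 of the slots. *)
Definition tractor_change g (Om : pt -> R) (k : int) (w : R) (F : slots) :
    slots :=
  let ups := dcov (fun z => ln (Om z)) in
  let E := epsv ups in let I := iotv g ups in
  Slots
    (fun x => (Om x `^ (w + k%:~R)) *: north F x)
    (fun x => (Om x `^ (w + k%:~R)) *: (west F x + E (north F) x))
    (fun x => (Om x `^ (w + k%:~R - 2)) *: (east F x - I (north F) x))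
    (fun x => (Om x `^ (w + k%:~R - 2)) *:
       (south F x + 2^-1 *: (E (I (north F)) x - I (E (north F)) x)
        - I (west F) x - E (east F) x)).

Definition Xstar_loc (F : slots) : slots :=
  Slots (fun=> 0) (north F) (fun=> 0) (east F).

Definition Istar_loc g s (F : slots) : slots :=
  let I := iotv g (dcov s) in
  Slots
    (fun x => - I (north F) x - s x *: east F x)
    (fun x => rho g s x *: north F x + I (west F) x + s x *: south F x)
    (I (east F))
    (fun x => rho g s x *: east F x - I (south F) x).

(* script D on T^k M[w] *)
Definition Dop_loc g (k : int) (w : R) (F : slots) : slots :=
  let d : R := n.+1%:R in let r : R := k%:~R in
  Slots
    (fun x => (d + 2 * w - 2) *: ((w + r) *: west F x - ext_d g (north F) x))
    (fun x => (d + 2 * w - 2) *: ext_d g (west F) x)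
    (fun x => form_lap g (north F) x + (w + r - 2) *: JmP g (north F) x
              - 2 *: codiff g (west F) x
              + (d + 2 * w) *:
                  (ext_d g (east F) x + (w + r - 2) *: south F x))
    (fun x => (JmP g (ext_d g (north F)) x - ext_d g (JmP g (north F)) x)
              - (form_lap g (west F) x + (w + r) *: JmP g (west F) x)
              - (d + 2 * w) *: ext_d g (south F) x).

(* y on T^k M[w]; I^* lands in T^{k-1} M[w] *)
Definition yop_loc g s (k : int) (w : R) (F : slots) : slots :=
  slots_scale (fun=> -1)
    (slots_add (Istar_loc g s (Dop_loc g k w F))
               (Dop_loc g (k - 1) w (Istar_loc g s F))).

(* only meaningful on the kernel of X^* *)
Definition Dhat_star_loc g (k : int) (w : R) (F : slots) : slots :=
  Slots (fun=> 0)
    (fun x => codiff g (west F) x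
              + (n.+1%:R + w - k%:~R) *: south F x)
    (fun=> 0)
    (fun x => - codiff g (south F) x).

(* epsilon-tilde and iota-tilde on j-forms of weight v *)
Definition eps_tilde g s (v : R) (A : lform) : lform := fun x =>
  v *: epsv (dcov s) A x - s x *: ext_d g A x.

Definition iot_tilde g s (j : int) (v : R) (A : lform) : lform := fun x =>
  (n.+1%:R + v - 2 * j%:~R) *: iotv g (dcov s) A x - s x *: codiff g A x.

(* D_[3] on T^k M[w] *)
Definition D3_loc g s (k : int) (w : R) (F : slots) : slots :=
  let E := epsv (dcov s) in
  Slots (fun=> 0) (fun=> 0)
    (fun x => eps_tilde g s (w + k%:~R) (west F) x
              - E (ext_d g (north F)) x)
    (E (ext_d g (west F))).

(* D^*_[3] on T^k M[w].  The south slot is iota(nu) delta = - delta iota(nu)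
   applied to F^{+-}: this sign is the one for which the result obeys the
   transformation law of T^{k-3} M[w]. *)
Definition D3star_loc g s (k : int) (w : R) (F : slots) : slots :=
  let I := iotv g (dcov s) in
  Slots (fun=> 0)
    (fun x => iot_tilde g s (k - 2) (w + k%:~R - 2) (east F) x
              - codiff g (I (north F)) x)
    (fun=> 0)
    (fun x => - codiff g (I (east F)) x).

Definition Pi_loc g s (k : int) (w : R) (F : slots) : slots :=
  slots_scale (fun=> ((w + k%:~R) * (n%:R + w - k%:~R))^-1)
    (D3star_loc g s (k + 3) w (D3_loc g s k w F)).

End Local.

Record manifold (R : realType) (n : nat) := Manifold {
  carrier :> topologicalType;
  hausdorff_carrier : hausdorff_space carrier;
  second_countable_carrier : @second_countable carrier;
  chart_index : Type;
  dom : chart_index -> set carrier;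
  chart : chart_index -> carrier -> 'rV[R]_n.+1;
  chart_inv : chart_index -> 'rV[R]_n.+1 -> carrier;
  dom_open : forall a, open (dom a);
  dom_cover : forall p, exists a, dom a p;
  chart_im_open : forall a, exists2 O : set 'rV[R]_n.+1,
    open O & chart a @` dom a = O `&` @half_space R n;
  chartK : forall a p, dom a p -> chart_inv a (chart a p) = p;
  chart_continuous : forall a, {within dom a, continuous (chart a)};
  chart_inv_continuous : forall a,
    {within chart a @` dom a, continuous (chart_inv a)};
  transition_smooth : forall a b (i : 'I_n.+1),
    smooth_on (chart a @` (dom a `&` dom b))
      (fun x => chart b (chart_inv a x) ord0 i) }.

Section Global.
Variables (R : realType) (n : nat) (M : manifold R n).
Local Notation pt := 'rV[R]_n.+1.
Implicit Types (U : set M) (p : M) (a b : chart_index M).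

(* tensor fields, as families of components indexed by the charts *)
Definition metric_field := chart_index M -> pt -> 'M[R]_n.+1.
Definition form_field := chart_index M -> lform R n.
(* a density, resp. a tractor form, as a family indexed by the scales *)
Definition density_field := metric_field -> M -> R.
Definition tractor_field := metric_field -> chart_index M -> slots R n.

Definition boundary : set M :=
  [set p | exists2 a, dom a p & chart a p ord0 ord0 = 0].

Definition interior_pts : set M := ~` boundary.

Definition chart_im a U : set pt := chart a @` (dom a `&` U).

Definition in_chart (f : M -> R) a (x : pt) : R := f (chart_inv a x).

Definition jac a b (x : pt) : 'M[R]_n.+1 :=
  \matrix_(i, j) pd i (fun z => chart b (chart_inv a z) ord0 j) x.

Definition smooth_fun (f : M -> R) : Prop :=
  forall a, smooth_on (chart_im a setT) (in_chart f a).

Definition is_metric (g : metric_field) : Prop :=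
  [/\ forall a i j, smooth_on (chart_im a setT) (fun x => g a x i j),
      forall a p, dom a p -> (g a (chart a p))^T = g a (chart a p),
      forall a p (u : 'rV[R]_n.+1), dom a p -> u != 0 ->
        0 < (u *m g a (chart a p) *m u^T) ord0 ord0
    & forall a b p, dom a p -> dom b p ->
        g a (chart a p) =
        jac a b (chart a p) *m g b (chart b p) *m (jac a b (chart a p))^T].

(* gh = Om^2 g *)
Definition rescales (Om : M -> R) (g gh : metric_field) : Prop :=
  [/\ smooth_fun Om, forall p, 0 < Om p
    & forall a p, dom a p ->
        gh a (chart a p) = (Om p) ^+ 2 *: g a (chart a p)].

Definition conformal_class (c : set metric_field) : Prop :=
  exists2 g0, is_metric g0 &
    forall g, c g <-> is_metric g /\ exists Om, rescales Om g0 g.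

Definition is_form U (j : int) (A : form_field) : Prop :=
  [/\ forall a S, smooth_on (chart_im a U) (fun x => A a x S),
      forall a p S, dom a p -> U p -> A a (chart a p) S != 0 -> #|S|%:Z = j
    & forall a b p, dom a p -> dom b p -> U p ->
        A a (chart a p) = pullback (jac a b (chart a p)) (A b (chart b p))].

Variable c : set metric_field.

(* smooth sections of E M[w] *)
Definition is_density (w : R) (mu : density_field) : Prop :=
  (forall g, c g -> smooth_fun (mu g)) /\
  (forall g gh Om, c g -> c gh -> rescales Om g gh ->
     forall p, mu gh p = Om p `^ w * mu g p).

(* smooth sections of T^k M[w] over U *)
Definition is_tractor U (k : int) (w : R) (F : tractor_field) : Prop :=
  (forall g, c g ->
     [/\ is_form U (k - 1) (fun a => north (F g a)),
         is_form U k (fun a => west (F g a)),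
         is_form U (k - 2) (fun a => east (F g a))
       & is_form U (k - 1) (fun a => south (F g a))]) /\
  (forall g gh Om, c g -> c gh -> rescales Om g gh ->
     forall a p, dom a p -> U p ->
       slots_at (F gh a) (chart a p) =
       slots_at (tractor_change (g a) (in_chart Om a) k w (F g a))
                (chart a p)).

Definition vanishes U (F : tractor_field) : Prop :=
  forall g a p, c g -> dom a p -> U p ->
    slots_at (F g a) (chart a p) = (0, 0, 0, 0).

Variable sigma : density_field.

Definition poincare_einstein : Prop :=
  [/\ conformal_class c /\ is_density 1 sigma,
      forall g p, c g -> interior_pts p -> 0 < sigma g p,
      forall g p, c g -> boundary p -> sigma g p = 0,
      forall g a p, c g -> dom a p -> boundary p ->
        dcov (in_chart (sigma g) a) (chart a p) != 0
    & forall g a p, c g -> dom a p -> interior_pts p ->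
        let go := fun x => (in_chart (sigma g) a x) ^- 2 *: g a x in
        ricci go (chart a p) = - n%:R *: go (chart a p)].

Definition Xstar (F : tractor_field) : tractor_field :=
  fun g a => Xstar_loc (F g a).

Definition Istar (F : tractor_field) : tractor_field :=
  fun g a => Istar_loc (g a) (in_chart (sigma g) a) (F g a).

Definition yop (k : int) (w : R) (F : tractor_field) : tractor_field :=
  fun g a => yop_loc (g a) (in_chart (sigma g) a) k w (F g a).

Definition Dhat_star (k : int) (w : R) (F : tractor_field) : tractor_field :=
  fun g a => Dhat_star_loc (g a) k w (F g a).

Definition holo_proj (k : int) (w : R) (F : tractor_field) : tractor_field :=
  fun g a => Pi_loc (g a) (in_chart (sigma g) a) k w (F g a).

Definition sigma_pow (alpha : R) (F : tractor_field) : tractor_field :=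
  fun g a => slots_scale (fun x => in_chart (sigma g) a x `^ alpha) (F g a).

(* F = O(sigma^alpha) for F of type T^k M[w]: F is sigma^alpha times a section
   that is smooth up to the boundary.  The equality is required off the
   boundary, where sigma^alpha makes sense for every real alpha; when
   alpha >= 0 and F is continuous on M it extends to the boundary. *)
Definition is_Osigma (k : int) (w alpha : R) (F : tractor_field) : Prop :=
  exists2 B, is_tractor setT k (w - alpha) B &
    forall g a p, c g -> dom a p -> interior_pts p ->
      slots_at (F g a) (chart a p) =
      slots_at (sigma_pow alpha B g a) (chart a p).

End Global.

Arguments boundary {R n} M _.
Arguments interior_pts {R n} M _.

(* Main.v *)
Require Import Defs.
From HB Require Import structures.
From mathcomp Require Import all_boot all_order all_algebra.
From mathcomp Require Import all_classical all_reals all_analysis.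
From mathcomp Require Import ring lra.
Import Order.TTheory GRing.Theory Num.Theory numFieldNormedType.Exports.

Set Implicit Arguments.
Unset Strict Implicit.
Unset Printing Implicit Defensive.

Local Open Scope classical_set_scope.
Local Open Scope ring_scope.

(* On sections F = (0, A, 0, phi) of T^k M[w] killed by I^*, D-hat^* and X^*,
   the Poincare-Einstein equations (in the form nabla nu + sigma P + rho g = 0,
   |nu|^2 + 2 rho sigma = 1) and Cartan-type identities for d and delta give,
   off the boundary,
       sigma y F = D^*_[3] D_[3] F - (w + k) (n + w - k) F.
   Moreover Q = D^*_[3] D_[3] takes values in the common kernel and is
   tangential: Q sigma^b = sigma^b Q, the weights being shifted accordingly.
   The scalar kappa = (w + k) (n + w - k) has the same value at w = - w0 - n and
   at w0.  So if y A = sigma^l B, the identity for A reads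
   Pi A = kappa^-1 Q A = A + kappa^-1 sigma^(l + 1) B, and the identity for
   sigma^b Pi A then yields y (sigma^b Pi A) = sigma^(b + l) kappa^-1 Q B.
   The section kappa^-1 Q B is smooth up to the boundary and is a tractor
   because Q is natural under changes of charts and of scales. *)

(** * Exterior algebra *)

Section ExteriorAlgebra.
Variables (R : realType) (n : nat).
Local Notation idx := 'I_n.+1.
Local Notation ext := (ext R n).
Implicit Types (i j k : idx) (S : {set idx}) (A B : ext) (u v : 'rV[R]_n.+1)
  (J K : 'M[R]_n.+1) (m : int).

(** Only west slots need real work. On the common kernel the north and east slots vanish and
    [iota(nu)] of the west slot is - sigma times the south slot, so off the boundary a division by
    sigma recovers the south slot, for A as well as for y A. The scalar kappa comes from the
    constant 1 in |nu|^2 = 1 - 2 rho sigma. Its two values agree because w -> - n - w exchanges its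
    two factors up to sign. The exponent h0 - 1 is the gap between the weights - w0 - n and w0. Q
    involves no division by sigma, so Q B makes sense up to the boundary. The equation for y A shows
    that the north slot of B vanishes off the boundary only; [holo_eps] therefore keeps the north
    slot as an argument, and naturality is proved for arbitrary tractors. Two obstacles shape the
    preliminaries. Derivatives at boundary points are one-sided, so the chain rule for transition
    maps and the symmetry of mixed derivatives are derived from a mean value theorem inside the
    half-space. And delta delta = 0, on which the kernel equations for Q rest, is proved by raising
    all indices, which turns delta into a divergence. *)

Definition esgn i S : R := (-1) ^+ #|[pred j in S | (j < i)%N]|.

Lemma esgnD1 i j S : i \in S -> esgn j (S :\ i) = (-1) ^+ (i < j)%N * esgn j S.
Proof.
move=> iS; rewrite /esgn (cardD1 i [pred k in S | (k < j)%N]) !inE iS /=.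
rewrite exprD mulrA -exprD addnn -mul2n exprM sqrrN expr1n expr1n mul1r.
by congr (_ ^+ _); apply: eq_card => k; rewrite !inE andbA.
Qed.

Lemma esgnU1 i j S : i \notin S -> esgn j (i |: S) = (-1) ^+ (i < j)%N * esgn j S.
Proof.
move=> iS; have := @esgnD1 i j (i |: S); rewrite finset.setU1K // setU11 => -> //.
by rewrite mulrA -exprD addnn -mul2n exprM sqrrN expr1n expr1n mul1r.
Qed.

Lemma esgn_sq i S : esgn i S * esgn i S = 1.
Proof. by rewrite /esgn -exprD addnn -mul2n exprM sqrrN expr1n expr1n. Qed.

Lemma esgnD1s i S : esgn i (S :\ i) = esgn i S.
Proof.
have [iS|iS] := boolP (i \in S); first by rewrite esgnD1 // ltnn mul1r.
by congr (esgn _ _); apply/finset.setDidPl; rewrite disjoint_sym disjoints1.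
Qed.

Lemma esgnU1s i S : esgn i (i |: S) = esgn i S.
Proof.
have [iS|iS] := boolP (i \in S); last by rewrite esgnU1 // ltnn mul1r.
by congr (esgn _ _); apply/finset.setUidPr; rewrite finset.sub1set.
Qed.

Lemma extDE A B S : (A + B) S = A S + B S. Proof. by rewrite ffunE. Qed.
Lemma extNE A S : (- A) S = - A S. Proof. by rewrite ffunE. Qed.
Lemma extZE (a : R) A S : (a *: A) S = a * A S. Proof. by rewrite ffunE. Qed.
Lemma ext0E S : (0 : ext) S = 0. Proof. by rewrite ffunE. Qed.

Lemma epsE i A S : eps i A S = if i \in S then esgn i S * A (S :\ i) else 0.
Proof. by rewrite ffunE. Qed.

Lemma iotE i A S : iot i A S = if i \notin S then esgn i S * A (i |: S) else 0.
Proof. by rewrite ffunE. Qed.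

Fact eps_is_linear i : linear (@eps R n i).
Proof.
move=> a A B; apply/ffunP => S; rewrite !(epsE, extDE, extZE).
case: ifP => _; last by rewrite mulr0 addr0.
by rewrite mulrDr; congr (_ + _); rewrite mulrCA.
Qed.
HB.instance Definition _ i :=
  GRing.isLinear.Build R ext ext *:%R (@eps R n i) (eps_is_linear i).

Fact iot_is_linear i : linear (@iot R n i).
Proof.
move=> a A B; apply/ffunP => S; rewrite !(iotE, extDE, extZE).
case: ifP => _; last by rewrite mulr0 addr0.
by rewrite mulrDr; congr (_ + _); rewrite mulrCA.
Qed.
HB.instance Definition _ i :=
  GRing.isLinear.Build R ext ext *:%R (@iot R n i) (iot_is_linear i).

Lemma expN1_lt i j : i != j ->
  (-1) ^+ (i < j)%N = - (-1) ^+ (j < i)%N :> R.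
Proof.
by rewrite -val_eqE /= => /eqP ij; case: ltngtP ij => //= *;
  rewrite ?expr0 ?expr1 ?opprK.
Qed.

Lemma eps_eps i j A : eps i (eps j A) = - eps j (eps i A).
Proof.
apply/ffunP => S; rewrite extNE !epsE.
have [->|ij] := eqVneq i j.
  by rewrite setD11; case: ifP; rewrite ?mulr0 oppr0.
rewrite !in_setD1 ij [j == i]eq_sym ij /=.
case: ifP => iS; case: ifP => jS; rewrite ?mulr0 ?oppr0 //.
rewrite (esgnD1 _ iS) (esgnD1 _ jS) (expN1_lt ij) !mulNr mulrN; congr (- _).
have -> : S :\ i :\ j = S :\ j :\ i by apply/finset.setP => k; rewrite !in_setD1 andbCA.
by ring.
Qed.

Lemma iot_iot i j A : iot i (iot j A) = - iot j (iot i A).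
Proof.
apply/ffunP => S; rewrite extNE !iotE.
have [->|ij] := eqVneq i j.
  by rewrite setU11; case: ifP; rewrite ?mulr0 oppr0.
rewrite !in_setU1 [j == i]eq_sym (negPf ij) /=.
case: ifP => iS; case: ifP => jS; rewrite ?mulr0 ?oppr0 //.
rewrite (esgnU1 _ iS) (esgnU1 _ jS) (expN1_lt ij) !mulNr mulrN; congr (- _).
rewrite finset.setUCA; ring.
Qed.

Lemma iot_eps i j A : iot i (eps j A) = (i == j)%:R *: A - eps j (iot i A).
Proof.
apply/ffunP => S; rewrite extDE extNE extZE !(iotE, epsE).
have [<-|ij] := eqVneq i j.
  rewrite setU11 setD11 esgnU1s mul1r.
  have [iS|iS] := boolP (i \in S) => /=.
    by rewrite finset.setD1K // esgnD1s mulrA esgn_sq mul1r subrr.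
  by rewrite finset.setU1K // mulrA esgn_sq mul1r subr0.
rewrite mul0r sub0r in_setU1 in_setD1 [j == i]eq_sym (negPf ij) /=.
case: ifP => iS; case: ifP => jS; rewrite ?mulr0 ?oppr0 //.
rewrite (esgnU1 _ iS) (esgnD1 _ jS) (expN1_lt ij) !mulNr mulrN; congr (- _).
have -> : (i |: S) :\ j = i |: (S :\ j).
  apply/finset.setP => k; rewrite !(in_setD1, in_setU1).
  by have [->|] := eqVneq k i; rewrite // ij.
ring.
Qed.

(* Exterior multiplication by the covector, resp. contraction with the vector,
   of components f. *)
Definition ewf (f : idx -> R) A : ext := \sum_i f i *: eps i A.
Definition iwf (f : idx -> R) A : ext := \sum_i f i *: iot i A.

Fact ewf_is_linear f : linear (ewf f).
Proof.
move=> a A B; rewrite /ewf scaler_sumr -big_split; apply: eq_bigr => i _ /=.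
by rewrite linearP scalerDr !scalerA mulrC.
Qed.
HB.instance Definition _ f :=
  GRing.isLinear.Build R ext ext *:%R (ewf f) (ewf_is_linear f).

Fact iwf_is_linear f : linear (iwf f).
Proof.
move=> a A B; rewrite /iwf scaler_sumr -big_split; apply: eq_bigr => i _ /=.
by rewrite linearP scalerDr !scalerA mulrC.
Qed.
HB.instance Definition _ f :=
  GRing.isLinear.Build R ext ext *:%R (iwf f) (iwf_is_linear f).

Lemma eq_ewf f h A : f =1 h -> ewf f A = ewf h A.
Proof. by move=> fh; apply: eq_bigr => i _; rewrite fh. Qed.

Lemma eq_iwf f h A : f =1 h -> iwf f A = iwf h A.
Proof. by move=> fh; apply: eq_bigr => i _; rewrite fh. Qed.

Lemma ewfD f h A : ewf (fun i => f i + h i) A = ewf f A + ewf h A.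
Proof. by rewrite -big_split; apply: eq_bigr => i _; rewrite scalerDl. Qed.

Lemma iwfD f h A : iwf (fun i => f i + h i) A = iwf f A + iwf h A.
Proof. by rewrite -big_split; apply: eq_bigr => i _; rewrite scalerDl. Qed.

Lemma ewfZ a f A : ewf (fun i => a * f i) A = a *: ewf f A.
Proof. by rewrite scaler_sumr; apply: eq_bigr => i _; rewrite scalerA. Qed.

Lemma iwfZ a f A : iwf (fun i => a * f i) A = a *: iwf f A.
Proof. by rewrite scaler_sumr; apply: eq_bigr => i _; rewrite scalerA. Qed.

Lemma ewf_sum (I : finType) (f : I -> idx -> R) A :
  ewf (fun i => \sum_a f a i) A = \sum_a ewf (f a) A.
Proof.
by rewrite exchange_big; apply: eq_bigr => i _; rewrite scaler_suml.
Qed.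

Lemma iwf_sum (I : finType) (f : I -> idx -> R) A :
  iwf (fun i => \sum_a f a i) A = \sum_a iwf (f a) A.
Proof.
by rewrite exchange_big; apply: eq_bigr => i _; rewrite scaler_suml.
Qed.

Lemma ewf_delta i A : ewf (fun j => (j == i)%:R) A = eps i A.
Proof.
rewrite /ewf (bigD1 i) //= eqxx scale1r big1 ?addr0 // => j /negPf ->.
by rewrite scale0r.
Qed.

Lemma eps_ewf i f A : eps i (ewf f A) = - ewf f (eps i A).
Proof.
rewrite /ewf linear_sum -sumrN; apply: eq_bigr => j _.
by rewrite linearZ /= eps_eps scalerN.
Qed.

Lemma iot_iwf i f A : iot i (iwf f A) = - iwf f (iot i A).
Proof.
rewrite /iwf linear_sum -sumrN; apply: eq_bigr => j _.
by rewrite linearZ /= iot_iot scalerN.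
Qed.

Lemma ewf_ewf f h A : ewf f (ewf h A) = - ewf h (ewf f A).
Proof.
rewrite {1}/ewf [ewf f A]/ewf (linear_sum (ewf h)) -sumrN; apply: eq_bigr => i _.
by rewrite linearZ /= eps_ewf scalerN.
Qed.

Lemma iwf_iwf f h A : iwf f (iwf h A) = - iwf h (iwf f A).
Proof.
rewrite {1}/iwf [iwf f A]/iwf (linear_sum (iwf h)) -sumrN; apply: eq_bigr => i _.
by rewrite linearZ /= iot_iwf scalerN.
Qed.

Lemma opp_self0 A : A = - A -> A = 0.
Proof.
move=> AN; have /eqP : A + A = 0 by rewrite {2}AN subrr.
by rewrite -mulr2n -scaler_nat scaler_eq0 pnatr_eq0 => /eqP.
Qed.

Lemma ewf_same f A : ewf f (ewf f A) = 0.
Proof. exact/opp_self0/ewf_ewf. Qed.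

Lemma iwf_same f A : iwf f (iwf f A) = 0.
Proof. exact/opp_self0/iwf_iwf. Qed.

Lemma iot_ewf i f A : iot i (ewf f A) = f i *: A - ewf f (iot i A).
Proof.
rewrite linear_sum /=.
under eq_bigr => j _ do rewrite linearZ /= iot_eps scalerBr scalerA.
rewrite sumrB (bigD1 i) //= eqxx mulr1 big1 ?addr0 // => j /negPf.
by rewrite eq_sym => ->; rewrite mulr0 scale0r.
Qed.

Lemma iwf_eps i f A : iwf f (eps i A) = f i *: A - eps i (iwf f A).
Proof.
rewrite /iwf linear_sum /=.
under eq_bigr => j _ do rewrite iot_eps scalerBr scalerA.
rewrite sumrB (bigD1 i) //= eqxx mulr1 big1 ?addr0; last first.
  by move=> j /negPf ->; rewrite mulr0 scale0r.
by congr (_ - _); apply: eq_bigr => j _; rewrite linearZ.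
Qed.

Lemma iwf_ewf f h A :
  iwf f (ewf h A) = (\sum_i f i * h i) *: A - ewf h (iwf f A).
Proof.
rewrite {1}/iwf; under eq_bigr => j _ do rewrite iot_ewf scalerBr scalerA.
rewrite sumrB scaler_suml; congr (_ - _); rewrite [iwf f A]/iwf linear_sum.
by apply: eq_bigr => i _; rewrite linearZ.
Qed.

Definition ext_basis S : ext := [ffun T => (T == S)%:R].

Lemma ext_basisE A : A = \sum_S A S *: ext_basis S.
Proof.
apply/ffunP => T; rewrite sum_ffunE (bigD1 T) //= big1 => [|S /negPf ST].
  by rewrite addr0 extZE ffunE eqxx mulr1.
by rewrite extZE ffunE eq_sym ST mulr0.
Qed.

Lemma ext1_basis : ext1 R n = ext_basis finset.set0.
Proof. by apply/ffunP => S; rewrite !ffunE cards_eq0. Qed.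

Lemma eps_basis i S : eps i (ext_basis S) =
  if i \in S then 0 else esgn i S *: ext_basis (i |: S).
Proof.
apply/ffunP => T; rewrite epsE; case: ifP => [iT|/negbT iT].
  rewrite ffunE; case: ifP => [iS|/negbT iS].
    rewrite ext0E; case: eqP => [TS|_]; last by rewrite mulr0.
    by move: iS; rewrite -TS setD11.
  rewrite extZE ffunE; have -> : (T :\ i == S) = (T == i |: S).
    apply/eqP/eqP => [<-|->]; first by rewrite finset.setD1K.
    by rewrite finset.setU1K.
  by case: eqP => [->|_]; rewrite ?mulr0 // esgnU1s.
case: ifP => iS; rewrite ?ext0E // extZE ffunE.
by case: eqP => [TS|]; rewrite ?mulr0 //; move: iT; rewrite TS setU11.
Qed.

(** The algebra is generated from [ext1] by the operators [eps i] and linear combinations.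
    Identities between pull-backs, contractions and products thus reduce to the commutation rules
    with [eps i]; no sum over index sets has to be handled. *)
Lemma ext_ind (P : ext -> Prop) :
  P (ext1 R n) -> (forall i A, P A -> P (eps i A)) ->
  (forall a A B, P A -> P B -> P (a *: A + B)) -> forall A, P A.
Proof.
move=> P1 Pe PD A.
have P0 : P 0 by have := PD (-1) _ _ P1 P1; rewrite scaleN1r addNr.
have PS S : P (ext_basis S).
  have [m] := ubnP #|S|; elim: m S => // m IHm S Sm.
  have [->|[i iS]] := finset.set_0Vmem S; first by rewrite -ext1_basis.
  have iS' : i \notin S :\ i by rewrite setD11.
  have /(Pe i) : P (ext_basis (S :\ i)).
    by apply: IHm; move: Sm; rewrite (cardsD1 i) iS.
  rewrite eps_basis (negPf iS') finset.setD1K // => /(PD (esgn i (S :\ i)) _ 0).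
  by move=> /(_ P0); rewrite addr0 scalerA esgn_sq scale1r.
by rewrite (ext_basisE A); apply: big_ind => //= [B C PB PC|S _];
  [rewrite -[B]scale1r|rewrite -[_ *: _]addr0]; apply: PD.
Qed.

(** Links the two conventions for signs: [pullback] multiplies its factors in the order of [enum],
    while [eps] uses the sign [esgn]. The new index is inserted behind as many entries as the
    exponent of [esgn i S] counts. *)
Lemma enum_setU1 i S : i \notin S ->
  exists s1 s2, [/\ enum S = s1 ++ s2, enum (i |: S) = s1 ++ i :: s2
                  & size s1 = #|[pred j in S | (j < i)%N]|].
Proof.
(* These are the entries below and above [i]. Strictly increasing lists with the same members
   coincide, which settles both enumerations. *)
move=> iS; exists [seq j : idx <- enum S | (j < i)%N], [seq j : idx <- enum S | (i < j)%N].
pose lt := [rel a b : idx | (a < b)%N].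
have lt_tr : transitive lt by move=> a b d /=; apply: ltn_trans.
have lt_ir : irreflexive lt by move=> a /=; rewrite ltnn.
have srt T : sorted lt (enum (T : {set idx})).
  rewrite /enum_mem -enumT; apply: sorted_filter => //.
  have -> : sorted lt (enum 'I_n.+1) = sorted ltn (map val (enum 'I_n.+1)).
    by rewrite sorted_map.
  by rewrite val_enum_ord iota_ltn_sorted.
have ltsplit (s1 s2 : seq idx) : sorted lt s1 -> sorted lt s2 ->
    (forall a b, a \in s1 -> b \in s2 -> lt a b) -> sorted lt (s1 ++ s2).
  by move=> *; rewrite !(sorted_pairwise lt_tr) pairwise_cat
    -!(sorted_pairwise lt_tr); apply/and3P; split=> //; apply/allrelP.
split.
- apply: (irr_sorted_eq lt_tr lt_ir) => [||j].
  + exact: srt.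
  + apply: ltsplit; try exact/sorted_filter/srt.
    move=> a b; rewrite !mem_filter => /andP[+ _] /andP[+ _] /=.
    exact: ltn_trans.
  + rewrite mem_enum mem_cat mem_filter [X in _ || X]mem_filter !mem_enum.
    have [->|] := eqVneq j i; first by rewrite (negPf iS) !andbF.
    by rewrite -val_eqE /= => ji; case: ltngtP ji => //=; rewrite ?orbF.
- apply: (irr_sorted_eq lt_tr lt_ir) => [||j].
  + exact: srt.
  + apply: ltsplit; first exact/sorted_filter/srt.
      rewrite /= (path_sortedE lt_tr); apply/andP; split.
        by apply/allP => j; rewrite mem_filter => /andP[].
      exact/sorted_filter/srt.
    move=> a b; rewrite in_cons !mem_filter => /andP[/= ai _].
    by case/orP=> [/eqP ->|/andP[+ _]] //; apply: ltn_trans.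
  + rewrite mem_enum mem_cat in_cons mem_filter [X in _ || (_ || X)]mem_filter.
    rewrite !mem_enum in_setU1.
    have [->|] := eqVneq j i; first by rewrite ltnn.
    by rewrite -val_eqE /= => ji; case: ltngtP ji => //=; rewrite ?orbF.
rewrite size_filter -sum1_count -sum1_card big_enum_cond /=.
by apply: eq_bigl => j; rewrite !inE andbC.
Qed.

Definition wedges J (s : seq idx) : ext :=
  foldr (fun j B => ewf (J^~ j) B) (ext1 R n) s.

Lemma pullbackE J A : pullback J A = \sum_S A S *: wedges J (enum S).
Proof. by []. Qed.

Fact pullback_is_linear J : linear (pullback J).
Proof.
move=> a A B; rewrite !pullbackE scaler_sumr -big_split; apply: eq_bigr => S _.
by rewrite extDE extZE scalerDl scalerA.
Qed.
HB.instance Definition _ J :=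
  GRing.isLinear.Build R ext ext *:%R (pullback J) (pullback_is_linear J).

Lemma pullback_basis J S : pullback J (ext_basis S) = wedges J (enum S).
Proof.
rewrite pullbackE (bigD1 S) //= ffunE eqxx scale1r big1 ?addr0 // => T TS.
by rewrite ffunE (negPf TS) scale0r.
Qed.

Lemma pullback_ext1 J : pullback J (ext1 R n) = ext1 R n.
Proof. by rewrite ext1_basis pullback_basis enum_set0 -ext1_basis. Qed.

Lemma ewf_wedges_mem J i s : i \in s -> ewf (J^~ i) (wedges J s) = 0.
Proof.
elim: s => //= j s IHs; rewrite in_cons; have [->|ij /IHs s0] := eqVneq i j.
  by rewrite ewf_same.
by rewrite ewf_ewf s0 linear0 oppr0.
Qed.

Lemma ewf_wedges_cat J i s1 s2 : ewf (J^~ i) (wedges J (s1 ++ s2)) =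
  (-1) ^+ size s1 *: wedges J (s1 ++ i :: s2).
Proof.
elim: s1 => [|j s IHs] /=; first by rewrite expr0 scale1r.
by rewrite ewf_ewf IHs linearZ /= exprS mulN1r scaleNr.
Qed.

(** On a basis form containing [i] both sides vanish, the right one because of a repeated factor.
    Otherwise the new factor moves past [s1], and the sign so produced is [esgn i S]. *)
Lemma pullback_eps J i A : pullback J (eps i A) = ewf (J^~ i) (pullback J A).
Proof.
rewrite (ext_basisE A) (linear_sum (@eps R n i)) !(linear_sum (pullback J)).
rewrite (linear_sum (ewf _)); apply: eq_bigr => S _.
rewrite !linearZ /=; congr (_ *: _); rewrite eps_basis.
case: ifP => [iS|/negbT iS].
  by rewrite linear0 pullback_basis ewf_wedges_mem // mem_enum.
rewrite linearZ /= !pullback_basis.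
have [s1 [s2 [-> -> sz]]] := enum_setU1 iS.
by rewrite ewf_wedges_cat sz.
Qed.

Lemma pullback_ewf J f A : pullback J (ewf f A) =
  ewf (fun i => \sum_j J i j * f j) (pullback J A).
Proof.
rewrite linear_sum ewf_sum; apply: eq_bigr => j _; rewrite linearZ /=.
rewrite pullback_eps -ewfZ; apply: eq_ewf => i; exact: mulrC.
Qed.

Lemma iot_ext1 i : iot i (ext1 R n) = 0.
Proof.
apply/ffunP => S; rewrite iotE ext0E; case: ifP => // _.
by rewrite ffunE cards_eq0; case: eqP => [S0|_]; rewrite ?mulr0 //;
  have := setU11 i S; rewrite S0 finset.in_set0.
Qed.

(** Both sides obey the same anticommutation rule with [eps j], so [ext_ind] applies; the vector
    [J i] is the push-forward of the i-th coordinate vector. *)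
Lemma iot_pullback J i A : iot i (pullback J A) =
  pullback J (iwf (J i) A).
Proof.
elim/ext_ind: A => [|j A IH|a A B IHA IHB].
- rewrite pullback_ext1 iot_ext1 /iwf big1 ?linear0 // => k _.
  by rewrite iot_ext1 scaler0.
- by rewrite pullback_eps iot_ewf IH iwf_eps linearB linearZ /= pullback_eps.
by rewrite !linearP /= IHA IHB.
Qed.

Lemma pullback_comp J K A : pullback J (pullback K A) = pullback (J *m K) A.
Proof.
elim/ext_ind: A => [|j A IH|a A B IHA IHB]; first by rewrite !pullback_ext1.
  rewrite !pullback_eps pullback_ewf IH; apply: eq_ewf => i; by rewrite mxE.
by rewrite !linearP /= IHA IHB.
Qed.

Lemma pullback1 A : pullback 1%:M A = A.
Proof.
elim/ext_ind: A => [|j A IH|a A B IHA IHB]; first by rewrite !pullback_ext1.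
  by rewrite !pullback_eps IH -[RHS]ewf_delta; apply: eq_ewf => i; rewrite mxE.
by rewrite !linearP /= IHA IHB.
Qed.

Definition ext_deg (m : int) A := forall S, A S != 0 -> #|S|%:Z = m.

Lemma ext_degP m A : ext_deg m A <-> forall S, #|S|%:Z != m -> A S = 0.
Proof.
split=> dA S; first by move=> Sm; apply: contra_neq_eq Sm => /dA.
by move=> AS; apply: contra_neq_eq AS => /dA.
Qed.

Lemma ext_deg0 m : ext_deg m 0.
Proof. by move=> S; rewrite ext0E eqxx. Qed.

Lemma ext_degD m A B : ext_deg m A -> ext_deg m B -> ext_deg m (A + B).
Proof.
move=> /ext_degP dA /ext_degP dB; apply/ext_degP => S Sm.
by rewrite extDE dA ?dB ?addr0.
Qed.

Lemma ext_degZ m a A : ext_deg m A -> ext_deg m (a *: A).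
Proof.
by move=> /ext_degP dA; apply/ext_degP => S Sm; rewrite extZE dA ?mulr0.
Qed.

Lemma ext_degN m A : ext_deg m A -> ext_deg m (- A).
Proof. by rewrite -scaleN1r; apply: ext_degZ. Qed.

Lemma ext_deg_sum m (I : finType) (F : I -> ext) :
  (forall a, ext_deg m (F a)) -> ext_deg m (\sum_i F i).
Proof.
move=> dF; apply: (big_ind (ext_deg m)) => //; first exact: ext_deg0.
by move=> *; apply: ext_degD.
Qed.

Lemma ext_deg_eps m i A : ext_deg m A -> ext_deg (m + 1) (eps i A).
Proof.
move=> dA S; rewrite epsE; case: ifP => [iS|]; last by rewrite eqxx.
rewrite mulf_eq0 negb_or => /andP[_ /dA]; rewrite [#|S|](cardsD1 i) iS => <-.
by rewrite PoszD addrC.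
Qed.

Lemma ext_deg_iot m i A : ext_deg m A -> ext_deg (m - 1) (iot i A).
Proof.
move=> dA S; rewrite iotE; case: ifP => [iS|]; last by rewrite eqxx.
rewrite mulf_eq0 negb_or => /andP[_ /dA]; rewrite cardsU1 iS => <-.
by rewrite PoszD addrAC subrr add0r.
Qed.

Lemma ext_deg_ewf m f A : ext_deg m A -> ext_deg (m + 1) (ewf f A).
Proof. by move=> dA; apply: ext_deg_sum => i; apply/ext_degZ/ext_deg_eps. Qed.

Lemma ext_deg_iwf m f A : ext_deg m A -> ext_deg (m - 1) (iwf f A).
Proof. by move=> dA; apply: ext_deg_sum => i; apply/ext_degZ/ext_deg_iot. Qed.

(** The number operator: in the coefficient at [S] every [i] in [S] reproduces [A S] once, the two
    signs [esgn i S] cancelling. *)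
Lemma sum_eps_iot m A : ext_deg m A -> \sum_i eps i (iot i A) = m%:~R *: A.
Proof.
move=> dA; apply/ffunP => S; rewrite sum_ffunE extZE.
under eq_bigr => i _ do rewrite epsE iotE setD11 /=.
transitivity (\sum_(i in S) A S).
  rewrite [RHS]big_mkcond; apply: eq_bigr => i _ /=; case: ifP => // iS.
  by rewrite finset.setD1K // esgnD1s mulrA esgn_sq mul1r.
rewrite sumr_const; have [->|/dA <-] := eqVneq (A S) 0.
  by rewrite mul0rn mulr0.
by rewrite mulr_natl.
Qed.

End ExteriorAlgebra.

(** * Calculus on the half-space *)

Section HalfSpaceCalculus.
Variables (R : realType) (n : nat).
Local Notation pt := 'rV[R]_n.+1.
Local Notation idx := 'I_n.+1.
Implicit Types (i j k : idx) (x y : pt) (V : set pt) (f g : pt -> R) (h t l : R).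

Definition relopen V := exists2 O : set pt, open O & V = O `&` @half_space R n.

(** [pd] is a limit and has a default value where the quotients diverge. Stating the differentiation
    rules for this relation yields existence and value together. *)
Definition is_pd i f x l : Prop := diff_quot i f x @ diff_filter i x --> l.

Definition axv i t : pt := t *: delta_mx ord0 i.

Lemma axvE i t j : axv i t ord0 j = t *+ (i == j).
Proof. by rewrite !mxE eqxx /= eq_sym mulr_natr. Qed.

Global Instance diff_filter_filter i x : Filter (diff_filter i x).
Proof. exact: within_filter. Qed.

Lemma half_space_axv i x t : half_space x -> 0 <= t -> half_space (x + axv i t).
Proof.
move=> hx t0; rewrite /half_space /= mxE axvE; apply: addr_ge0 => //.
exact: mulrn_wge0.
Qed.

(** Small positive increments never leave the half-space, so one-sided limits are taken along a
    proper filter and are unique. *)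
Lemma diff_filter_proper i x : half_space x -> ProperFilter (diff_filter i x).
Proof.
move=> hx; apply: Build_ProperFilter_ex => P.
rewrite /diff_filter /within /= => /nbhs_ballP [e /= e0 eP].
exists (e / 2); apply: eP.
- by rewrite /ball /= sub0r normrN gtr0_norm ?divr_gt0 // ltr_pdivrMr // ltr_pMr // ltr1n.
- by rewrite gt_eqF // divr_gt0.
- by apply: half_space_axv => //; rewrite ltW // divr_gt0.
Qed.

Lemma is_pdE i f x l : half_space x -> is_pd i f x l -> pd i f x = l.
Proof.
by move=> hx fl; have ? := @diff_filter_proper i x hx; apply: cvg_lim.
Qed.

Lemma is_pd_pdable i f x l : is_pd i f x l -> pdable i f x.
Proof. by move=> fl; apply/cvg_ex; exists l. Qed.

Lemma pdableP i f x : pdable i f x -> is_pd i f x (pd i f x).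
Proof. by []. Qed.

Lemma diff_filter_neq0 i x : \forall h \near diff_filter i x, h != 0.
Proof.
rewrite /diff_filter near_withinE near_withinE; near=> h => h0 _.
exact: h0.
Unshelve. all: by end_near. Qed.

Lemma diff_filter0 i x : id @ diff_filter i x --> (0 : R).
Proof.
apply: cvg_trans (@cvg_within _ _ _ _) _.
exact: cvg_within.
Qed.

Lemma diff_filter_half i x : \forall h \near diff_filter i x, half_space (x + axv i h).
Proof. by rewrite /diff_filter near_withinE; near=> h. Unshelve. all: by end_near. Qed.

Lemma cvg_axv i x (F : set_system R) : Filter F -> id @ F --> (0 : R) ->
  (fun h => x + axv i h) @ F --> x.
Proof.
move=> FF F0; rewrite -[X in _ --> X]addr0; apply: cvgD; first exact: cvg_cst.
by rewrite -(scale0r (delta_mx ord0 i)); apply: cvgZr_tmp.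
Qed.

(** Continuity along the axis follows from the derivative alone, so the product and chain rules
    require no separate continuity of [f]. *)
Lemma is_pd_cvg i f x l : is_pd i f x l ->
  (fun h => f (x + axv i h)) @ diff_filter i x --> f x.
Proof.
move=> fl; rewrite -[X in _ --> X]add0r -[X in X + _](mul0r l).
apply: (@cvg_trans _ ((fun h => h * diff_quot i f x h + f x) @ diff_filter i x)).
  apply: near_eq_cvg; apply: filterS (diff_filter_neq0 i x) => h h0.
  by rewrite /diff_quot mulrA divff // mul1r subrK.
by apply: cvgD; [apply: cvgM => //; exact: diff_filter0|exact: cvg_cst].
Qed.

Lemma near_axv i x V : relopen V -> V x ->
  \forall h \near diff_filter i x, V (x + axv i h).
Proof.
move=> [U oU VE]; rewrite VE; case=> Ux hx.
have HU : \forall h \near diff_filter i x, U (x + axv i h).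
  have /(_ U) := @cvg_axv i x _ (diff_filter_filter i x) (@diff_filter0 i x); apply.
  exact: open_nbhs_nbhs.
by apply: filterS2 (diff_filter_half i x) HU => h ? ?; split.
Qed.

Lemma is_pd_local i f g x l V : relopen V -> V x ->
  (forall y, V y -> f y = g y) -> is_pd i f x l -> is_pd i g x l.
Proof.
move=> oV Vx fg; apply: cvg_trans; apply: near_eq_cvg.
apply: filterS (near_axv i oV Vx) => h Vh.
by rewrite /diff_quot -/(axv i h) !fg.
Qed.

Lemma is_pd_ext i f g x l : f =1 g -> is_pd i f x l -> is_pd i g x l.
Proof. by move=> /funext ->. Qed.

Lemma is_pd_val i f x l l' : is_pd i f x l -> l = l' -> is_pd i f x l'.
Proof. by move=> ? <-. Qed.

Lemma is_pd_cst i (a : R) x : is_pd i (fun=> a) x 0.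
Proof.
apply: (@cvg_trans _ ((fun=> 0 : R) @ diff_filter i x)); last exact: cvg_cst.
by apply: near_eq_cvg; near=> h; rewrite /diff_quot subrr mulr0.
Unshelve. all: by end_near. Qed.

Lemma is_pdD i f g x l l' : is_pd i f x l -> is_pd i g x l' ->
  is_pd i (fun y => f y + g y) x (l + l').
Proof.
move=> fl gl; apply: cvg_trans (cvgD fl gl); apply: near_eq_cvg.
by near=> h; rewrite /diff_quot /= fctE -mulrDr; congr (_ * _); ring.
Unshelve. all: by end_near. Qed.

Lemma is_pdM i f g x l l' : is_pd i f x l -> is_pd i g x l' ->
  is_pd i (fun y => f y * g y) x (l * g x + f x * l').
Proof.
move=> fl gl; have gx := is_pd_cvg gl.
apply: (@cvg_trans _ ((fun h => diff_quot i f x h * g (x + axv i h) +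
    f x * diff_quot i g x h) @ diff_filter i x)).
  by apply: near_eq_cvg; near=> h; rewrite /diff_quot -/(axv i h); ring.
by apply: cvgD; [exact: cvgM|apply: cvgM => //; exact: cvg_cst].
Unshelve. all: by end_near. Qed.

Lemma is_pdZ i (a : R) f x l : is_pd i f x l ->
  is_pd i (fun y => a * f y) x (a * l).
Proof.
move=> fl; apply: is_pd_val (is_pdM (is_pd_cst i a x) fl) _.
by rewrite mul0r add0r.
Qed.

Lemma is_pdN i f x l : is_pd i f x l -> is_pd i (fun y => - f y) x (- l).
Proof.
move=> /(is_pdZ (a := -1)); rewrite mulN1r; apply: is_pd_ext => y; exact: mulN1r.
Qed.

Lemma is_pdB i f g x l l' : is_pd i f x l -> is_pd i g x l' ->
  is_pd i (fun y => f y - g y) x (l - l').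
Proof. by move=> fl /is_pdN; apply: is_pdD. Qed.

Lemma is_pd_sum i (I : finType) (P : pred I) (f : I -> pt -> R) x (l : I -> R) :
  (forall a, P a -> is_pd i (f a) x (l a)) ->
  is_pd i (fun y => \sum_(a | P a) f a y) x (\sum_(a | P a) l a).
Proof.
move=> fl; suff H s : is_pd i (fun y => \sum_(a <- s | P a) f a y) x
    (\sum_(a <- s | P a) l a) by exact: H.
elim: s => [|a s IHs].
  rewrite big_nil; apply: is_pd_ext (is_pd_cst i 0 x) => y.
  by rewrite big_nil.
rewrite big_cons; case: ifP => [Pa|Pa].
  apply: is_pd_ext (is_pdD (fl _ Pa) IHs) => y; by rewrite big_cons Pa.
by apply: is_pd_ext IHs => y; rewrite big_cons Pa.
Qed.

Lemma is_pd_comp i f x l (u : R -> R) (du : R) : is_pd i f x l ->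
  is_derive (f x) 1 u du -> is_pd i (fun y => u (f y)) x (du * l).
Proof.
move=> fl [/cvg_ex [m um] udu].
have um' : m = du by rewrite -udu; apply/esym/cvg_lim.
rewrite {m}um' /= in um.
(* Caratheodory's form of the derivative of [u]: [q] is continuous at [f x], and no division by zero
   occurs for increments at which [f] returns to the value [f x]. *)
pose q t := if t == f x then du else (u t - u (f x)) / (t - f x).
have qc : q @ f x --> du.
  apply/cvgrPdist_lt => e e0.
  move/cvgrPdist_lt : um => /(_ e e0).
  rewrite !near_simpl /dnbhs near_withinE => /nbhs_ballP [d /= d0 dP].
  apply/nbhs_ballP; exists d => //= t; rewrite /q.
  case: eqP => [_ _|/eqP tf]; [by rewrite subrr normr0|].
  rewrite /ball /= => td.
  have := dP (t - f x); rewrite /ball /= sub0r normrN distrC => /(_ td).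
  rewrite subr_eq0 => /(_ tf).
  by rewrite /GRing.scale /= mulr1 subrK mulrC.
have qx : q (f x) = du by rewrite /q eqxx.
apply: (@cvg_trans _ ((fun h => q (f (x + axv i h)) * diff_quot i f x h)
    @ diff_filter i x)).
  apply: near_eq_cvg; apply: filterS (diff_filter_neq0 i x) => h h0.
  rewrite /diff_quot -/(axv i h) /q.
  case: eqP => [->|/eqP tf]; first by rewrite !subrr !mulr0.
  by field; rewrite h0 subr_eq0 tf.
by apply: cvgM => //; exact: (cvg_comp _ _ (is_pd_cvg fl) qc).
Qed.

Lemma is_pdV i f x l : f x != 0 -> is_pd i f x l ->
  is_pd i (fun y => (f y)^-1) x (- l * (f x)^-1 * (f x)^-1).
Proof.
move=> f0 fl.
have : is_derive (f x) 1 (fun t : R => t^-1) (- (f x) ^- 2).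
  have := @is_deriveV R id (f x) 1 1 f0 _; rewrite /GRing.scale /= mulr1; exact.
move=> /(is_pd_comp fl) H; apply: is_pd_val H _.
by rewrite expr2 invfM !mulNr mulrC mulrA.
Qed.

Lemma is_pd_powR i f x l (a : R) : 0 < f x -> is_pd i f x l ->
  is_pd i (fun y => f y `^ a) x (a * f x `^ (a - 1) * l).
Proof. by move=> f0 fl; apply: is_pd_comp fl (is_derive1_powR a f0). Qed.

Lemma is_pd_ln i f x l : 0 < f x -> is_pd i f x l ->
  is_pd i (fun y => ln (f y)) x ((f x)^-1 * l).
Proof. by move=> f0 fl; apply: is_pd_comp fl (is_derive1_ln f0). Qed.

End HalfSpaceCalculus.

(** * Functions smooth up to the boundary *)

Section Smooth.
Variables (R : realType) (n : nat).
Local Notation pt := 'rV[R]_n.+1.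
Local Notation idx := 'I_n.+1.
Implicit Types (i j : idx) (x y : pt) (U : set pt) (f g : pt -> R) (k : nat).

Lemma relopen_half V x : @relopen R n V -> V x -> half_space x.
Proof. by move=> [U _ ->] []. Qed.

Lemma relopenI V W : @relopen R n V -> relopen W -> relopen (V `&` W).
Proof.
move=> [U oU ->] [U' oU' ->]; exists (U `&` U'); first exact: openI.
by rewrite setIACA setIid.
Qed.

Lemma contP V f : {within V, continuous f} <->
  (forall x, V x -> f @ within V (nbhs x) --> f x).
Proof. exact: subspace_continuousP. Qed.

Lemma Ck_onW V U k f : V `<=` U -> Ck_on k U f -> Ck_on k V f.
Proof.
move=> VU; elim: k f => [|k IHk] f [cf df]; split=> //.
- exact: continuous_subspaceW cf.
- exact: continuous_subspaceW cf.
- by move=> i; have [dfi ckf] := df i; split; [move=> x /VU /dfi|exact: IHk].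
Qed.

Lemma smooth_onW V U f : V `<=` U -> smooth_on U f -> smooth_on V f.
Proof. by move=> VU sf k; apply: Ck_onW (sf k). Qed.

Lemma Ck_onS V k f : Ck_on k.+1 V f -> Ck_on k V f.
Proof.
elim: k f => [|k IHk] f [cf df]; split=> // i.
by have [dfi /IHk] := df i.
Qed.

Variable V : set pt.
Hypothesis hV : relopen V.
Let half x : V x -> half_space x. Proof. exact: relopen_half. Qed.

Lemma is_pd_on i f x l : V x -> is_pd i f x l -> pd i f x = l.
Proof. by move=> /half; apply: is_pdE. Qed.

Lemma pd_local i f g x : V x -> (forall y, V y -> f y = g y) ->
  pdable i f x -> pd i g x = pd i f x.
Proof. by move=> Vx fg /pdableP /(is_pd_local hV Vx fg); apply: is_pd_on. Qed.

Lemma Ck_on_eq k f g : (forall x, V x -> f x = g x) -> Ck_on k V f -> Ck_on k V g.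
Proof.
elim: k f g => [|k IHk] f g fg [cf df].
  split=> //; apply: subspace_eq_continuous cf => x.
  by rewrite inE => /fg.
split; first by apply: subspace_eq_continuous cf => x; rewrite inE => /fg.
move=> i; have [dfi ckf] := df i; split.
  by move=> x Vx; apply/is_pd_pdable/(is_pd_local hV Vx fg)/pdableP/dfi.
by apply: IHk ckf => x Vx; rewrite (pd_local Vx fg) //; apply: dfi.
Qed.

Lemma smooth_on_eq f g : (forall x, V x -> f x = g x) ->
  smooth_on V f -> smooth_on V g.
Proof. by move=> fg sf k; apply: Ck_on_eq (sf k). Qed.

Lemma Ck_on_is_pd k f i x : Ck_on k.+1 V f -> V x -> is_pd i f x (pd i f x).
Proof. by move=> [_ /(_ i) [df _]] /df. Qed.

Lemma Ck_on_pd k f i : Ck_on k.+1 V f -> Ck_on k V (pd i f).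
Proof. by move=> [_ /(_ i) []]. Qed.

(** Explicit candidates [df] give existence and regularity of the partial derivatives at once. They
    agree with [pd i f] on [V] only, which suffices since [V] is relatively open. *)
Lemma Ck_on_build k f (df : idx -> pt -> R) : {within V, continuous f} ->
  (forall i x, V x -> is_pd i f x (df i x)) -> (forall i, Ck_on k V (df i)) ->
  Ck_on k.+1 V f.
Proof.
move=> cf dfP ckf; split=> // i; split.
  by move=> x Vx; apply: is_pd_pdable (dfP i x Vx).
by apply: Ck_on_eq (ckf i) => x Vx; apply/esym/is_pd_on/dfP.
Qed.

Lemma Ck_on_cst k (a : R) : Ck_on k V (fun=> a).
Proof.
have ca b : {within V, continuous (fun=> b : R)}.
  by apply/contP => x _; apply: cvg_cst.
elim: k a => [|k IHk] a; first by split.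
apply: (@Ck_on_build k _ (fun _ _ => 0)) => // i x _; exact: is_pd_cst.
Qed.

Lemma Ck_onD k f g : Ck_on k V f -> Ck_on k V g -> Ck_on k V (fun x => f x + g x).
Proof.
elim: k f g => [|k IHk] f g fk gk.
  split=> //; have [/contP cf _] := fk; have [/contP cg _] := gk.
  by apply/contP => x Vx; apply: cvgD; [apply: cf|apply: cg].
apply: (@Ck_on_build k _ (fun i x => pd i f x + pd i g x)).
- have [/contP cf _] := fk; have [/contP cg _] := gk.
  by apply/contP => x Vx; apply: cvgD; [apply: cf|apply: cg].
- by move=> i x Vx; apply: is_pdD; apply: Ck_on_is_pd Vx; eauto.
- by move=> i; apply: IHk; apply: Ck_on_pd.
Qed.

Lemma Ck_onM k f g : Ck_on k V f -> Ck_on k V g -> Ck_on k V (fun x => f x * g x).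
Proof.
elim: k f g => [|k IHk] f g fk gk.
  split=> //; have [/contP cf _] := fk; have [/contP cg _] := gk.
  by apply/contP => x Vx; apply: cvgM; [apply: cf|apply: cg].
apply: (@Ck_on_build k _ (fun i x => pd i f x * g x + f x * pd i g x)).
- have [/contP cf _] := fk; have [/contP cg _] := gk.
  by apply/contP => x Vx; apply: cvgM; [apply: cf|apply: cg].
- by move=> i x Vx; apply: is_pdM; apply: Ck_on_is_pd Vx; eauto.
- by move=> i; apply: Ck_onD; apply: IHk; do ?[exact: Ck_on_pd|exact: Ck_onS].
Qed.

Lemma Ck_on_cont k f x : Ck_on k V f -> V x -> f @ within V (nbhs x) --> f x.
Proof. by case: k => [|k] [/contP cf _]; exact: cf. Qed.

Lemma Ck_on_within k f : Ck_on k V f -> {within V, continuous f}.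
Proof. by case: k => [|k] []. Qed.

Lemma Ck_onV k f : (forall x, V x -> f x != 0) -> Ck_on k V f ->
  Ck_on k V (fun x => (f x)^-1).
Proof.
move=> f0.
have cV k' : Ck_on k' V f -> {within V, continuous (fun x => (f x)^-1)}.
  by move=> fk; apply/contP => x Vx; apply: cvgV; [exact: f0|exact: Ck_on_cont fk Vx].
elim: k => [|k IHk] fk; first by split=> //; apply: cV fk.
apply: (@Ck_on_build k _ (fun i x => -1 * pd i f x * (f x)^-1 * (f x)^-1)).
- exact: cV fk.
- move=> i x Vx; rewrite mulN1r; apply: is_pdV; first exact: f0.
  exact: Ck_on_is_pd fk Vx.
- by move=> i; have := IHk (Ck_onS fk); have := Ck_on_pd i fk;
    have := Ck_on_cst k (-1); move=> *; do 3?apply: Ck_onM.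
Qed.

Lemma Ck_on_powR k f (a : R) : (forall x, V x -> 0 < f x) -> Ck_on k V f ->
  Ck_on k V (fun x => f x `^ a).
Proof.
move=> f0.
have cP k' b : Ck_on k' V f -> {within V, continuous (fun x => f x `^ b)}.
  move=> fk; apply/contP => x Vx.
  have [dp _] := is_derive1_powR b (f0 _ Vx).
  have := differentiable_continuous ((derivable1_diffP _ _).1 dp).
  exact: (cvg_comp _ _ (Ck_on_cont fk Vx)).
elim: k a => [|k IHk] a fk; first by split=> //; apply: cP fk.
apply: (@Ck_on_build k _ (fun i x => a * f x `^ (a - 1) * pd i f x)).
- exact: cP fk.
- move=> i x Vx; apply: is_pd_powR; first exact: f0.
  exact: Ck_on_is_pd fk Vx.
- move=> i; apply: Ck_onM; last exact: Ck_on_pd.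
  by apply: Ck_onM; [exact: Ck_on_cst|apply/IHk/Ck_onS].
Qed.

Lemma Ck_on_ln k f : (forall x, V x -> 0 < f x) -> Ck_on k V f ->
  Ck_on k V (fun x => ln (f x)).
Proof.
move=> f0 fk.
have cl : {within V, continuous (fun x => ln (f x))}.
  apply/contP => x Vx.
  have [dp _] := is_derive1_ln (f0 _ Vx).
  have := differentiable_continuous ((derivable1_diffP _ _).1 dp).
  exact: (cvg_comp _ _ (Ck_on_cont fk Vx)).
case: k fk => [|k] fk; first by split.
apply: (@Ck_on_build k _ (fun i x => (f x)^-1 * pd i f x)) => //.
- move=> i x Vx; apply: is_pd_ln; first exact: f0.
  exact: Ck_on_is_pd fk Vx.
- move=> i; apply: Ck_onM; last exact: Ck_on_pd.
  by apply: Ck_onV; [move=> x Vx; rewrite gt_eqF // f0|exact: Ck_onS].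
Qed.

Lemma smooth_cst (a : R) : smooth_on V (fun=> a).
Proof. by move=> k; apply: Ck_on_cst. Qed.

Lemma smoothD f g : smooth_on V f -> smooth_on V g -> smooth_on V (fun x => f x + g x).
Proof. by move=> sf sg k; apply: Ck_onD. Qed.

Lemma smoothM f g : smooth_on V f -> smooth_on V g -> smooth_on V (fun x => f x * g x).
Proof. by move=> sf sg k; apply: Ck_onM. Qed.

Lemma smoothZ (a : R) f : smooth_on V f -> smooth_on V (fun x => a * f x).
Proof. by move=> sf; apply: smoothM => //; apply: smooth_cst. Qed.

Lemma smoothN f : smooth_on V f -> smooth_on V (fun x => - f x).
Proof. by move=> /(smoothZ (-1)); apply: smooth_on_eq => x _; rewrite mulN1r. Qed.

Lemma smoothB f g : smooth_on V f -> smooth_on V g -> smooth_on V (fun x => f x - g x).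
Proof. by move=> sf sg; apply: smoothD => //; apply: smoothN. Qed.

Lemma smooth_sum (I : finType) (P : pred I) (F : I -> pt -> R) :
  (forall a, P a -> smooth_on V (F a)) ->
  smooth_on V (fun x => \sum_(a | P a) F a x).
Proof.
move=> sF; suff H s : smooth_on V (fun x => \sum_(a <- s | P a) F a x) by exact: H.
elim: s => [|a s IHs].
  by apply: smooth_on_eq (smooth_cst 0) => x _; rewrite big_nil.
have [Pa|Pa] := boolP (P a).
  by apply: smooth_on_eq (smoothD (sF a Pa) IHs) => x _; rewrite big_cons Pa.
by apply: smooth_on_eq IHs => x _; rewrite big_cons (negPf Pa).
Qed.

Lemma smooth_prod (I : finType) (F : I -> pt -> R) :
  (forall a, smooth_on V (F a)) -> smooth_on V (fun x => \prod_a F a x).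
Proof.
move=> sF; suff H s : smooth_on V (fun x => \prod_(a <- s) F a x) by exact: H.
elim: s => [|a s IHs].
  by apply: smooth_on_eq (smooth_cst 1) => x _; rewrite big_nil.
by apply: smooth_on_eq (smoothM (sF a) IHs) => x _; rewrite big_cons.
Qed.

Lemma smoothV f : (forall x, V x -> f x != 0) -> smooth_on V f ->
  smooth_on V (fun x => (f x)^-1).
Proof. by move=> f0 sf k; apply: Ck_onV. Qed.

Lemma smooth_powR f a : (forall x, V x -> 0 < f x) -> smooth_on V f ->
  smooth_on V (fun x => f x `^ a).
Proof. by move=> f0 sf k; apply: Ck_on_powR. Qed.

Lemma smooth_ln f : (forall x, V x -> 0 < f x) -> smooth_on V f ->
  smooth_on V (fun x => ln (f x)).
Proof. by move=> f0 sf k; apply: Ck_on_ln. Qed.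

Lemma smooth_pd i f : smooth_on V f -> smooth_on V (pd i f).
Proof. by move=> sf k; apply: Ck_on_pd (sf k.+1). Qed.

Lemma smooth_is_pd i f x : smooth_on V f -> V x -> is_pd i f x (pd i f x).
Proof. by move=> sf; apply: Ck_on_is_pd (sf 1%N). Qed.

Lemma smooth_cont f x : smooth_on V f -> V x -> f @ within V (nbhs x) --> f x.
Proof. by move=> sf; apply: Ck_on_cont (sf 0%N). Qed.

Lemma smooth_det m (g : pt -> 'M[R]_m) :
  (forall a b, smooth_on V (fun x => g x a b)) -> smooth_on V (fun x => \det (g x)).
Proof.
move=> sg; apply: smooth_sum => s _; apply: smoothZ.
by apply: smooth_prod => a; apply: sg.
Qed.

Lemma smooth_invmx m (g : pt -> 'M[R]_m) :
  (forall a b, smooth_on V (fun x => g x a b)) ->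
  (forall x, V x -> g x \in unitmx) ->
  forall a b, smooth_on V (fun x => invmx (g x) a b).
Proof.
move=> sg gu a b.
(* Cramer's formula writes the entries of the inverse as quotients of polynomials in the entries of
   [g]. *)
apply: (@smooth_on_eq (fun x => (\det (g x))^-1 * cofactor (g x) b a)).
  by move=> x Vx; rewrite /invmx gu // !mxE.
apply: smoothM.
  by apply: smoothV; [move=> x /gu; rewrite unitmxE unitfE|exact: smooth_det].
apply: smoothZ; apply: smooth_det => i' j'.
by apply: smooth_on_eq (sg (lift b i') (lift a j')) => x _; rewrite !mxE.
Qed.

End Smooth.

(** * Mean value theorem, chain rule and symmetry of mixed derivatives *)

Section MeanValue.
Variables (R : realType) (n : nat).
Local Notation pt := 'rV[R]_n.+1.
Local Notation idx := 'I_n.+1.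
Implicit Types (i j : idx) (x y v : pt) (f : pt -> R).

Lemma axvD i (s t : R) : axv i (s + t) = axv i s + axv i t :> pt.
Proof. exact: scalerDl. Qed.

Lemma axv0 i : axv i 0 = 0 :> pt.
Proof. exact: scale0r. Qed.

Lemma relopen_box V x : @relopen R n V -> V x -> exists2 e : R, 0 < e &
  forall y, half_space y -> (forall j, `|y ord0 j - x ord0 j| < e) -> V y.
Proof.
move=> [U oU ->] [Ux hx].
have /nbhs_ballP [e /= e0 eU] := open_nbhs_nbhs (conj oU Ux).
exists e => // y hy yx; split=> //; apply: eU; split=> // i j.
by rewrite ord1 /ball /= distrC.
Qed.

Lemma shift_cvg y v : (fun z => z + v) @ y --> y + v.
Proof.
apply: (@cvgD R pt pt (nbhs y) _ (fun z => z) (fun=> v) y v).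
  exact: cvg_id.
exact: cvg_cst.
Qed.

Section Axis.
Variable V : set pt.
Hypothesis hV : relopen V.

Lemma MVT_axis_pos i f df x (h : R) : 0 < h ->
  (forall t, 0 <= t <= h -> V (x + axv i t)) -> {within V, continuous f} ->
  (forall y, V y -> is_pd i f y (df y)) ->
  exists2 c, 0 <= c <= h & f (x + axv i h) - f x = df (x + axv i c) * h.
Proof.
move=> h0 segV /contP cf fdf.
pose F t := f (x + axv i t); pose dF t := df (x + axv i t).
have Vx : V x by have := segV 0; rewrite axv0 addr0 lexx ltW //; apply.
have dFP t : t \in `]0, h[%R -> is_derive t 1 F (dF t).
  rewrite in_itv /= => /andP[t0 th].
  have Vt : V (x + axv i t) by apply: segV; rewrite !ltW.
  have H : (fun s => s^-1 *: ((F \o shift t) (s *: 1) - F t)) @ 0^' --> dF t.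
    have := fdf _ Vt; apply: cvg_trans; apply: (@cvg_trans _
        (diff_quot i f (x + axv i t) @ 0^')).
      apply: near_eq_cvg; apply: nearW => s.
      rewrite /diff_quot /F /= -/(axv i s) -addrA -axvD.
      by rewrite /GRing.scale /= mulr1 [s + t]addrC.
    apply: cvg_app => P; rewrite /diff_filter /within /= => HP.
    have [e /= e0 eP] := (nbhs_ballP _ _).1 HP; apply/nbhs_ballP.
    (* An increment smaller than [t] in absolute value keeps the point at a positive distance along
       the axis from [x], hence in the half-space: the one-sided filter then admits both signs. *)
    exists (Num.min e t) => /=; first by rewrite lt_min e0.
    move=> s; rewrite /ball /= sub0r normrN lt_min => /andP[se st] s0.
    apply: eP => //; first by rewrite /ball /= sub0r normrN.
    rewrite /half_space /= -/(axv i s) -addrA -axvD.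
    apply: half_space_axv; first exact: relopen_half hV Vx.
    by move: st; rewrite ltr_norml => /andP[st _]; rewrite -lerBlDl sub0r ltW.
  split; first by apply/cvg_ex; exists (dF t).
  exact: cvg_lim H.
have cF : {within `[0, h], continuous F}.
  apply/subspace_continuousP => t /=; rewrite in_itv /= => /segV Vt.
  apply: cvg_trans (cf _ Vt) => P; rewrite /within /= => HP.
  have ct : (fun s : R => x + axv i s) @ t --> x + axv i t.
    by apply: cvgD; [exact: cvg_cst|apply: cvgZr_tmp].
  have := ct _ HP; rewrite /= !nbhs_simpl /= => HP'.
  apply: filterS HP' => s HP' /=; rewrite in_itv /= => /segV; exact: HP'.
have [c c0h E] := MVT h0 dFP cF.
exists c; first by move: c0h; rewrite in_itv /= => /andP[? ?]; rewrite !ltW.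
by rewrite -[h in RHS]subr0 -E /F axv0 addr0.
Qed.

Lemma MVT_axis i f df x (h : R) :
  (forall t, 0 <= t <= 1 -> V (x + axv i (t * h))) -> {within V, continuous f} ->
  (forall y, V y -> is_pd i f y (df y)) ->
  exists2 t, 0 <= t <= 1 & f (x + axv i h) - f x = df (x + axv i (t * h)) * h.
Proof.
move=> segV cf fdf; have [h0|h0|->] := ltgtP h 0.
(* For negative [h] the segment is run through from its other end, with increment [- h]. *)
- have [||c /andP[c0 ch] E] := @MVT_axis_pos i f df (x + axv i h) (- h) _ _ cf fdf.
  + by rewrite oppr_gt0.
  + move=> t /andP[t0 th]; rewrite -addrA -axvD.
    have -> : h + t = (1 + t / h) * h by rewrite mulrDl mul1r divfK // lt_eqF.
    apply: segV; rewrite -lerBlDl sub0r gerDl.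
    by rewrite ler_ndivlMr // mulN1r ler_ndivrMr // mul0r t0 th.
  exists (1 + c / h).
    rewrite -lerBlDl sub0r gerDl.
    by rewrite ler_ndivlMr // mulN1r ler_ndivrMr // mul0r c0 ch.
  have -> : (1 + c / h) * h = h + c by rewrite mulrDl mul1r divfK // lt_eqF.
  rewrite axvD addrA; move: E; rewrite -(addrA x _ (axv i (- h))) -axvD subrr axv0 addr0.
  by move/(congr1 -%R); rewrite opprB mulrN opprK.
- have [|t /andP[t0 th] E] := @MVT_axis_pos i f df x h h0 _ cf fdf.
  + move=> t /andP[t0 th]; rewrite -(divfK (lt0r_neq0 h0) t).
    by apply: segV; rewrite divr_ge0 ?(ltW h0) //= ler_pdivrMr // mul1r.
  exists (t / h); first by rewrite divr_ge0 ?(ltW h0) //= ler_pdivrMr // mul1r.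
  by rewrite divfK // lt0r_neq0.
- by exists 0; rewrite ?lexx ?ler01 // mulr0 axv0 addr0 subrr.
Qed.

(** A box centred at [x] and cut by the half-space. Intermediate points only have to tend to [x]
    together with [y], so this larger box serves as well as the one spanned by the two points. *)
Definition between x y : set pt :=
  [set z | half_space z /\ forall j, `|z ord0 j - x ord0 j| <= `|y ord0 j - x ord0 j|].

(* The mean value theorem is applied along one coordinate axis at a time, so as
   to stay in the box spanned by x and y, hence in the half-space. *)
Lemma mean_value f (df : idx -> pt -> R) x y : half_space x -> half_space y ->
  between x y `<=` V -> {within V, continuous f} ->
  (forall i z, V z -> is_pd i f z (df i z)) ->
  exists xi : idx -> pt, (forall j, between x y (xi j)) /\
    f y - f x = \sum_j (y ord0 j - x ord0 j) * df j (xi j).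
Proof.
move=> hx hy xyV cf fdf.
pose z (m : nat) : pt := \row_k (if (k < m)%N then y ord0 k else x ord0 k).
have zS (j : idx) : z j.+1 = z j + axv j (y ord0 j - x ord0 j).
  apply/rowP => k; rewrite [RHS]mxE axvE !mxE ltnS leq_eqVlt.
  have [->|jk] := eqVneq j k; first by rewrite eqxx ltnn /= addrC subrK.
  by rewrite addr0 -val_eqE /= in jk *; rewrite eq_sym (negPf jk).
have bz (j : idx) t : 0 <= t <= 1 ->
    between x y (z j + axv j (t * (y ord0 j - x ord0 j))).
  move=> /andP[t0 t1]; split.
    have [j0|j0] := eqVneq j ord0.
      rewrite /half_space /= mxE axvE j0 eqxx mxE ltn0 mulr1n.
      have -> : x ord0 ord0 + t * (y ord0 ord0 - x ord0 ord0) =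
        (1 - t) * x ord0 ord0 + t * y ord0 ord0 by ring.
      by rewrite addr_ge0 // mulr_ge0 // subr_ge0.
    rewrite /half_space /= mxE axvE (negPf j0) addr0 mxE.
    by case: ifP => _; [exact: hy|exact: hx].
  move=> k; rewrite mxE axvE mxE; have [<-|jk] := eqVneq j k.
    rewrite ltnn mulr1n [x ord0 j + _]addrC addrK normrM ger0_norm // ler_piMl //.
  by rewrite mulr0n addr0; case: ifP => _ //; rewrite subrr normr0.
have /choice [xi xiP] : forall j : idx, exists p : pt, between x y p /\
    f (z j.+1) - f (z j) = (y ord0 j - x ord0 j) * df j p.
  move=> j; have [t /(bz j) bt E] := MVT_axis (fun t ht => xyV _ (bz j t ht)) cf (fdf j).
  exists (z j + axv j (t * (y ord0 j - x ord0 j))); split=> //.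
  by rewrite zS E mulrC.
exists xi; split=> [j|]; first by have [] := xiP j.
have zy : z n.+1 = y by apply/rowP => k; rewrite mxE ltn_ord.
have zx : z 0%N = x by apply/rowP => k; rewrite mxE ltn0.
transitivity (f (z n.+1) - f (z 0%N)); first by rewrite zy zx.
rewrite -(@telescope_sumr _ 0 n.+1 (fun m => f (z m))) // big_mkord.
by apply: eq_bigr => j _; have [_ ->] := xiP j.
Qed.

End Axis.

Lemma is_pd_chain V f (df : idx -> pt -> R) W (phi : pt -> pt) i x (dphi : idx -> R) :
  @relopen R n V -> @relopen R n W -> W x -> (forall y, W y -> V (phi y)) ->
  {within V, continuous f} -> (forall j z, V z -> is_pd j f z (df j z)) ->
  (forall j, {within V, continuous (df j)}) ->
  (forall j, is_pd i (fun z => phi z ord0 j) x (dphi j)) ->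
  is_pd i (f \o phi) x (\sum_j dphi j * df j (phi x)).
Proof.
move=> hV hW Wx WV cf fdf cdf phid.
have Vx : V (phi x) by exact: WV.
have hx : half_space (phi x) by exact: relopen_half hV Vx.
have [e e0 eV] := relopen_box hV Vx.
pose near_phi (d : R) h := half_space (phi (x + axv i h)) /\
  forall j, `|phi (x + axv i h) ord0 j - phi x ord0 j| < d.
have nearP d : 0 < d -> \forall h \near diff_filter i x, near_phi d h.
  move=> d0; have H1 : \forall h \near diff_filter i x, half_space (phi (x + axv i h)).
    apply: filterS (near_axv i hW Wx) => h /WV; exact: relopen_half.
  have H2 : \forall h \near diff_filter i x,
      forall j, `|phi (x + axv i h) ord0 j - phi x ord0 j| < d.
    apply: filter_forall => j.
    have /cvgrPdist_lt /(_ _ d0) := is_pd_cvg (phid j).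
    by apply: filterS => h; rewrite distrC.
  by apply: filterS2 H1 H2 => h ? ?; split.
have /choice [xi xiP] : forall h, exists p : idx -> pt, near_phi e h ->
    (forall j, between (phi x) (phi (x + axv i h)) (p j)) /\
    f (phi (x + axv i h)) - f (phi x) =
     \sum_j (phi (x + axv i h) ord0 j - phi x ord0 j) * df j (p j).
  move=> h; have [[hy he]|?] := pselect (near_phi e h); last first.
    (* An arbitrary value for increments that are not small; the limit does not see it. *)
    by exists (fun=> x).
  have [|p pP] := @mean_value _ hV f df _ _ hx hy _ cf fdf; last by exists p.
  move=> y [hyy bt]; apply: eV => // j.
  exact: le_lt_trans (bt j) (he j).
apply: (@cvg_trans _ ((fun h => \sum_j diff_quot i (fun z => phi z ord0 j) x h *
    df j (xi h j)) @ diff_filter i x)).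
  apply: near_eq_cvg; apply: filterS (nearP e e0) => h /xiP [_ E].
  rewrite /diff_quot /= -/(axv i h) E mulr_sumr; apply: eq_bigr => j _.
  by rewrite mulrA.
apply: cvg_big => [p|j _]; first exact: add_continuous.
apply: cvgM; first exact: phid.
have H : (fun h => xi h j) @ diff_filter i x --> within V (nbhs (phi x)).
  move=> P; rewrite /within /= => HP.
  have [d /= d0 dP] := (nbhs_ballP _ _).1 HP.
  have de : 0 < Num.min d e by rewrite lt_min d0.
  apply: filterS (nearP _ de) => h [hh ball_h].
  have /xiP [bt _] : near_phi e h.
    by split=> // k; apply: lt_le_trans (ball_h k) _; rewrite ge_min lexx orbT.
  have [hxi bxi] := bt j; apply: dP.
    split=> // a k; rewrite ord1 /ball /= distrC.
    apply: le_lt_trans (bxi k) (lt_le_trans (ball_h k) _).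
    by rewrite ge_min lexx.
  apply: eV => // k; apply: le_lt_trans (bxi k) (lt_le_trans (ball_h k) _).
  by rewrite ge_min lexx orbT.
by apply: cvg_comp H _; have /contP := cdf j; apply.
Qed.

Lemma smooth_chain V f W (phi : pt -> pt) i x :
  @relopen R n V -> @relopen R n W -> W x -> (forall y, W y -> V (phi y)) ->
  smooth_on V f -> (forall j, smooth_on W (fun z => phi z ord0 j)) ->
  is_pd i (f \o phi) x (\sum_j pd i (fun z => phi z ord0 j) x * pd j f (phi x)).
Proof.
move=> hV hW Wx WV sf sphi.
apply: (is_pd_chain (df := fun j => pd j f) hV hW Wx WV).
- exact: Ck_on_within (sf 0%N).
- by move=> j z Vz; apply: smooth_is_pd.
- by move=> j; apply: Ck_on_within (smooth_pd j sf 0%N).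
- by move=> j; apply: smooth_is_pd Wx.
Qed.

(** The shift must point into the half-space: then every increment admissible at [x] is admissible
    at [x + v]. *)
Lemma is_pd_shift i f x v l : 0 <= v ord0 ord0 ->
  is_pd i f (x + v) l -> is_pd i (fun y => f (y + v)) x l.
Proof.
move=> v0; apply: cvg_trans.
apply: (@cvg_trans _ (diff_quot i f (x + v) @ diff_filter i x)).
  apply: near_eq_cvg; apply: nearW => h.
  by rewrite /diff_quot addrAC.
apply: cvg_app => P; rewrite /diff_filter /within /= => HP.
have [e /= e0 eP] := (nbhs_ballP _ _).1 HP; apply/nbhs_ballP.
exists e => //= h he h0 hh; apply: eP => //.
by rewrite /half_space /= addrAC mxE addr_ge0.
Qed.

(** The mean value theorem is used twice, along [i] for the increment of [f] in direction [j], and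
    then along [j] for [pd i f]. The sign of [h] keeps the shift inside the half-space. *)
Lemma second_difference V f i j x (h : R) : @relopen R n V -> V x -> 0 < h ->
  smooth_on V f ->
  (forall t s, 0 <= t <= 1 -> 0 <= s <= 1 -> V (x + axv i (t * h) + axv j (s * h))) ->
  exists t s, [/\ 0 <= t <= 1, 0 <= s <= 1 &
    f (x + axv i h + axv j h) - f (x + axv i h) - (f (x + axv j h) - f x) =
    pd j (pd i f) (x + axv i (t * h) + axv j (s * h)) * h * h].
Proof.
move=> hV Vx h0 sf boxV.
pose u y := f (y + axv j h) - f y.
(* The domain of [u]: the point and its shift both have to lie in [V]. *)
pose V' := V `&` [set y | V (y + axv j h)].
have hj : 0 <= (axv j h : pt) ord0 ord0 by rewrite axvE mulrn_wge0 // ltW.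
have hV' : relopen V'.
  have [U oU VE] := hV; exists (U `&` [set y | U (y + axv j h)]).
    apply: openI => //; apply: (@open_comp _ _ (fun y : pt => y + axv j h)) => // y _.
    exact: shift_cvg.
  rewrite /V' VE; apply/seteqP; split=> y /=; first by move=> [[? ?] [? ?]].
  move=> [[Uy Uyh] hy]; split; first by split.
  by split=> //; apply: half_space_axv => //; rewrite ltW.
have sd i' : smooth_on V (pd i' f) by exact: smooth_pd.
have uV' y : V' y -> forall i', is_pd i' u y (pd i' f (y + axv j h) - pd i' f y).
  move=> [Vy Vyh] i'; apply: is_pdB; last exact: smooth_is_pd sf Vy.
  by apply: is_pd_shift => //; apply: smooth_is_pd sf Vyh.
have cu : {within V', continuous u}.
  apply/contP => y [Vy Vyh]; apply: cvgB; last first.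
    apply: cvg_trans (smooth_cont sf Vy) => P; rewrite /within /= => HP.
    by apply: (@filterS _ (nbhs y) _ _ _ _ HP) => z Pz [] /Pz.
  apply: cvg_trans (smooth_cont sf Vyh) => P; rewrite /within /= => HP.
  have {}HP := @shift_cvg y (axv j h) _ HP.
  by apply: (@filterS _ (nbhs y) _ _ _ _ HP) => z Pz [] _ /Pz.
have [|t t01 E] := @MVT_axis _ hV' i u (fun y => pd i f (y + axv j h) - pd i f y) x h _ cu (fun y Vy => uV' y Vy i).
- move=> t t01; split; first by have := boxV t 0 t01; rewrite mul0r axv0 addr0 lexx ler01; apply.
  by have := boxV t 1 t01; rewrite mul1r lexx ler01; apply.
have [||s s01 E'] := @MVT_axis _ hV j (pd i f) (pd j (pd i f)) (x + axv i (t * h)) h _ _ (fun y Vy => smooth_is_pd (sd i) Vy).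
- by move=> s s01; apply: boxV.
- exact: Ck_on_within (sd i 0%N).
exists t, s; split=> //; rewrite -E' -E /u.
by rewrite [x + axv i h + axv j h]addrAC.
Qed.

(** The second difference is symmetric in [i] and [j], so the two mixed derivatives take a common
    value at points near [x]. If they differed at [x] by [D], each would be within [D / 2] of that
    value for small [h], a contradiction. *)
Lemma pd_sym V f i j x : @relopen R n V -> V x -> smooth_on V f ->
  pd i (pd j f) x = pd j (pd i f) x.
Proof.
move=> hV Vx sf; apply/eqP; rewrite -subr_eq0 -normr_le0 leNgt; apply/negP => D0.
set D := `|_ - _| in D0.
have D2 : 0 < D / 2 by rewrite divr_gt0.
have sij i' j' := smooth_pd i' (smooth_pd j' sf).
have close i' j' : exists2 d : R, 0 < d & forall y, V y ->
    (forall k, `|y ord0 k - x ord0 k| < d) ->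
    `|pd i' (pd j' f) x - pd i' (pd j' f) y| < D / 2.
  have /cvgrPdist_lt /(_ _ D2) := smooth_cont (sij i' j') Vx.
  rewrite near_withinE => /nbhs_ballP [d /= d0 dP]; exists d => // y Vy yx.
  by apply: dP => //; split=> // a k; rewrite ord1 /ball /= distrC.
have [d1 d10 d1P] := close i j; have [d2 d20 d2P] := close j i.
have [e e0 eV] := relopen_box hV Vx.
have m0 : 0 < Num.min e (Num.min d1 d2) by rewrite !lt_min e0 d10.
have [h h0 hm] : exists2 h : R, 0 < h & h + h < Num.min e (Num.min d1 d2).
  by exists (Num.min e (Num.min d1 d2) / 3); lra.
have box i' j' t s : 0 <= t <= 1 -> 0 <= s <= 1 ->
    let y := x + axv i' (t * h) + axv j' (s * h) in
    half_space y /\ forall k, `|y ord0 k - x ord0 k| < Num.min e (Num.min d1 d2).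
  move=> /andP[t0 t1] /andP[s0 s1] /=; split.
    apply: half_space_axv; last by rewrite mulr_ge0 ?(ltW h0).
    apply: half_space_axv; last by rewrite mulr_ge0 ?(ltW h0).
    exact: relopen_half hV Vx.
  move=> k; rewrite !mxE eqxx /=.
  have -> : x ord0 k + t * h * (k == i')%:R + s * h * (k == j')%:R - x ord0 k =
    t * h * (k == i')%:R + s * h * (k == j')%:R by ring.
  have b1 (b : bool) (r : R) : 0 <= r <= 1 -> `|r * h * b%:R| <= h.
    move=> /andP[r0 r1]; rewrite !normrM !ger0_norm ?(ltW h0) //.
    by rewrite mulrAC ler_piMl ?(ltW h0) // mulr_ile1 // lern1; case: b.
  apply: le_lt_trans (ler_normD _ _) _.
  apply: (@le_lt_trans _ _ (h + h)); first by apply: lerD; apply: b1; apply/andP.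
  by [].
have boxV i' j' t s : 0 <= t <= 1 -> 0 <= s <= 1 ->
    V (x + axv i' (t * h) + axv j' (s * h)).
  move=> t01 s01; have [hy yx] := box i' j' t s t01 s01; apply: eV => // k.
  by apply: lt_le_trans (yx k) _; rewrite ge_min lexx.
have [t [s [t01 s01 E]]] := second_difference hV Vx h0 sf (boxV i j).
have [t' [s' [t01' s01' E']]] := second_difference hV Vx h0 sf (boxV j i).
have EE : pd j (pd i f) (x + axv i (t * h) + axv j (s * h)) =
          pd i (pd j f) (x + axv j (t' * h) + axv i (s' * h)).
  apply: (mulIf (lt0r_neq0 h0)); apply: (mulIf (lt0r_neq0 h0)).
  apply: etrans (esym E) _; apply: etrans _ E'; rewrite (addrAC x (axv j h)).
  move: (f (x + axv i h + axv j h)) (f (x + axv i h)) (f (x + axv j h)) (f x).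
  by move=> a b a' b'; ring.
have near_x i' j' a b (a01 : 0 <= a <= 1) (b01 : 0 <= b <= 1) (d : R) :
    Num.min e (Num.min d1 d2) <= d -> forall k,
    `|(x + axv i' (a * h) + axv j' (b * h)) ord0 k - x ord0 k| < d.
  by move=> md k; apply: lt_le_trans ((box i' j' a b a01 b01).2 k) md.
have md1 : Num.min e (Num.min d1 d2) <= d1 by rewrite !ge_min lexx !orbT.
have md2 : Num.min e (Num.min d1 d2) <= d2 by rewrite !ge_min lexx !orbT.
have H1 := d1P _ (boxV j i _ _ t01' s01') (near_x j i _ _ t01' s01' _ md1).
have H2 := d2P _ (boxV i j _ _ t01 s01) (near_x i j _ _ t01 s01 _ md2).
have {}H2 := eq_ind _ (fun q => `|pd j (pd i f) x - q| < D / 2) H2 _ EE.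
move: H1 H2; move: (pd i (pd j f) (x + axv j (t' * h) + axv i (s' * h))) => q H1.
rewrite distrC => H2.
have := le_lt_trans (ler_distD q (pd i (pd j f) x) (pd j (pd i f) x)) (ltrD H1 H2).
by rewrite -splitr -/D ltxx.
Qed.

End MeanValue.

(* Otherwise conversion may unfold partial derivatives into limits. *)
Local Opaque pd.

(** * Forms, Levi-Civita connection and Leibniz rules *)

Section FormCalculus.
Variables (R : realType) (n : nat).
Local Notation pt := 'rV[R]_n.+1.
Local Notation idx := 'I_n.+1.
Local Notation ext := (ext R n).
Local Notation lform := (lform R n).
Implicit Types (i j k l : idx) (x : pt) (f : pt -> R) (A B : lform) (L : ext)
  (u v : pt -> idx -> R).

Definition is_pdx i A x L := forall S, is_pd i (fun z => A z S) x (L S).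

Definition pdx i A x : ext := [ffun S => pd i (fun z => A z S) x].

Lemma pdxSE i A x S : pdx i A x S = pd i (fun z => A z S) x.
Proof. by rewrite ffunE. Qed.

Definition sform (V : set pt) A := forall S, smooth_on V (fun x => A x S).
Definition scov (V : set pt) u := forall j, smooth_on V (fun x => u x j).

Lemma is_pdxD i A B x L L' : is_pdx i A x L -> is_pdx i B x L' ->
  is_pdx i (fun z => A z + B z) x (L + L').
Proof.
move=> AL BL S; rewrite extDE; apply: is_pd_ext (is_pdD (AL S) (BL S)) => z.
by rewrite extDE.
Qed.

Lemma is_pdxZ i f A x df L : is_pd i f x df -> is_pdx i A x L ->
  is_pdx i (fun z => f z *: A z) x (df *: A x + f x *: L).
Proof.
move=> fd AL S; rewrite extDE !extZE; apply: is_pd_ext (is_pdM fd (AL S)) => z.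
by rewrite extZE.
Qed.

Lemma is_pdx_sum i (I : finType) (F : I -> lform) x (L : I -> ext) :
  (forall a, is_pdx i (F a) x (L a)) ->
  is_pdx i (fun z => \sum_a F a z) x (\sum_a L a).
Proof.
move=> FL S; rewrite sum_ffunE.
apply: is_pd_ext (@is_pd_sum _ _ i _ xpredT (fun a z => F a z S) x (fun a => L a S) _).
  by move=> z; rewrite sum_ffunE.
by move=> a _; apply: FL.
Qed.

Lemma lin_extE (T : {linear ext -> ext}) (A : ext) S :
  T A S = \sum_U A U * T (ext_basis R U) S.
Proof.
rewrite {1}(ext_basisE A) linear_sum sum_ffunE; apply: eq_bigr => U _.
by rewrite linearZ extZE.
Qed.

Lemma is_pdx_lin i (T : {linear ext -> ext}) A x L : is_pdx i A x L ->
  is_pdx i (fun z => T (A z)) x (T L).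
Proof.
move=> AL S; rewrite lin_extE.
apply: is_pd_ext (@is_pd_sum _ _ i _ xpredT
  (fun U z => A z U * T (ext_basis R U) S) x _ _); first by move=> z /=; rewrite -lin_extE.
move=> U _; apply: is_pd_val (is_pdM (AL U) (is_pd_cst _ _ _)) _.
by rewrite mulr0 addr0.
Qed.

Lemma is_pdx_ext i A B x L : A =1 B -> is_pdx i A x L -> is_pdx i B x L.
Proof. by move=> AB AL S; apply: is_pd_ext (AL S) => z; rewrite AB. Qed.

Lemma is_pdx_ewf i u A x du L : (forall j, is_pd i (fun z => u z j) x (du j)) ->
  is_pdx i A x L ->
  is_pdx i (fun z => ewf (u z) (A z)) x (ewf du (A x) + ewf (u x) L).
Proof.
move=> ud AL; rewrite -big_split; apply: is_pdx_sum => j.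
exact: is_pdxZ (ud j) (is_pdx_lin (T := @eps R n j) AL).
Qed.

Lemma is_pdx_iwf i u A x du L : (forall j, is_pd i (fun z => u z j) x (du j)) ->
  is_pdx i A x L ->
  is_pdx i (fun z => iwf (u z) (A z)) x (iwf du (A x) + iwf (u x) L).
Proof.
move=> ud AL; rewrite -big_split; apply: is_pdx_sum => j.
exact: is_pdxZ (ud j) (is_pdx_lin (T := @iot R n j) AL).
Qed.

Variable V : set pt.
Hypothesis hV : relopen V.

Lemma pdxE i A x L : V x -> is_pdx i A x L -> pdx i A x = L.
Proof.
by move=> Vx AL; apply/ffunP => S; rewrite ffunE; apply: (is_pd_on hV Vx).
Qed.

Lemma sform_is_pdx i A x : sform V A -> V x -> is_pdx i A x (pdx i A x).
Proof. by move=> sA Vx S; rewrite ffunE; apply: smooth_is_pd (sA S) Vx. Qed.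

Lemma sform_pdx i A : sform V A -> sform V (pdx i A).
Proof.
move=> sA S; apply: (smooth_on_eq hV) (smooth_pd i (sA S)) => x _.
by rewrite ffunE.
Qed.

Lemma sform_eq A B : (forall x, V x -> A x = B x) -> sform V A -> sform V B.
Proof. by move=> AB sA S; apply: (smooth_on_eq hV) (sA S) => x Vx; rewrite AB. Qed.

Lemma sform_cst (L : ext) : sform V (fun=> L).
Proof. by move=> S; apply: smooth_cst. Qed.

Lemma sformD A B : sform V A -> sform V B -> sform V (fun x => A x + B x).
Proof.
move=> sA sB S; apply: (smooth_on_eq hV) (smoothD hV (sA S) (sB S)) => x _.
by rewrite extDE.
Qed.

Lemma sformZ f A : smooth_on V f -> sform V A -> sform V (fun x => f x *: A x).
Proof.
move=> sf sA S; apply: (smooth_on_eq hV) (smoothM hV sf (sA S)) => x _.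
by rewrite extZE.
Qed.

Lemma sformN A : sform V A -> sform V (fun x => - A x).
Proof.
move=> sA; apply: sform_eq (sformZ (smooth_cst hV (-1)) sA) => x _.
exact: scaleN1r.
Qed.

Lemma sformB A B : sform V A -> sform V B -> sform V (fun x => A x - B x).
Proof. by move=> sA sB; apply: sformD => //; apply: sformN. Qed.

Lemma sform_sum (I : finType) (F : I -> lform) : (forall a, sform V (F a)) ->
  sform V (fun x => \sum_a F a x).
Proof.
move=> sF S; apply: (smooth_on_eq hV) (@smooth_sum _ _ _ hV I xpredT _ (fun a _ => sF a S)) => x _.
by rewrite sum_ffunE.
Qed.

Lemma sform_lin (T : {linear ext -> ext}) A : sform V A -> sform V (fun x => T (A x)).
Proof.
move=> sA S; apply: (smooth_on_eq hV) (@smooth_sum _ _ _ hV _ xpredT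
  (fun U x => A x U * T (ext_basis R U) S) _); first by move=> x _; rewrite -lin_extE.
by move=> U _; apply: smoothM => //; apply: smooth_cst.
Qed.

Lemma sform_ewf u A : scov V u -> sform V A -> sform V (fun x => ewf (u x) (A x)).
Proof.
by move=> su sA; apply: sform_sum => j; apply: sformZ (su j) (sform_lin (@eps R n j) sA).
Qed.

Lemma sform_iwf u A : scov V u -> sform V A -> sform V (fun x => iwf (u x) (A x)).
Proof.
by move=> su sA; apply: sform_sum => j; apply: sformZ (su j) (sform_lin (@iot R n j) sA).
Qed.

Lemma pdx_local i A B x : V x -> (forall y, V y -> A y = B y) -> sform V A ->
  pdx i B x = pdx i A x.
Proof.
move=> Vx AB sA; apply: (pdxE Vx) => S.
have AS : is_pd i (fun z => A z S) x (pdx i A x S) by exact: sform_is_pdx.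
apply: (is_pd_local hV Vx _ AS) => y Vy.
by rewrite AB.
Qed.

Lemma pdx_sym i j A x : sform V A -> V x -> pdx i (pdx j A) x = pdx j (pdx i A) x.
Proof.
move=> sA Vx; apply/ffunP => S; rewrite [LHS]pdxSE [RHS]pdxSE.
have E i' j' : pd i' (fun z => pdx j' A z S) x = pd i' (pd j' (fun z => A z S)) x.
  by congr (pd i' _ x); apply/funext => z; exact: pdxSE.
by rewrite !E; exact: pd_sym hV Vx (sA S).
Qed.

End FormCalculus.

(** * Endomorphisms acting on forms as derivations *)

Section GlAction.
Variables (R : realType) (n : nat).
Local Notation idx := 'I_n.+1.
Local Notation ext := (ext R n).
Implicit Types (N : idx -> idx -> R) (f v : idx -> R) (A : ext).

(* The action of the endomorphism N as a derivation. *)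
Definition gl N A : ext := \sum_j \sum_l N j l *: eps j (iot l A).

Lemma glE N A : gl N A = \sum_l ewf (N^~ l) (iot l A).
Proof. by rewrite /gl exchange_big. Qed.

Fact gl_is_linear N : linear (gl N).
Proof.
move=> a A B; rewrite !glE scaler_sumr -big_split; apply: eq_bigr => l _ /=.
by rewrite !linearP.
Qed.
HB.instance Definition _ N :=
  GRing.isLinear.Build R ext ext *:%R (gl N) (gl_is_linear N).

Lemma eq_gl N N' A : N =2 N' -> gl N A = gl N' A.
Proof. by move=> NN; do 2!apply: eq_bigr => ? _; rewrite NN. Qed.

Lemma glD N N' A : gl (fun j l => N j l + N' j l) A = gl N A + gl N' A.
Proof. by rewrite !glE -big_split; apply: eq_bigr => l _; rewrite /= ewfD. Qed.

Lemma glZ a N A : gl (fun j l => a * N j l) A = a *: gl N A.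
Proof. by rewrite !glE scaler_sumr; apply: eq_bigr => l _; rewrite ewfZ. Qed.

Lemma gl_delta A : gl (fun j l => (j == l)%:R) A = \sum_i eps i (iot i A).
Proof. by rewrite glE; apply: eq_bigr => i _; rewrite ewf_delta. Qed.

Lemma gl_ewf N f A :
  gl N (ewf f A) = ewf (fun j => \sum_l N j l * f l) A + ewf f (gl N A).
Proof.
rewrite !glE (linear_sum (ewf f)) ewf_sum -big_split; apply: eq_bigr => l _ /=.
rewrite iot_ewf linearB linearZ /= [in RHS]ewf_ewf -ewfZ; congr (_ - _).
by apply: eq_ewf => j; rewrite mulrC.
Qed.

(** Vectors carry the representation dual to that of covectors, whence the transpose and the minus
    sign in comparison with [gl_ewf]. *)
Lemma gl_iwf N v A :
  gl N (iwf v A) = - iwf (fun l => \sum_j N j l * v j) A + iwf v (gl N A).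
Proof.
rewrite !glE (linear_sum (iwf v)) iwf_sum; apply/eqP.
rewrite eq_sym addrC subr_eq; apply/eqP.
have -> : \sum_j iwf (fun l => N j l * v j) A =
    \sum_l (\sum_j v j * N j l) *: iot l A.
  rewrite exchange_big; apply: eq_bigr => l _; rewrite scaler_suml.
  by apply: eq_bigr => j _; rewrite mulrC.
rewrite -big_split; apply: eq_bigr => l _ /=.
by rewrite iot_iwf linearN /= iwf_ewf addrC.
Qed.

End GlAction.

(** * Metric, Christoffel symbols and covariant derivative *)

Section Metric.
Variables (R : realType) (n : nat).
Local Notation pt := 'rV[R]_n.+1.
Local Notation idx := 'I_n.+1.
Local Notation ext := (ext R n).
Local Notation lform := (lform R n).
Implicit Types (i j k l m : idx) (x : pt) (f : pt -> R) (A B : lform) (L : ext)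
  (u v : pt -> idx -> R).

Definition local_metric (V : set pt) (g : pt -> 'M[R]_n.+1) :=
  [/\ forall i j, smooth_on V (fun x => g x i j),
      forall x, V x -> (g x)^T = g x & forall x, V x -> g x \in unitmx].

Variables (V : set pt) (g : pt -> 'M[R]_n.+1).
Hypothesis hV : relopen V.
Hypothesis hg : local_metric V g.

Let gsm i j : smooth_on V (fun x => g x i j). Proof. by have [] := hg. Qed.

Lemma g_sym x i j : V x -> g x i j = g x j i.
Proof. by have [_ gs _] := hg; move=> /gs {1}<-; rewrite mxE. Qed.

Lemma ginvR x i j : V x -> \sum_k g x i k * ginv g x k j = (i == j)%:R.
Proof.
have [_ _ gu] := hg => /gu gxu.
by have /matrixP /(_ i j) := mulmxV gxu; rewrite !mxE.
Qed.

Lemma ginvL x i j : V x -> \sum_k ginv g x i k * g x k j = (i == j)%:R.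
Proof.
have [_ _ gu] := hg => /gu gxu.
by have /matrixP /(_ i j) := mulVmx gxu; rewrite !mxE.
Qed.

Lemma ginv_sym x i j : V x -> ginv g x i j = ginv g x j i.
Proof.
by have [_ gs _] := hg; move=> /gs gx; rewrite /ginv -{1}gx -trmx_inv mxE.
Qed.

Lemma smooth_ginv i j : smooth_on V (fun x => ginv g x i j).
Proof. by apply: smooth_invmx; have [] := hg. Qed.

Lemma pd_g_sym x i j k : V x ->
  pd k (fun z => g z i j) x = pd k (fun z => g z j i) x.
Proof.
move=> Vx; apply: (pd_local hV Vx); first by move=> y Vy; apply: g_sym.
exact/is_pd_pdable/smooth_is_pd.
Qed.

Lemma smooth_christoffel l i j : smooth_on V (christoffel g l i j).
Proof.
apply: smoothZ => //; apply: smooth_sum => // m _; apply: smoothM => //.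
  exact: smooth_ginv.
apply: smoothB => //; last exact: smooth_pd.
by apply: smoothD => //; apply: smooth_pd.
Qed.

Lemma christoffel_sym l i j x : V x -> christoffel g l i j x = christoffel g l j i x.
Proof.
move=> Vx; congr (_ * _); apply: eq_bigr => m _; congr (_ * _).
by rewrite (pd_g_sym i j) // [X in X - _]addrC.
Qed.

(** Lowering the index cancels the inverse metric and leaves the Christoffel symbols of the first
    kind, which are linear in the derivatives of [g]. *)
Lemma christoffel_low m i j x : V x -> \sum_l g x m l * christoffel g l i j x =
  2^-1 * (pd i (fun z => g z m j) x + pd j (fun z => g z m i) x
     - pd m (fun z => g z i j) x).
Proof.
move=> Vx; rewrite /christoffel.
pose c m' := pd i (fun z => g z m' j) x + pd j (fun z => g z m' i) x
     - pd m' (fun z => g z i j) x.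
transitivity (\sum_m' (m == m')%:R * (2^-1 * c m')).
  under [RHS]eq_bigr => m' _ do rewrite -(ginvR _ _ Vx) mulr_suml.
  rewrite exchange_big; apply: eq_bigr => l _.
  by rewrite !mulr_sumr; apply: eq_bigr => m' _; rewrite /c; ring.
rewrite (bigD1 m) //= eqxx mul1r big1 ?addr0 // => m' /negPf.
by rewrite eq_sym => ->; rewrite mul0r.
Qed.

(** This is nabla g = 0 in coordinates: in the sum of the two symbols of the first kind all
    derivatives but one cancel by the symmetry of [g]. *)
Lemma pd_g k i j x : V x -> pd k (fun z => g z i j) x =
  \sum_l christoffel g l k i x * g x l j + \sum_l christoffel g l k j x * g x i l.
Proof.
move=> Vx.
have -> : \sum_l christoffel g l k i x * g x l j =
    \sum_l g x j l * christoffel g l k i x.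
  by apply: eq_bigr => l _; rewrite mulrC (g_sym j).
have -> : \sum_l christoffel g l k j x * g x i l =
    \sum_l g x i l * christoffel g l k j x.
  by apply: eq_bigr => l _; rewrite mulrC.
rewrite !christoffel_low //.
rewrite (pd_g_sym j i) // (pd_g_sym j k) // (pd_g_sym i k) //.
by field.
Qed.

(** Differentiation of the constant product of the inverse metric with the metric gives [E]; the
    remaining factor [g] is then removed by contraction with its inverse. *)
Lemma pd_ginv_metric k i j x : V x -> pd k (fun z => ginv g z i j) x =
  - \sum_a \sum_b ginv g x i a * pd k (fun z => g z a b) x * ginv g x b j.
Proof.
move=> Vx.
pose D a b := pd k (fun z => ginv g z a b) x.
pose dg a b := pd k (fun z => g z a b) x.
have E a c : \sum_b D a b * g x b c = - \sum_b ginv g x a b * dg b c.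
  have : is_pd k (fun z => \sum_b ginv g z a b * g z b c) x
      (\sum_b (D a b * g x b c + ginv g x a b * dg b c)).
    apply: is_pd_sum => b _.
    by apply: is_pdM; apply: smooth_is_pd Vx; [exact: smooth_ginv|exact: gsm].
  move=> /(is_pd_local hV Vx (g := fun=> (a == c)%:R)).
  move=> /(_ (fun y => ginvL a c)) /(is_pd_on hV Vx).
  rewrite (is_pd_on hV Vx (is_pd_cst _ _ _)) big_split /= => /esym /eqP.
  by rewrite addr_eq0 => /eqP.
transitivity (\sum_c (\sum_b D i b * g x b c) * ginv g x c j).
  under eq_bigr => c _ do rewrite mulr_suml.
  rewrite exchange_big /=.
  under eq_bigr => b _ do (under eq_bigr => c _ do rewrite -mulrA).
  under eq_bigr => b _ do rewrite -mulr_sumr ginvR //.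
  rewrite (bigD1 j) //= eqxx mulr1 big1 ?addr0 // => b /negPf ->.
  by rewrite mulr0.
under eq_bigr => c _ do rewrite E mulNr mulr_suml.
by rewrite sumrN exchange_big.
Qed.

(** The equation nabla g^-1 = 0, obtained by inserting [pd_g] into [pd_ginv_metric]. *)
Lemma pd_ginv k i j x : V x -> pd k (fun z => ginv g z i j) x =
  - (\sum_l christoffel g i k l x * ginv g x l j +
     \sum_l christoffel g j k l x * ginv g x i l).
Proof.
move=> Vx; rewrite pd_ginv_metric //; congr (- _).
have E a b : ginv g x i a * pd k (fun z => g z a b) x * ginv g x b j =
   \sum_l christoffel g l k a x * ginv g x i a * (g x l b * ginv g x b j) +
   \sum_l christoffel g l k b x * ginv g x b j * (ginv g x i a * g x a l).
  rewrite pd_g // mulrDr mulrDl; congr (_ + _);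
  by rewrite mulr_sumr mulr_suml; apply: eq_bigr => l _; ring.
under eq_bigr => a _ do under eq_bigr => b _ do rewrite E.
under eq_bigr => a _ do rewrite big_split /=.
rewrite big_split /= addrC; congr (_ + _).
  rewrite exchange_big; apply: eq_bigr => b _ /=.
  rewrite exchange_big (bigD1 i) //= [X in _ + X]big1 ?addr0.
    by rewrite -mulr_sumr ginvL // eqxx mulr1.
  by move=> l /negPf li; rewrite -mulr_sumr ginvL // eq_sym li mulr0.
apply: eq_bigr => a _; rewrite exchange_big (bigD1 j) //= [X in _ + X]big1 ?addr0.
  by rewrite -mulr_sumr ginvR // eqxx mulr1.
by move=> l /negPf lj; rewrite -mulr_sumr ginvR // lj mulr0.
Qed.

(** The components of the covariant derivative in direction [i] of the covector field [u]. *)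
Definition nabv i u x : idx -> R :=
  fun j => pd i (fun z => u z j) x - \sum_l christoffel g l i j x * u x l.

Definition up u x : idx -> R := fun k => \sum_j ginv g x k j * u x j.

Definition conn i x : idx -> idx -> R := fun j l => christoffel g l i j x.

Lemma nablaE i A x : nabla g i A x = pdx i A x - gl (conn i x) (A x).
Proof. by []. Qed.

Lemma scov_up u : scov V u -> scov V (up u).
Proof.
move=> su k; apply: smooth_sum => // j _; apply: smoothM => //; exact: smooth_ginv.
Qed.

Lemma sform_gl_conn i A : sform V A -> sform V (fun x => gl (conn i x) (A x)).
Proof.
move=> sA; apply: sform_sum => // j; apply: sform_sum => // l.
apply: sformZ => //; first exact: smooth_christoffel.
exact: (sform_lin hV (@eps R n j)) (sform_lin hV (@iot R n l) sA).
Qed.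

Lemma sform_nabla i A : sform V A -> sform V (nabla g i A).
Proof.
by move=> sA; apply: sformB => //; [exact: sform_pdx|exact: sform_gl_conn].
Qed.

Lemma sform_ext_d A : sform V A -> sform V (ext_d g A).
Proof.
move=> sA; apply: sform_sum => // i.
exact: (sform_lin hV (@eps R n i)) (sform_nabla _ sA).
Qed.

Lemma codiffE A x : codiff g A x = \sum_j iwf (ginv g x ^~ j) (nabla g j A x).
Proof. by rewrite /codiff exchange_big. Qed.

Lemma sform_codiff A : sform V A -> sform V (codiff g A).
Proof.
move=> sA; apply: sform_sum => // i; apply: sform_sum => // j.
apply: sformZ => //; first exact: smooth_ginv.
exact: (sform_lin hV (@iot R n i)) (sform_nabla _ sA).
Qed.

Lemma nabla_local i A B x : V x -> (forall y, V y -> A y = B y) -> sform V A ->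
  nabla g i B x = nabla g i A x.
Proof. by move=> Vx AB sA; rewrite !nablaE (pdx_local hV _ Vx AB sA) AB. Qed.

Lemma ext_d_local A B x : V x -> (forall y, V y -> A y = B y) -> sform V A ->
  ext_d g B x = ext_d g A x.
Proof. by move=> Vx AB sA; apply: eq_bigr => i _; rewrite (nabla_local _ Vx AB sA). Qed.

Lemma codiff_local A B x : V x -> (forall y, V y -> A y = B y) -> sform V A ->
  codiff g B x = codiff g A x.
Proof.
move=> Vx AB sA; apply: eq_bigr => i _; apply: eq_bigr => j _.
by rewrite (nabla_local _ Vx AB sA).
Qed.

Lemma nablaD i A B x : V x -> sform V A -> sform V B ->
  nabla g i (fun z => A z + B z) x = nabla g i A x + nabla g i B x.
Proof.
move=> Vx sA sB; rewrite !nablaE (linearD (gl _)) opprD addrACA; congr (_ + _).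
by apply: (pdxE hV Vx); apply: is_pdxD; apply: sform_is_pdx Vx.
Qed.

Lemma nablaZ i f A x : V x -> smooth_on V f -> sform V A ->
  nabla g i (fun z => f z *: A z) x = pd i f x *: A x + f x *: nabla g i A x.
Proof.
move=> Vx sf sA; rewrite !nablaE [gl _ (_ *: _)]linearZ /= scalerBr addrA; congr (_ - _).
by apply: (pdxE hV Vx); apply: is_pdxZ; [apply: smooth_is_pd Vx|apply: sform_is_pdx Vx].
Qed.

Lemma nabla_ewf i u A x : V x -> scov V u -> sform V A ->
  nabla g i (fun z => ewf (u z) (A z)) x =
  ewf (nabv i u x) (A x) + ewf (u x) (nabla g i A x).
Proof.
move=> Vx su sA; rewrite !nablaE gl_ewf linearB /= [ewf (nabv _ _ _) _]ewfD.
have -> : pdx i (fun z => ewf (u z) (A z)) x =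
    ewf (fun j => pd i (fun z => u z j) x) (A x) + ewf (u x) (pdx i A x).
  apply: (pdxE hV Vx); apply: is_pdx_ewf; last exact: sform_is_pdx Vx.
  by move=> j; apply: smooth_is_pd Vx.
rewrite opprD addrACA; congr (_ + _ + _).
rewrite -scaleN1r -ewfZ; apply: eq_ewf => j; by rewrite mulN1r.
Qed.

(** Raising an index commutes with the covariant derivative: the derivatives of [ginv g] are exactly
    the Christoffel terms that turn [pd i u] into [nabv i u]. *)
Lemma nabla_iwf i u A x : V x -> scov V u -> sform V A ->
  nabla g i (fun z => iwf (up u z) (A z)) x =
  iwf (fun k => \sum_j ginv g x k j * nabv i u x j) (A x) +
  iwf (up u x) (nabla g i A x).
Proof.
move=> Vx su sA; rewrite !nablaE gl_iwf linearB /=.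
have -> : pdx i (fun z => iwf (up u z) (A z)) x =
    iwf (fun k => pd i (fun z => up u z k) x) (A x) + iwf (up u x) (pdx i A x).
  apply: (pdxE hV Vx); apply: is_pdx_iwf; last exact: sform_is_pdx Vx.
  by move=> j; apply: smooth_is_pd Vx => //; apply: scov_up.
rewrite opprD opprK addrACA; congr (_ + _); rewrite -iwfD; apply: eq_iwf => k.
have -> : pd i (fun z => up u z k) x =
    \sum_j (pd i (fun z => ginv g z k j) x * u x j +
            ginv g x k j * pd i (fun z => u z j) x).
  apply: (is_pd_on hV Vx); apply: is_pd_sum => j _; apply: is_pdM.
    by apply: smooth_is_pd Vx; apply: smooth_ginv.
  exact: smooth_is_pd Vx.
rewrite big_split /=.
under eq_bigr => j _ do rewrite pd_ginv // mulNr mulrDl opprD.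
rewrite big_split /= !sumrN.
under [RHS]eq_bigr => j _ do rewrite mulrBr.
rewrite sumrB.
have -> : \sum_j (\sum_l christoffel g k i l x * ginv g x l j) * u x j =
    \sum_j conn i x j k * up u x j.
  under eq_bigr => j _ do rewrite mulr_suml.
  rewrite exchange_big; apply: eq_bigr => l _.
  by rewrite mulr_sumr; apply: eq_bigr => j _; rewrite mulrA.
have -> : \sum_j (\sum_l christoffel g j i l x * ginv g x k l) * u x j =
    \sum_j ginv g x k j * (\sum_l christoffel g l i j x * u x l).
  under eq_bigr => j _ do rewrite mulr_suml.
  rewrite exchange_big; apply: eq_bigr => l _.
  by rewrite mulr_sumr; apply: eq_bigr => j _; ring.
ring.
Qed.

End Metric.

(** * Leibniz rules and Cartan-type identities *)

Section Leibniz.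
Variables (R : realType) (n : nat).
Local Notation pt := 'rV[R]_n.+1.
Local Notation idx := 'I_n.+1.
Local Notation ext := (ext R n).
Local Notation lform := (lform R n).
Implicit Types (i j k l m : idx) (x : pt) (f : pt -> R) (A B : lform) (L : ext)
  (u v : pt -> idx -> R).
Variables (V : set pt) (g : pt -> 'M[R]_n.+1).
Hypothesis hV : relopen V.
Hypothesis hg : local_metric V g.

Definition dfun f : pt -> idx -> R := fun x i => pd i f x.

Lemma scov_dfun f : smooth_on V f -> scov V (dfun f).
Proof. by move=> sf j; apply: smooth_pd. Qed.

Lemma ext_dD A B x : V x -> sform V A -> sform V B ->
  ext_d g (fun z => A z + B z) x = ext_d g A x + ext_d g B x.
Proof.
move=> Vx sA sB; rewrite -big_split; apply: eq_bigr => i _.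
by rewrite (nablaD _ hV) // linearD.
Qed.

Lemma codiffD A B x : V x -> sform V A -> sform V B ->
  codiff g (fun z => A z + B z) x = codiff g A x + codiff g B x.
Proof.
move=> Vx sA sB; rewrite !codiffE -big_split; apply: eq_bigr => i _.
by rewrite (nablaD _ hV) // linearD.
Qed.

Lemma ext_dM f A x : V x -> smooth_on V f -> sform V A ->
  ext_d g (fun z => f z *: A z) x = ewf (dfun f x) (A x) + f x *: ext_d g A x.
Proof.
move=> Vx sf sA; rewrite scaler_sumr -big_split; apply: eq_bigr => i _ /=.
by rewrite (nablaZ _ hV) // linearD !linearZ.
Qed.

Lemma codiffM f A x : V x -> smooth_on V f -> sform V A ->
  codiff g (fun z => f z *: A z) x =
  iwf (up g (dfun f) x) (A x) + f x *: codiff g A x.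
Proof.
move=> Vx sf sA; rewrite !codiffE scaler_sumr.
have -> : iwf (up g (dfun f) x) (A x) =
    \sum_j dfun f x j *: iwf (ginv g x ^~ j) (A x).
  rewrite iwf_sum; apply: eq_bigr => j _; rewrite -iwfZ.
  by apply: eq_iwf => k; rewrite mulrC.
rewrite -big_split; apply: eq_bigr => i _ /=.
by rewrite (nablaZ _ hV) // linearD !linearZ.
Qed.

Lemma ext_dZ a A x : V x -> sform V A ->
  ext_d g (fun z => a *: A z) x = a *: ext_d g A x.
Proof.
move=> Vx sA; rewrite (@ext_dM (fun=> a)) //; last exact: smooth_cst.
have -> : ewf (dfun (fun=> a) x) (A x) = 0.
  rewrite /ewf big1 // => i _.
  by rewrite /dfun (is_pd_on hV Vx (is_pd_cst i a x)) scale0r.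
by rewrite add0r.
Qed.

Lemma codiffZ a A x : V x -> sform V A ->
  codiff g (fun z => a *: A z) x = a *: codiff g A x.
Proof.
move=> Vx sA; rewrite (@codiffM (fun=> a)) //; last exact: smooth_cst.
have -> : iwf (up g (dfun (fun=> a)) x) (A x) = 0.
  rewrite /iwf big1 // => i _; rewrite /up big1 ?scale0r // => j _.
  by rewrite /dfun (is_pd_on hV Vx (is_pd_cst j a x)) mulr0.
by rewrite add0r.
Qed.

Lemma ext_dN A x : V x -> sform V A -> ext_d g (fun z => - A z) x = - ext_d g A x.
Proof.
move=> Vx sA; have E : (fun z => - A z) = (fun z => -1 *: A z).
  by apply/funext => z; exact: esym (scaleN1r _).
by rewrite E ext_dZ // scaleN1r.
Qed.

Lemma codiffN A x : V x -> sform V A -> codiff g (fun z => - A z) x = - codiff g A x.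
Proof.
move=> Vx sA; have E : (fun z => - A z) = (fun z => -1 *: A z).
  by apply/funext => z; exact: esym (scaleN1r _).
by rewrite E codiffZ // scaleN1r.
Qed.

Lemma codiffB A B x : V x -> sform V A -> sform V B ->
  codiff g (fun z => A z - B z) x = codiff g A x - codiff g B x.
Proof. by move=> Vx sA sB; rewrite codiffD ?codiffN //; apply: sformN. Qed.

Lemma ext_d0 x : V x -> ext_d g (fun=> 0) x = 0.
Proof.
move=> Vx; have E : (fun=> 0) = (fun _ : pt => (0 : R) *: (0 : ext)).
  by apply/funext => z; exact: esym (scale0r 0).
by rewrite E ext_dZ ?scale0r //; apply: sform_cst.
Qed.

Lemma codiff0 x : V x -> codiff g (fun=> 0) x = 0.
Proof.
move=> Vx; have E : (fun=> 0) = (fun _ : pt => (0 : R) *: (0 : ext)).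
  by apply/funext => z; exact: esym (scale0r 0).
by rewrite E codiffZ ?scale0r //; apply: sform_cst.
Qed.

(** The connection being torsion-free, this says that [u] is closed at [x]. It is used for
    gradients, namely of sigma and of log Omega. *)
Definition sym_nab u x := forall i j, nabv g i u x j = nabv g j u x i.

Lemma sym_nab_dfun f x : V x -> smooth_on V f -> sym_nab (dfun f) x.
Proof.
move=> Vx sf i j; rewrite /nabv /dfun (pd_sym _ _ hV Vx sf); congr (_ - _).
by apply: eq_bigr => l _; congr (_ * _); apply: christoffel_sym hV hg _ _ _ _ Vx.
Qed.

Lemma sum_eps_ewf_sym (H : idx -> idx -> R) (A : ext) : (forall i j, H i j = H j i) ->
  \sum_i eps i (ewf (H i) A) = 0.
Proof.
move=> Hs; apply: opp_self0; rewrite -sumrN.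
transitivity (\sum_i \sum_j H i j *: eps i (eps j A)).
  apply: eq_bigr => i _; rewrite linear_sum; apply: eq_bigr => j _.
  by rewrite linearZ.
rewrite exchange_big; apply: eq_bigr => i _; rewrite linear_sum -sumrN.
by apply: eq_bigr => j _; rewrite linearZ /= Hs eps_eps scalerN.
Qed.

(** The derivative of [u] enters through a symmetric tensor antisymmetrised by two exterior
    multiplications, hence drops out. *)
Lemma ext_d_ewf u A x : V x -> scov V u -> sform V A -> sym_nab u x ->
  ext_d g (fun z => ewf (u z) (A z)) x = - ewf (u x) (ext_d g A x).
Proof.
move=> Vx su sA Hu.
transitivity (\sum_i (eps i (ewf (nabv g i u x) (A x)) -
    ewf (u x) (eps i (nabla g i A x)))).
  by apply: eq_bigr => i _; rewrite (nabla_ewf _ hV) // linearD /= [X in _ + X]eps_ewf.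
rewrite sumrB (sum_eps_ewf_sym (H := fun i => nabv g i u x)) // sub0r.
by congr (- _); rewrite [RHS]linear_sum.
Qed.

(** As for [ext_d_ewf], with two contractions in place of two exterior multiplications. *)
Lemma codiff_iwf u A x : V x -> scov V u -> sform V A -> sym_nab u x ->
  codiff g (fun z => iwf (up g u z) (A z)) x = - iwf (up g u x) (codiff g A x).
Proof.
move=> Vx su sA Hu; rewrite !codiffE.
pose H j := iwf (fun k => \sum_l ginv g x k l * nabv g j u x l) (A x).
transitivity (\sum_j (iwf (ginv g x ^~ j) (H j) -
    iwf (up g u x) (iwf (ginv g x ^~ j) (nabla g j A x)))).
  by apply: eq_bigr => j _; rewrite (nabla_iwf hV hg) // linearD /= [X in _ + X]iwf_iwf.
rewrite sumrB [iwf (up _ _ _) _]linear_sum /=.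
suff -> : \sum_j iwf (ginv g x ^~ j) (H j) = 0 by rewrite sub0r.
have E : \sum_j iwf (ginv g x ^~ j) (H j) =
    \sum_j \sum_l nabv g j u x l *: iwf (ginv g x ^~ j) (iwf (ginv g x ^~ l) (A x)).
  apply: eq_bigr => j _; rewrite /H iwf_sum linear_sum; apply: eq_bigr => l _ /=.
  by rewrite -linearZ -iwfZ; congr iwf; apply: eq_iwf => k; rewrite mulrC.
rewrite E; apply: opp_self0; rewrite {1}exchange_big -sumrN; apply: eq_bigr => j _.
rewrite -sumrN; apply: eq_bigr => l _.
by rewrite Hu iwf_iwf scalerN.
Qed.

(** Two anticommutators are compared: [codiff] with exterior multiplication by [u], and [ext_d] with
    contraction by [u]. Both contain the derivative of [A] along the gradient [up g u]. It cancels
    in the difference, leaving the trace of nabla u minus twice its action as a derivation. *)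
Lemma lie_codiff u A x : V x -> scov V u -> sform V A -> sym_nab u x ->
  codiff g (fun z => ewf (u z) (A z)) x + ewf (u x) (codiff g A x)
  - iwf (up g u x) (ext_d g A x) - ext_d g (fun z => iwf (up g u z) (A z)) x =
  (\sum_i \sum_j ginv g x i j * nabv g i u x j) *: A x
  - 2 *: gl (fun k i => \sum_j ginv g x i j * nabv g j u x k) (A x).
Proof.
move=> Vx su sA Hu; rewrite !codiffE.
pose H j k := \sum_l ginv g x k l * nabv g j u x l.
have E1 : \sum_j iwf (ginv g x ^~ j) (nabla g j (fun z => ewf (u z) (A z)) x) =
  (\sum_i \sum_j ginv g x i j * nabv g i u x j) *: A x
  - gl (fun k i => \sum_j ginv g x i j * nabv g j u x k) (A x)
  + \sum_j up g u x j *: nabla g j A x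
  - ewf (u x) (\sum_j iwf (ginv g x ^~ j) (nabla g j A x)).
  transitivity (\sum_j ((\sum_i ginv g x i j * nabv g j u x i) *: A x
     - ewf (nabv g j u x) (iwf (ginv g x ^~ j) (A x)) +
     up g u x j *: nabla g j A x - ewf (u x) (iwf (ginv g x ^~ j) (nabla g j A x)))).
    apply: eq_bigr => j _; rewrite (nabla_ewf _ hV) // linearD /= !iwf_ewf.
    rewrite !addrA; congr (_ + _ *: _ - _); apply: eq_bigr => i _.
    by rewrite (ginv_sym hg).
  rewrite !big_split /= !sumrN -scaler_suml; congr (_ *: _ - _ + _ - _).
    by rewrite exchange_big; apply: eq_bigr => i _; apply: eq_bigr => j _;
      rewrite Hu.
  - rewrite -[RHS]/(gl (fun k l => \sum_j ginv g x l j * nabv g j u x k) (A x)) glE.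
  transitivity (\sum_j \sum_i ginv g x i j *: ewf (nabv g j u x) (iot i (A x))).
    by apply: eq_bigr => j _; rewrite [ewf _ (iwf _ _)]linear_sum;
      apply: eq_bigr => i _; rewrite linearZ.
  rewrite exchange_big; apply: eq_bigr => i _; rewrite ewf_sum.
    by apply: eq_bigr => j _; rewrite ewfZ.
  - by rewrite [RHS]linear_sum.
have E2 : ext_d g (fun z => iwf (up g u z) (A z)) x =
  gl (fun k i => \sum_j ginv g x i j * nabv g j u x k) (A x) +
  \sum_j up g u x j *: nabla g j A x - iwf (up g u x) (ext_d g A x).
  transitivity (\sum_j (eps j (iwf (H j) (A x)) + up g u x j *: nabla g j A x -
     iwf (up g u x) (eps j (nabla g j A x)))).
    apply: eq_bigr => j _; rewrite (nabla_iwf hV hg) // linearD /= -addrA.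
    by congr (_ + _); rewrite iwf_eps opprB addrC subrK.
  rewrite sumrB big_split /= [iwf _ (ext_d _ _ _)]linear_sum; congr (_ + _ - _).
  apply: eq_bigr => j _; rewrite linear_sum; apply: eq_bigr => i _.
  rewrite linearZ /=; congr (_ *: _); apply: eq_bigr => l _.
  by rewrite Hu.
rewrite E1 E2.
set a := _ *: A x; set b := gl _ _; set d := \sum_j _; set e := ewf _ _.
set q := iwf _ _.
move: a b d e q => a b d e q.
by apply/ffunP => S; rewrite !(extDE, extNE, extZE); ring.
Qed.

End Leibniz.

(** * Conformal rescaling *)

Section Conformal.
Variables (R : realType) (n : nat).
Local Notation pt := 'rV[R]_n.+1.
Local Notation idx := 'I_n.+1.
Local Notation ext := (ext R n).
Local Notation lform := (lform R n).
Implicit Types (i j k l m : idx) (x : pt) (f : pt -> R) (A B : lform) (L : ext)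
  (u v : pt -> idx -> R).

Lemma sum_deltal (F : idx -> R) i : \sum_k (i == k)%:R * F k = F i.
Proof.
rewrite (bigD1 i) //= eqxx mul1r big1 ?addr0 // => k /negPf.
by rewrite eq_sym => ->; rewrite mul0r.
Qed.

Lemma sum_deltar (F : idx -> R) i : \sum_k (k == i)%:R * F k = F i.
Proof. by rewrite -[RHS]sum_deltal; apply: eq_bigr => k _; rewrite eq_sym. Qed.

Lemma sum_deltaZ (F : idx -> ext) i : \sum_k (i == k)%:R *: F k = F i.
Proof.
rewrite (bigD1 i) //= eqxx scale1r big1 ?addr0 // => k /negPf.
by rewrite eq_sym => ->; rewrite scale0r.
Qed.

Lemma sum_iot_iwf_sym (H : idx -> idx -> R) (A : ext) : (forall i j, H i j = H j i) ->
  \sum_i iwf (H i) (iot i A) = 0.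
Proof.
move=> Hs; apply: opp_self0.
transitivity (\sum_j \sum_i H i j *: iot j (iot i A)); first exact: exchange_big.
rewrite -sumrN; apply: eq_bigr => j _; rewrite /iwf -sumrN; apply: eq_bigr => i _.
by rewrite Hs iot_iot scalerN.
Qed.

Variables (V : set pt) (g gh : pt -> 'M[R]_n.+1) (Om : pt -> R).
Hypothesis hV : relopen V.
Hypothesis hg : local_metric V g.
Hypothesis Om_smooth : smooth_on V Om.
Hypothesis Om_gt0 : forall x, V x -> 0 < Om x.
Hypothesis ghE : forall x, V x -> gh x = (Om x) ^+ 2 *: g x.

(** The covector field Upsilon of the transformation laws. *)
Definition dlog : pt -> idx -> R := dfun (fun z => ln (Om z)).

Lemma smooth_lnOm : smooth_on V (fun z => ln (Om z)).
Proof. by apply: smooth_ln. Qed.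

Lemma scov_dlog : scov V dlog.
Proof. by apply: scov_dfun; apply: smooth_lnOm. Qed.

Lemma pd_Om i x : V x -> pd i Om x = Om x * dlog x i.
Proof.
move=> Vx; rewrite /dlog /dfun.
rewrite (is_pd_on hV Vx (is_pd_ln (Om_gt0 Vx) (smooth_is_pd Om_smooth Vx))).
by rewrite mulrA divff ?mul1r // gt_eqF // Om_gt0.
Qed.

Lemma pd_powR_Om (w : R) i x : V x ->
  pd i (fun z => Om z `^ w) x = w * Om x `^ w * dlog x i.
Proof.
move=> Vx.
rewrite (is_pd_on hV Vx (is_pd_powR (a := w) (Om_gt0 Vx) (smooth_is_pd Om_smooth Vx))).
have O0 := Om_gt0 Vx.
have E : Om x `^ w = Om x `^ (w - 1) * Om x.
  rewrite -{1}(subrK 1 w) (@powRD _ (Om x) (w - 1) 1) ?powRr1 ?(ltW O0) //.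
  by rewrite (gt_eqF O0) implybT.
by rewrite pd_Om // E; ring.
Qed.

Lemma ginv_gh x i j : V x -> ginv gh x i j = Om x ^- 2 * ginv g x i j.
Proof.
move=> Vx; have [_ _ gu] := hg.
have O2 : Om x ^+ 2 \is a GRing.unit by rewrite unitfE expf_neq0 // gt_eqF // Om_gt0.
rewrite /ginv ghE // invmxZ ?mxE // unitmxZ //; exact: gu.
Qed.

Lemma pd_gh x i m j : V x -> pd i (fun z => gh z m j) x =
  Om x ^+ 2 * (2 * dlog x i * g x m j + pd i (fun z => g z m j) x).
Proof.
move=> Vx; have [sg gs gu] := hg; apply: (is_pd_on hV Vx).
have dO := smooth_is_pd (i := i) Om_smooth Vx.
have H := is_pdM (is_pdM dO dO) (smooth_is_pd (i := i) (sg m j) Vx).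
apply: is_pd_val (is_pd_local hV Vx _ H) _.
  by move=> y Vy; rewrite ghE // mxE.
by rewrite pd_Om //; ring.
Qed.

Lemma christoffel_gh l i j x : V x -> christoffel gh l i j x =
  christoffel g l i j x + ((l == i)%:R * dlog x j + (l == j)%:R * dlog x i
    - g x i j * up g dlog x l).
Proof.
move=> Vx.
have O0 : Om x != 0 by rewrite gt_eqF // Om_gt0.
(* The Kronecker deltas are expanded as products of the inverse metric with the metric, so that both
   sides become sums over [m] and can be compared term by term. *)
have -> : (l == i)%:R * dlog x j = \sum_m ginv g x l m * g x m i * dlog x j.
  by rewrite -mulr_suml (ginvL hg).
have -> : (l == j)%:R * dlog x i = \sum_m ginv g x l m * g x m j * dlog x i.
  by rewrite -mulr_suml (ginvL hg).
rewrite /christoffel /up !mulr_sumr -!big_split -sumrN -!big_split /=.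
apply: eq_bigr => m _; rewrite ginv_gh // !pd_gh //.
move: (pd i _ x) (pd j _ x) (pd m _ x) (ginv g x l m) (dlog x) => a b a' b' D.
move: (g x m j) (g x m i) (g x i j) (Om x) O0 => c c' c'' o o0.
by field.
Qed.

Lemma gl_conn_gh i (A : ext) x : V x -> gl (conn gh i x) A = gl (conn g i x) A +
  (ewf (dlog x) (iot i A) + dlog x i *: (\sum_j eps j (iot j A))
   - ewf (g x i) (iwf (up g dlog x) A)).
Proof.
move=> Vx.
have -> : gl (conn gh i x) A = gl (fun j l => conn g i x j l +
   ((fun j l => (i == l)%:R * dlog x j) j l +
    (dlog x i * (j == l)%:R + -1 * (g x i j * up g dlog x l)))) A.
  apply: eq_gl => j l; rewrite /conn christoffel_gh // [l == i]eq_sym [l == j]eq_sym.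
  by ring.
rewrite !glD !glZ gl_delta scaleN1r !addrA; congr (_ + _ + _ - _).
- rewrite glE -[RHS](sum_deltaZ (fun l => ewf (dlog x) (iot l A))).
  by apply: eq_bigr => l _; rewrite ewfZ.
- rewrite glE [RHS]linear_sum; apply: eq_bigr => l _ /=.
  by rewrite linearZ /= -ewfZ; apply: eq_ewf => j; rewrite mulrC.
Qed.

Lemma nabla_gh i A x : V x -> nabla gh i A x = nabla g i A x -
  (ewf (dlog x) (iot i (A x)) + dlog x i *: (\sum_j eps j (iot j (A x)))
   - ewf (g x i) (iwf (up g dlog x) (A x))).
Proof. by move=> Vx; rewrite !nablaE gl_conn_gh // opprD addrA. Qed.

(** Of the three terms by which the connection changes, the first two give opposite multiples of
    Upsilon wedged with [N], and the third is antisymmetrised against the symmetric [g]. *)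
Lemma ext_d_gh A x : V x -> ext_d gh A x = ext_d g A x.
Proof.
move=> Vx; rewrite /ext_d.
set N := \sum_j eps j (iot j (A x)).
transitivity (\sum_i (eps i (nabla g i A x) - (- ewf (dlog x) (eps i (iot i (A x)))
    + dlog x i *: eps i N - eps i (ewf (g x i) (iwf (up g dlog x) (A x)))))).
  apply: eq_bigr => i _; rewrite nabla_gh // linearB; congr (_ - _).
  by rewrite linearB linearD; congr (_ + _ - _); [rewrite /= eps_ewf|rewrite linearZ].
rewrite sumrB sumrB big_split /= sum_eps_ewf_sym; last by move=> i j; apply: (g_sym hg).
by rewrite subr0 sumrN -(linear_sum (ewf (dlog x))) /= addNr subr0.
Qed.

(** The three terms of the change of connection contract to 1, [k] and - (d - (k - 1)) times [B].
    They are subtracted, which gives the coefficient d - 2 k. *)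
Lemma codiff_gh (k : int) A x : V x -> ext_deg k (A x) -> codiff gh A x =
  Om x ^- 2 *: (codiff g A x +
    (n.+1%:R - 2 * k%:~R) *: iwf (up g dlog x) (A x)).
Proof.
move=> Vx dA; rewrite !codiffE.
set B := iwf _ _.
have dB : ext_deg (k - 1) B by apply: ext_deg_iwf.
have t1 : \sum_j iwf (ginv g x ^~ j) (ewf (dlog x) (iot j (A x))) = B.
  under eq_bigr => j _ do rewrite iwf_ewf.
  rewrite sumrB -(linear_sum (ewf (dlog x))) /=.
  have -> : \sum_j iwf ((ginv g x)^~ j) (iot j (A x)) = 0.
    by rewrite (@sum_iot_iwf_sym (fun j => ginv g x ^~ j)) // => i j;
      apply: (ginv_sym hg).
  rewrite linear0 subr0; apply: eq_bigr => j _; congr (_ *: _).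
  by apply: eq_bigr => i _; rewrite (ginv_sym hg).
have t2 : \sum_j iwf (ginv g x ^~ j) (dlog x j *: (\sum_i eps i (iot i (A x))))
    = k%:~R *: B.
  rewrite (sum_eps_iot dA); under eq_bigr => j _ do rewrite !linearZ /= scalerA mulrC -scalerA.
  rewrite -scaler_sumr; congr (_ *: _); rewrite /B iwf_sum; apply: eq_bigr => j _.
  by rewrite -iwfZ; apply: eq_iwf => i; rewrite mulrC.
have t3 : \sum_j iwf (ginv g x ^~ j) (ewf (g x j) B) = (n.+1%:R - (k%:~R - 1)) *: B.
  under eq_bigr => j _ do rewrite iwf_ewf.
  rewrite sumrB scalerBl; congr (_ - _).
    rewrite -scaler_suml; congr (_ *: _).
    rewrite exchange_big /=.
    under eq_bigr => i _ do rewrite (ginvL hg _ _ Vx) eqxx.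
    by rewrite sumr_const card_ord.
  have -> : k%:~R - 1 = (k - 1)%:~R :> R by rewrite intrB.
  rewrite -(sum_eps_iot dB).
  transitivity (\sum_j \sum_i ginv g x i j *: ewf (g x j) (iot i B)).
    by apply: eq_bigr => j _; rewrite [LHS]linear_sum; apply: eq_bigr => i _;
      rewrite linearZ.
  rewrite exchange_big; apply: eq_bigr => i _ /=.
  transitivity (ewf (fun m => \sum_j ginv g x i j * g x j m) (iot i B)).
    by rewrite ewf_sum; apply: eq_bigr => j _; rewrite ewfZ.
  rewrite -ewf_delta; apply: eq_ewf => m; by rewrite (ginvL hg) // eq_sym.
transitivity (Om x ^- 2 *: \sum_j iwf (ginv g x ^~ j) (nabla gh j A x)).
  rewrite scaler_sumr; apply: eq_bigr => j _; rewrite -iwfZ; apply: eq_iwf => i.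
  exact: ginv_gh.
congr (_ *: _).
transitivity (\sum_j (iwf (ginv g x ^~ j) (nabla g j A x) -
    (iwf (ginv g x ^~ j) (ewf (dlog x) (iot j (A x))) +
     iwf (ginv g x ^~ j) (dlog x j *: (\sum_i eps i (iot i (A x)))) -
     iwf (ginv g x ^~ j) (ewf (g x j) B)))).
  apply: eq_bigr => j _; rewrite nabla_gh //; move: (nabla g j A x) => C.
  by rewrite linearB; congr (_ - _); rewrite linearB; congr (_ - _); rewrite linearD.
rewrite sumrB sumrB big_split /= t1 t2 t3.
move: (\sum_j _) B {dB t1 t2 t3} => C B.
by apply/ffunP => S; rewrite !(extDE, extNE, extZE); ring.
Qed.

End Conformal.

(** * Changes of coordinates *)

Section Pullback.
Variables (R : realType) (n : nat).
Local Notation pt := 'rV[R]_n.+1.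
Local Notation idx := 'I_n.+1.
Local Notation ext := (ext R n).
Local Notation lform := (lform R n).
Implicit Types (i j k l m p q r : idx) (x : pt) (f : pt -> R) (A B : lform)
  (u v : pt -> idx -> R).

(** Pull-back is an algebra morphism, so differentiating its matrix replaces one factor dy^j at a
    time by its derivative; by [ext_ind] it suffices to check this Leibniz rule on [eps k C]. *)
Lemma is_pdx_pullback (J : pt -> 'M[R]_n.+1) (dJ : idx -> idx -> R) i x (C : ext) :
  (forall m j, is_pd i (fun z => J z m j) x (dJ m j)) ->
  is_pdx i (fun z => pullback (J z) C) x
    (\sum_m \sum_j dJ m j *: eps m (pullback (J x) (iot j C))).
Proof.
move=> JP.
pose dP (C : ext) := \sum_m eps m (pullback (J x) (iwf (dJ m) C)).
have dPE D : \sum_m \sum_j dJ m j *: eps m (pullback (J x) (iot j D)) = dP D.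
  apply: eq_bigr => m _; rewrite /iwf (linear_sum (pullback (J x))).
  by rewrite (linear_sum (@eps R n m)); apply: eq_bigr => j _; rewrite !linearZ.
rewrite dPE; elim/ext_ind: C => [|k C IH|a C D IHC IHD].
- have -> : dP (ext1 R n) = 0.
    rewrite /dP big1 // => m _; rewrite /iwf big1 ?linear0 // => j _.
    by rewrite iot_ext1 scaler0.
  apply: (@is_pdx_ext _ _ i (fun=> ext1 R n)) => [z|S].
    by rewrite pullback_ext1.
  by rewrite ext0E; apply: is_pd_cst.
- have -> : dP (eps k C) = ewf (dJ ^~ k) (pullback (J x) C) +
      ewf (fun m => J x m k) (dP C).
    rewrite /dP (linear_sum (ewf (fun m => J x m k))) -big_split; apply: eq_bigr => m _ /=.
    rewrite iwf_eps linearB linearZ /= linearB linearZ /=; congr (_ + _).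
    by rewrite pullback_eps eps_ewf opprK.
  apply: is_pdx_ext (is_pdx_ewf (u := fun z m => J z m k) _ IH).
    by move=> z; rewrite pullback_eps.
  by move=> m; apply: JP.
- have -> : dP (a *: C + D) = a *: dP C + dP D.
    rewrite /dP scaler_sumr -big_split; apply: eq_bigr => m _.
    by rewrite !linearP.
  have H := is_pdxD (is_pdxZ (is_pd_cst i a x) IHC) IHD.
  rewrite scale0r add0r in H; apply: is_pdx_ext H => z; by rewrite linearP.
Qed.

Lemma is_pdx_pullback_form (J : pt -> 'M[R]_n.+1) (dJ : idx -> idx -> R) i x B
    (L : ext) :
  (forall m j, is_pd i (fun z => J z m j) x (dJ m j)) -> is_pdx i B x L ->
  is_pdx i (fun z => pullback (J z) (B z)) x
   (\sum_m \sum_j dJ m j *: eps m (pullback (J x) (iot j (B x))) +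
    pullback (J x) L).
Proof.
move=> JP BL.
pose F U z := B z U *: pullback (J z) (ext_basis R U).
pose dP U := \sum_m \sum_j dJ m j *:
      eps m (pullback (J x) (iot j (ext_basis R U))).
have H : is_pdx i (fun z => \sum_U F U z) x
    (\sum_U (L U *: pullback (J x) (ext_basis R U) + B x U *: dP U)).
  by apply: is_pdx_sum => U; apply: is_pdxZ; [exact: BL|exact: is_pdx_pullback].
have E : \sum_U (L U *: pullback (J x) (ext_basis R U) + B x U *: dP U) =
   \sum_m \sum_j dJ m j *: eps m (pullback (J x) (iot j (B x))) + pullback (J x) L.
  rewrite big_split /= addrC; congr (_ + _).
    rewrite {2}(ext_basisE (B x)).
    under eq_bigr => U _ do rewrite scaler_sumr.
    rewrite exchange_big; apply: eq_bigr => m _ /=.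
    under eq_bigr => U _ do rewrite scaler_sumr.
    rewrite exchange_big; apply: eq_bigr => j _ /=.
    rewrite (linear_sum (@iot R n j)) (linear_sum (pullback (J x))).
    rewrite (linear_sum (@eps R n m)) scaler_sumr.
    by apply: eq_bigr => U _; rewrite !linearZ /= !scalerA mulrC.
  rewrite {2}(ext_basisE L) linear_sum; apply: eq_bigr => U _.
  by rewrite linearZ.
rewrite -E; apply: is_pdx_ext H => z.
rewrite [in RHS](ext_basisE (B z)) linear_sum; apply: eq_bigr => U _.
by rewrite linearZ.
Qed.

Section Transition.
Variables (Va Vb : set pt) (ga gb : pt -> 'M[R]_n.+1) (phi : pt -> pt).
Hypothesis hVa : relopen Va.
Hypothesis hVb : relopen Vb.
Hypothesis hga : local_metric Va ga.
Hypothesis hgb : local_metric Vb gb.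
Hypothesis phiV : forall x, Va x -> Vb (phi x).
Hypothesis phi_smooth : forall j, smooth_on Va (fun z => phi z ord0 j).

Definition jac_mx (phi : pt -> pt) x : 'M[R]_n.+1 :=
  \matrix_(i, j) pd i (fun z => phi z ord0 j) x.
Local Notation J := (jac_mx phi).

Hypothesis gaE : forall x, Va x -> ga x = J x *m gb (phi x) *m (J x)^T.

Lemma smooth_jac_mx i j : smooth_on Va (fun x => J x i j).
Proof.
apply: (smooth_on_eq hVa) (smooth_pd i (phi_smooth j)) => x _.
by rewrite mxE.
Qed.

Lemma pd_jac_mx_sym i j k x : Va x ->
  pd k (fun z => J z i j) x = pd i (fun z => J z k j) x.
Proof.
move=> Vx; have E i' : (fun z => J z i' j) = pd i' (fun z => phi z ord0 j).
  by apply/funext => z; rewrite mxE.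
by rewrite !E; exact: pd_sym _ _ hVa Vx (phi_smooth j).
Qed.

Lemma is_pd_phi f i x : smooth_on Vb f -> Va x ->
  is_pd i (fun z => f (phi z)) x (\sum_p J x i p * pd p f (phi x)).
Proof.
move=> sf Vx.
apply: is_pd_val (smooth_chain (i := i) hVb hVa Vx phiV sf phi_smooth) _.
by apply: eq_bigr => p _; rewrite mxE.
Qed.

Lemma is_pdx_phi B i x : sform Vb B -> Va x ->
  is_pdx i (fun z => B (phi z)) x (\sum_p J x i p *: pdx p B (phi x)).
Proof.
move=> sB Vx S; rewrite sum_ffunE.
have H : is_pd i (fun z => B (phi z) S) x
    (\sum_p J x i p * pd p (fun z => B z S) (phi x)).
  exact: (is_pd_phi (f := fun z => B z S)).
apply: is_pd_val H _.
by apply: eq_bigr => p _; rewrite extZE ffunE.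
Qed.

Lemma is_pdx_pullback_phi B i x : sform Vb B -> Va x ->
  is_pdx i (fun z => pullback (J z) (B (phi z))) x
   (\sum_m \sum_j pd i (fun z => J z m j) x *:
      eps m (pullback (J x) (iot j (B (phi x)))) +
    pullback (J x) (\sum_p J x i p *: pdx p B (phi x))).
Proof.
move=> sB Vx; apply: (is_pdx_pullback_form (B := fun z => B (phi z))).
  by move=> m j; apply: smooth_is_pd Vx; apply: smooth_jac_mx.
exact: is_pdx_phi.
Qed.

Lemma jac_mx_unit x : Va x -> J x \in unitmx.
Proof.
move=> Vx; have [_ _ gu] := hga; have := gu _ Vx.
by rewrite gaE // !unitmx_mul => /andP[/andP[]].
Qed.

Lemma ga_sum x m j : Va x ->
  ga x m j = \sum_p \sum_q J x m p * gb (phi x) p q * J x j q.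
Proof.
move=> Vx; rewrite gaE // mxE exchange_big; apply: eq_bigr => q _.
by rewrite [(J x *m _) _ _]mxE [_^T _ _]mxE mulr_suml.
Qed.

(** In the derivative of [ga], [X] collects the terms in which the Jacobian is differentiated, [Y]
    those in which [gb] is differentiated along [phi]. *)
Let X i m j x := \sum_p \sum_q pd i (fun z => J z m p) x * gb (phi x) p q * J x j q.
Let Y i m j x := \sum_p \sum_q \sum_r
  J x m p * J x j q * J x i r * pd r (fun z => gb z p q) (phi x).

Lemma pd_ga i m j x : Va x ->
  pd i (fun z => ga z m j) x = X i m j x + X i j m x + Y i m j x.
Proof.
move=> Vx; have [sg _ _] := hgb.
have JP a b : is_pd i (fun z => J z a b) x (pd i (fun z => J z a b) x).
  by apply: smooth_is_pd Vx; apply: smooth_jac_mx.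
have H : is_pd i (fun z => \sum_p \sum_q J z m p * gb (phi z) p q * J z j q) x
  (\sum_p \sum_q ((pd i (fun z => J z m p) x * gb (phi x) p q +
     J x m p * (\sum_r J x i r * pd r (fun z => gb z p q) (phi x))) * J x j q +
     J x m p * gb (phi x) p q * pd i (fun z => J z j q) x)).
  apply: is_pd_sum => p _; apply: is_pd_sum => q _.
  apply: is_pdM => //; apply: is_pdM => //.
  exact: (is_pd_phi (f := fun z => gb z p q)).
have {}H := is_pd_local hVa Vx (fun y Vy => esym (ga_sum m j Vy)) H.
rewrite (is_pd_on hVa Vx H) {H} /X /Y.
rewrite [\sum_p \sum_q pd i (fun z => J z j p) x * _ * _]exchange_big -!big_split.
apply: eq_bigr => p _; rewrite -!big_split; apply: eq_bigr => q _ /=.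
rewrite (g_sym hgb q p (phiV Vx)).
have -> : \sum_r J x m p * J x j q * J x i r * pd r (fun z => gb z p q) (phi x) =
  J x m p * (\sum_r J x i r * pd r (fun z => gb z p q) (phi x)) * J x j q.
  rewrite mulr_sumr mulr_suml; apply: eq_bigr => r _.
  move: (pd r _ _) => a; ring.
move: (\sum_r _) (pd i _ x) (pd i _ x) => a b c; ring.
Qed.

(* Both sides are compared after multiplication by ga = J gb J^T, which lowers the
   index l. *)
Lemma christoffel_transition i j k x : Va x ->
  \sum_l christoffel ga l i j x * J x l k = pd i (fun z => J z j k) x +
  \sum_p \sum_q J x i p * J x j q * christoffel gb k p q (phi x).
Proof.
move=> Vx; have [sg _ gu] := hgb.
pose S k := \sum_l christoffel ga l i j x * J x l k.
pose T k := pd i (fun z => J z j k) x +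
  \sum_p \sum_q J x i p * J x j q * christoffel gb k p q (phi x).
rewrite -/(S k) -/(T k).
have Xs a b d : X a b d x = X b a d x.
  by apply: eq_bigr => p _; apply: eq_bigr => q _; rewrite pd_jac_mx_sym.
have low m : \sum_l ga x m l * christoffel ga l i j x =
    X i j m x + 2^-1 * (Y i m j x + Y j m i x - Y m i j x).
  rewrite (christoffel_low hga) // !pd_ga //.
  rewrite (Xs m i) (Xs m j) (Xs j i).
  move: (X _ _ _ _) (X _ _ _ _) (X _ _ _ _) (Y _ _ _ _) (Y _ _ _ _) (Y _ _ _ _).
  by move=> a b d e h o; field.
have lowT m : X i j m x + 2^-1 * (Y i m j x + Y j m i x - Y m i j x) =
    \sum_p \sum_k J x m p * gb (phi x) p k * T k.
  have -> : \sum_p \sum_k J x m p * gb (phi x) p k * T k =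
     \sum_p \sum_k J x m p * gb (phi x) p k * pd i (fun z => J z j k) x +
     \sum_p J x m p * (\sum_r \sum_q J x i r * J x j q *
        (\sum_k gb (phi x) p k * christoffel gb k r q (phi x))).
    rewrite -big_split; apply: eq_bigr => p _ /=.
    under eq_bigr => k' _ do rewrite mulrDr.
    rewrite big_split /=; congr (_ + _).
    under [LHS]eq_bigr => k' _ do rewrite -mulrA mulr_sumr.
    rewrite -mulr_sumr; congr (_ * _); rewrite exchange_big; apply: eq_bigr => r _ /=.
    under [LHS]eq_bigr => k' _ do rewrite mulr_sumr.
    rewrite exchange_big; apply: eq_bigr => q _ /=.
    by rewrite mulr_sumr; apply: eq_bigr => k' _; ring.
  congr (_ + _).
    rewrite /X exchange_big; apply: eq_bigr => p _; apply: eq_bigr => q _.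
    by rewrite (g_sym hgb q p (phiV Vx)); ring.
  have -> : Y j m i x = \sum_p \sum_q \sum_r
     J x m p * J x j q * J x i r * pd q (fun z => gb z p r) (phi x).
    apply: eq_bigr => p _; rewrite exchange_big; apply: eq_bigr => q _.
    by apply: eq_bigr => r _; ring.
  have -> : Y m i j x = \sum_p \sum_q \sum_r
     J x m p * J x j q * J x i r * pd p (fun z => gb z r q) (phi x).
    rewrite /Y.
    under eq_bigr => p _ do rewrite exchange_big.
    rewrite exchange_big; apply: eq_bigr => p _ /=.
    rewrite exchange_big; apply: eq_bigr => q _ /=.
    by apply: eq_bigr => r _; ring.
  rewrite -sumrN -!big_split mulr_sumr; apply: eq_bigr => p _ /=.
  rewrite -sumrN -!big_split mulr_sumr [\sum_r \sum_q _]exchange_big mulr_sumr.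
  apply: eq_bigr => q _ /=.
  rewrite -sumrN -!big_split mulr_sumr mulr_sumr; apply: eq_bigr => r _ /=.
  rewrite (christoffel_low hgb p r q (phiV Vx)).
  move: (pd r _ _) (pd q _ _) (pd p _ _) => a b d; ring.
have gaS m : \sum_l ga x m l * christoffel ga l i j x =
    \sum_p \sum_k J x m p * gb (phi x) p k * S k.
  under eq_bigr => l _ do rewrite ga_sum // mulr_suml.
  rewrite exchange_big; apply: eq_bigr => p _ /=.
  under eq_bigr => l _ do rewrite mulr_suml.
  rewrite exchange_big; apply: eq_bigr => q _ /=.
  by rewrite mulr_sumr; apply: eq_bigr => l _; ring.
have ST : (J x *m gb (phi x)) *m (\col_k S k) = (J x *m gb (phi x)) *m (\col_k T k).
  have E (Q : idx -> R) m : ((J x *m gb (phi x)) *m (\col_k Q k)) m ord0 =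
      \sum_p \sum_k J x m p * gb (phi x) p k * Q k.
    rewrite mxE exchange_big; apply: eq_bigr => q _ /=.
    by rewrite [(J x *m _) _ _]mxE [(\col_k _) _ _]mxE mulr_suml.
  apply/matrixP => m a; rewrite (ord1 a) !E -gaS -lowT; exact: low.
have U : J x *m gb (phi x) \in unitmx.
  by rewrite unitmx_mul jac_mx_unit // gu //; apply: phiV.
have /(congr1 (mulmx (invmx (J x *m gb (phi x))))) := ST.
by rewrite !(mulKmx U) => /colP /(_ k); rewrite !mxE.
Qed.

Definition forms_match A B := forall x, Va x -> A x = pullback (J x) (B (phi x)).

(** [X1] contains the second derivatives of [phi]. It arises once from differentiating the Jacobian
    in the pull-back and once from the inhomogeneous term of [christoffel_transition], and
    cancels. *)
Lemma nabla_transition A B i x : forms_match A B -> sform Vb B -> Va x ->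
  nabla ga i A x = pullback (J x) (\sum_p J x i p *: nabla gb p B (phi x)).
Proof.
move=> AB sB Vx.
pose X1 := \sum_m \sum_j pd i (fun z => J z m j) x *:
      eps m (pullback (J x) (iot j (B (phi x)))).
pose P1 := \sum_p J x i p *: pdx p B (phi x).
pose P2 := \sum_p J x i p *: gl (conn gb p (phi x)) (B (phi x)).
have EA : pdx i A x = X1 + pullback (J x) P1.
  apply: (pdxE hVa Vx) => S.
  have H : is_pdx i (fun z => pullback (J z) (B (phi z))) x
    (X1 + pullback (J x) P1) by exact: is_pdx_pullback_phi.
  by apply: (is_pd_local hVa Vx _ (H S)) => y Vy; rewrite AB.
have EB : \sum_p J x i p *: nabla gb p B (phi x) = P1 - P2.
  by rewrite -sumrB; apply: eq_bigr => p _; rewrite nablaE scalerBr.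
have EC : gl (conn ga i x) (A x) = X1 + pullback (J x) P2.
  rewrite AB // glE /X1 /P2; move: (B (phi x)) => C.
  transitivity (\sum_k ewf (fun j => \sum_l christoffel ga l i j x * J x l k)
      (pullback (J x) (iot k C))).
    transitivity (\sum_l \sum_k ewf (fun j => christoffel ga l i j x * J x l k)
      (pullback (J x) (iot k C))).
      apply: eq_bigr => l _; rewrite iot_pullback /iwf (linear_sum (pullback (J x))).
      rewrite (linear_sum (ewf _)); apply: eq_bigr => k _.
      by rewrite !linearZ /= -ewfZ; apply: eq_ewf => j; rewrite mulrC.
    by rewrite exchange_big; apply: eq_bigr => k _; rewrite -ewf_sum.
  transitivity (\sum_k (ewf (fun j => pd i (fun z => J z j k) x) (pullback (J x) (iot k C))
    + ewf (fun j => \sum_p J x i p * (\sum_q J x j q * christoffel gb k p q (phi x)))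
        (pullback (J x) (iot k C)))).
    apply: eq_bigr => k _; rewrite -ewfD; apply: eq_ewf => j.
    rewrite christoffel_transition //; congr (_ + _); apply: eq_bigr => p _.
    by rewrite mulr_sumr; apply: eq_bigr => q _; rewrite mulrA.
  rewrite big_split /= exchange_big; congr (_ + _).
  rewrite (linear_sum (pullback (J x))) /=.
  transitivity (\sum_k \sum_p J x i p *: ewf (fun j => \sum_q J x j q *
     christoffel gb k p q (phi x)) (pullback (J x) (iot k C))).
    by apply: eq_bigr => k _; rewrite ewf_sum; apply: eq_bigr => p _; rewrite ewfZ.
  rewrite exchange_big; apply: eq_bigr => p _ /=.
  rewrite linearZ /= glE (linear_sum (pullback (J x))) scaler_sumr.
  by apply: eq_bigr => k _; rewrite /= pullback_ewf.
rewrite nablaE EA EB EC linearB /=.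
by rewrite opprD addrACA subrr add0r.
Qed.

Lemma ext_d_transition A B x : forms_match A B -> sform Vb B -> Va x ->
  ext_d ga A x = pullback (J x) (ext_d gb B (phi x)).
Proof.
move=> AB sB Vx.
transitivity (\sum_i \sum_p J x i p *: eps i (pullback (J x) (nabla gb p B (phi x)))).
  apply: eq_bigr => i _; rewrite (nabla_transition i AB sB Vx).
  rewrite (linear_sum (pullback (J x))) (linear_sum (@eps R n i)).
  by apply: eq_bigr => p _; rewrite !linearZ.
rewrite exchange_big (linear_sum (pullback (J x))); apply: eq_bigr => p _ /=.
by rewrite pullback_eps.
Qed.

Lemma ginv_transition q p x : Va x ->
  \sum_i \sum_j J x i q * ginv ga x i j * J x j p = ginv gb (phi x) q p.
Proof.
move=> Vx; have [_ _ gau] := hga; have [_ _ gbu] := hgb.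
have uJ := jac_mx_unit Vx; have ua := gau _ Vx; have ub := gbu _ (phiV Vx).
have E : (J x)^T *m ginv ga x *m J x = ginv gb (phi x).
  have H : (J x *m gb (phi x) *m (J x)^T) *m ginv ga x = 1%:M.
    by rewrite -gaE // mulmxV.
  have H2 : gb (phi x) *m (J x)^T *m ginv ga x = invmx (J x).
    rewrite -[LHS](mulKmx uJ) -[RHS]mulmx1; congr (_ *m _).
    by rewrite -H !mulmxA.
  rewrite -[LHS](mulKmx ub) -[RHS]mulmx1; congr (_ *m _).
  by rewrite !mulmxA H2 mulVmx.
rewrite -E [(_ *m J x) _ _]mxE exchange_big; apply: eq_bigr => j _ /=.
rewrite [(_ *m ginv ga x) _ _]mxE mulr_suml; apply: eq_bigr => i _.
by rewrite [_^T _ _]mxE.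
Qed.

Lemma iwf_up_transition u v (C : ext) x : Va x ->
  (forall i, u x i = \sum_p J x i p * v (phi x) p) ->
  iwf (up ga u x) (pullback (J x) C) = pullback (J x) (iwf (up gb v (phi x)) C).
Proof.
move=> Vx uv.
transitivity (pullback (J x) (iwf (fun q => \sum_i up ga u x i * J x i q) C)).
  rewrite [in RHS]iwf_sum (linear_sum (pullback (J x))); apply: eq_bigr => i _ /=.
  by rewrite iwfZ linearZ /= iot_pullback.
congr pullback; apply: eq_iwf => q; rewrite /up.
transitivity (\sum_i \sum_j \sum_p J x i q * ginv ga x i j * J x j p * v (phi x) p).
  apply: eq_bigr => i _; rewrite mulr_suml; apply: eq_bigr => j _.
  by rewrite uv mulr_sumr mulr_suml; apply: eq_bigr => p _; ring.
under eq_bigr => i _ do rewrite exchange_big.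
rewrite exchange_big; apply: eq_bigr => p _ /=.
rewrite -ginv_transition // mulr_suml; apply: eq_bigr => i _.
by rewrite mulr_suml.
Qed.

Lemma ewf_transition u v (C : ext) x :
  (forall i, u x i = \sum_p J x i p * v (phi x) p) ->
  ewf (u x) (pullback (J x) C) = pullback (J x) (ewf (v (phi x)) C).
Proof. by move=> uv; rewrite pullback_ewf; apply: eq_ewf. Qed.

Lemma codiff_transition A B x : forms_match A B -> sform Vb B -> Va x ->
  codiff ga A x = pullback (J x) (codiff gb B (phi x)).
Proof.
move=> AB sB Vx; rewrite /codiff.
pose D p := nabla gb p B (phi x).
transitivity (\sum_p \sum_q (\sum_i \sum_j J x i q * ginv ga x i j * J x j p) *:
    pullback (J x) (iot q (D p))).
  transitivity (\sum_i \sum_j \sum_p \sum_q (J x i q * ginv ga x i j * J x j p) *: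
    pullback (J x) (iot q (D p))).
    apply: eq_bigr => i _; apply: eq_bigr => j _.
    rewrite (nabla_transition j AB sB Vx) iot_pullback (linear_sum (iwf _)).
    rewrite (linear_sum (pullback (J x))) scaler_sumr; apply: eq_bigr => p _ /=.
    rewrite !linearZ /= /iwf (linear_sum (pullback (J x))) scaler_sumr scaler_sumr.
    apply: eq_bigr => q _; rewrite /= [pullback _ (_ *: _)]linearZ /= !scalerA.
    by congr (_ *: _); ring.
  under eq_bigr => i _ do rewrite exchange_big.
  rewrite exchange_big; apply: eq_bigr => p _ /=.
  under eq_bigr => i _ do rewrite exchange_big.
  rewrite exchange_big; apply: eq_bigr => q _ /=.
  under eq_bigr => i _ do rewrite -scaler_suml.
  by rewrite -scaler_suml.
rewrite (linear_sum (pullback (J x))) exchange_big; apply: eq_bigr => q _ /=.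
rewrite (linear_sum (pullback (J x))); apply: eq_bigr => p _ /=.
by rewrite linearZ ginv_transition.
Qed.

End Transition.
End Pullback.

(** * The codifferential squares to zero *)

Section CodiffSquare.
Variables (R : realType) (n : nat).
Local Notation pt := 'rV[R]_n.+1.
Local Notation idx := 'I_n.+1.
Local Notation ext := (ext R n).
Local Notation lform := (lform R n).
Implicit Types (i j k l m p q r : idx) (x : pt) (A B : lform).
Variables (V : set pt) (g : pt -> 'M[R]_n.+1).
Hypothesis hV : relopen V.
Hypothesis hg : local_metric V g.

Let gsm i j : smooth_on V (fun x => g x i j). Proof. by have [] := hg. Qed.

Definition cgamma k x := \sum_l christoffel g l l k x.

Lemma cgammaE k x : V x -> cgamma k x =
  2^-1 * \sum_l \sum_m ginv g x l m * pd k (fun z => g z l m) x.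
Proof.
move=> Vx; rewrite /cgamma /christoffel -mulr_sumr; congr (_ * _).
pose F l m := ginv g x l m * pd l (fun z => g z m k) x.
have FE : \sum_l \sum_m F l m = \sum_l \sum_m ginv g x l m * pd m (fun z => g z l k) x.
  rewrite exchange_big; apply: eq_bigr => l _; apply: eq_bigr => m _.
  by rewrite /F (ginv_sym hg).
have -> : \sum_l \sum_m ginv g x l m * pd k (fun z => g z l m) x =
  \sum_l \sum_m F l m + \sum_l \sum_m ginv g x l m * pd k (fun z => g z l m) x -
  \sum_l \sum_m ginv g x l m * pd m (fun z => g z l k) x by rewrite FE [X in X - _]addrC addrK.
rewrite -sumrN -!big_split; apply: eq_bigr => l _ /=.
rewrite -sumrN -!big_split; apply: eq_bigr => m _ /=.
by rewrite /F (pd_g_sym hV hg m l k Vx) mulrBr mulrDr.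
Qed.

Lemma smooth_cgamma k : smooth_on V (cgamma k).
Proof. by apply: smooth_sum => // l _; apply: smooth_christoffel. Qed.

(** [cgamma k] is half the trace of g^-1 d_k g. Its derivative in direction [j] involves second
    derivatives of [g], which commute, and the trace of (g^-1 d_j g) (g^-1 d_k g), which is
    symmetric because traces are cyclic. *)
Lemma pd_cgamma_sym j k x : V x -> pd j (cgamma k) x = pd k (cgamma j) x.
Proof.
move=> Vx.
have [DD DDE] : exists DD : idx -> idx -> idx -> idx -> R,
    forall j k l m, pd j (pd k (fun z => g z l m)) x = DD j k l m by eexists.
have [D DE] : exists D : idx -> 'M[R]_n.+1,
    forall c a b, D c a b = pd c (fun z => g z a b) x.
  by exists (fun c => \matrix_(a, b) pd c (fun z => g z a b) x) => c a b; rewrite mxE.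
have DDs j' k' l m : DD j' k' l m = DD k' j' l m.
  by rewrite -!DDE; exact: pd_sym _ _ hV Vx (gsm l m).
have F j' k' : \sum_l \sum_m pd j' (fun z => ginv g z l m) x * D k' l m =
    - \tr ((ginv g x *m D j') *m (ginv g x *m D k')).
  rewrite /mxtrace -sumrN; apply: eq_bigr => l _.
  rewrite mulmxA [(_ *m D k') l l]mxE -sumrN; apply: eq_bigr => m _.
  rewrite (pd_ginv_metric hV hg) // mulNr !DE (pd_g_sym hV hg l m k' Vx) -!DE.
  have -> : (ginv g x *m D j' *m ginv g x) l m =
      \sum_a \sum_b ginv g x l a * pd j' (fun z => g z a b) x * ginv g x b m.
    rewrite [LHS]mxE exchange_big; apply: eq_bigr => b _.
    rewrite [(_ *m D j') l b]mxE mulr_suml.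
    by apply: eq_bigr => a _; rewrite DE.
  by [].
have E j' k' : pd j' (cgamma k') x = 2^-1 *
   (- \tr ((ginv g x *m D j') *m (ginv g x *m D k')) +
    \sum_l \sum_m ginv g x l m * DD j' k' l m).
  have H : is_pd j' (fun z => 2^-1 * \sum_l \sum_m ginv g z l m * pd k' (fun z => g z l m) z) x
    (2^-1 * \sum_l \sum_m
   (pd j' (fun z => ginv g z l m) x * D k' l m + ginv g x l m * DD j' k' l m)).
    apply: is_pdZ; apply: is_pd_sum => l _; apply: is_pd_sum => m _.
    rewrite DE -DDE; apply: is_pdM.
      by apply: smooth_is_pd Vx; apply: smooth_ginv.
    by apply: smooth_is_pd Vx; apply: smooth_pd.
  have H2 := is_pd_local hV Vx (fun y Vy => esym (cgammaE k' Vy)) H.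
  apply: etrans (is_pd_on hV Vx H2) _; apply: congr1.
  rewrite -F -big_split; apply: eq_bigr => l _; exact: big_split.
apply: etrans (E j k) (etrans _ (esym (E k j))); apply: congr1.
rewrite mxtrace_mulC; apply: congr1.
by apply: eq_bigr => l _; apply: eq_bigr => m _; rewrite DDs.
Qed.

(* After raising all indices, delta is a divergence with the correction term
   cgamma = d (log (sqrt (det g))), which is closed. *)
Definition raise A : lform := fun x => pullback (ginv g x) (A x).

Lemma pdx_raise k A x : V x -> sform V A -> pdx k (raise A) x =
  \sum_m \sum_j pd k (fun z => ginv g z m j) x *: eps m (pullback (ginv g x) (iot j (A x))) +
  pullback (ginv g x) (pdx k A x).
Proof.
move=> Vx sA; apply: (pdxE hV Vx); apply: is_pdx_pullback_form; last exact: sform_is_pdx.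
by move=> m j; apply: smooth_is_pd Vx; apply: smooth_ginv.
Qed.

Lemma sform_raise A : sform V A -> sform V (raise A).
Proof.
move=> sA; suff sb U : sform V (fun x => pullback (ginv g x) (ext_basis R U)).
  apply: (sform_eq hV) (sform_sum hV (F := fun U x => A x U *: pullback (ginv g x) (ext_basis R U)) _).
    move=> x _; rewrite /raise [in RHS](ext_basisE (A x)) linear_sum.
    by apply: eq_bigr => U _; rewrite linearZ.
  by move=> U; apply: sformZ.
elim/ext_ind: (ext_basis R U) => [|k C IH|a C D IHC IHD].
- by apply: (sform_eq hV) (sform_cst hV (ext1 R n)) => x _; rewrite pullback_ext1.
- apply: (sform_eq hV) (sform_ewf hV (u := fun x m => ginv g x m k) _ IH).
    by move=> x _; rewrite pullback_eps.
  by move=> m; apply: smooth_ginv.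
- apply: (sform_eq hV) (sformD hV (sformZ hV (smooth_cst hV a) IHC) IHD) => x _.
  by rewrite linearP.
Qed.

(** Differentiating [raise A] also differentiates [ginv g], which yields two Christoffel sums. In
    [T1] the part contracted twice vanishes by the symmetry of the lower indices, and only the trace
    [cgamma] remains. [T2] is the connection term inside [nabla]. *)
Lemma raise_codiff A x : V x -> sform V A -> raise (codiff g A) x =
  \sum_k iot k (pdx k (raise A) x + cgamma k x *: raise A x).
Proof.
move=> Vx sA.
have gs i j := ginv_sym hg i j Vx.
pose P := pullback (ginv g x).
have E0 : raise (codiff g A) x = \sum_k iot k (P (nabla g k A x)).
  rewrite /raise codiffE linear_sum; apply: eq_bigr => k _.
  by rewrite /P iot_pullback; congr pullback; apply: eq_iwf => i; rewrite gs.
have T1 : \sum_k \sum_m \sum_j \sum_l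
   (christoffel g m k l x * ginv g x l j) *: iot k (eps m (P (iot j (A x)))) =
   \sum_k cgamma k x *: iot k (raise A x).
  transitivity (\sum_k \sum_m \sum_l christoffel g m k l x *:
      iot k (eps m (iot l (raise A x)))).
    apply: eq_bigr => k _; apply: eq_bigr => m _; rewrite exchange_big.
    apply: eq_bigr => l _ /=; rewrite /raise iot_pullback /iwf.
    rewrite (linear_sum (pullback (ginv g x))) (linear_sum (@eps R n m)).
    rewrite (linear_sum (@iot R n k)) scaler_sumr; apply: eq_bigr => j _.
    by rewrite !linearZ /= scalerA mulrC.
  transitivity (\sum_k \sum_m (k == m)%:R *: (\sum_l christoffel g m k l x *: iot l (raise A x)) +
    \sum_m eps m (\sum_k iwf (fun l => christoffel g m k l x) (iot k (raise A x)))).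
    have -> : \sum_m eps m (\sum_k iwf (fun l => christoffel g m k l x) (iot k (raise A x))) =
       \sum_k \sum_m \sum_l - (christoffel g m k l x *: eps m (iot k (iot l (raise A x)))).
      rewrite exchange_big; apply: eq_bigr => m _ /=.
      rewrite (linear_sum (@eps R n m)); apply: eq_bigr => k _ /=.
      rewrite /iwf (linear_sum (@eps R n m)); apply: eq_bigr => l _.
      by rewrite linearZ /= iot_iot linearN scalerN.
    rewrite -big_split; apply: eq_bigr => k _; rewrite -big_split.
    apply: eq_bigr => m _; rewrite scaler_sumr -big_split; apply: eq_bigr => l _ /=.
    by rewrite iot_eps scalerBr !scalerA [_%:R * _]mulrC.
  rewrite [X in _ + X]big1 ?addr0; last first.
    move=> m _; rewrite (sum_iot_iwf_sym (H := fun k l => christoffel g m k l x)) ?linear0 //.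
    by move=> k l; apply: (christoffel_sym hV hg).
  under eq_bigr => k _ do rewrite sum_deltaZ.
  rewrite exchange_big; apply: eq_bigr => l _ /=; by rewrite -scaler_suml.
have T2 : \sum_k \sum_m \sum_j \sum_l
   (christoffel g j k l x * ginv g x m l) *: iot k (eps m (P (iot j (A x)))) =
   \sum_k iot k (P (gl (conn g k x) (A x))).
  apply: eq_bigr => k _; rewrite /gl /P (linear_sum (pullback (ginv g x))) (linear_sum (@iot R n k)).
  rewrite exchange_big /=.
  under eq_bigr => j _ do rewrite exchange_big /=.
  rewrite exchange_big; apply: eq_bigr => l _ /=.
  rewrite (linear_sum (pullback (ginv g x))) (linear_sum (@iot R n k)).
  apply: eq_bigr => j _; rewrite !linearZ /= pullback_eps /ewf (linear_sum (@iot R n k)) scaler_sumr.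
  by apply: eq_bigr => m _; rewrite linearZ /= scalerA.
have T3 : \sum_k iot k (pdx k (raise A) x) =
    \sum_k iot k (P (pdx k A x)) - \sum_k cgamma k x *: iot k (raise A x) -
    \sum_k iot k (P (gl (conn g k x) (A x))).
  rewrite -T1 -T2 -!sumrB; apply: eq_bigr => k _.
  rewrite pdx_raise // linearD /= [LHS]addrC -addrA; congr (_ + _).
  rewrite (linear_sum (@iot R n k)) -opprD -big_split -sumrN; apply: eq_bigr => m _ /=.
  rewrite (linear_sum (@iot R n k)) -big_split -sumrN; apply: eq_bigr => j _ /=.
  rewrite linearZ /= (pd_ginv hV hg) // scaleNr -big_split /=; congr (- _).
  rewrite -big_split /= scaler_suml; apply: eq_bigr => l _.
  by rewrite scalerDl.
rewrite E0.
under [RHS]eq_bigr => k _ do rewrite linearD linearZ /=.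
rewrite big_split /= T3.
have -> : \sum_k iot k (P (nabla g k A x)) =
    \sum_k iot k (P (pdx k A x)) - \sum_k iot k (P (gl (conn g k x) (A x))).
  by rewrite -sumrB; apply: eq_bigr => k _; rewrite nablaE /P !linearB.
by rewrite addrAC subrK.
Qed.

Lemma raise_inj (A B : lform) x : V x -> raise A x = raise B x -> A x = B x.
Proof.
move=> Vx /(congr1 (pullback (g x))); rewrite /raise !pullback_comp.
by have [_ _ gu] := hg; rewrite /ginv mulmxV ?gu // !pullback1.
Qed.

Lemma sum_iot_iot_sym (H : idx -> idx -> ext) : (forall i j, H i j = H j i) ->
  \sum_i \sum_j iot i (iot j (H i j)) = 0.
Proof.
move=> Hs; apply: opp_self0; rewrite {1}exchange_big -sumrN.
apply: eq_bigr => i _; rewrite -sumrN; apply: eq_bigr => j _.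
by rewrite Hs iot_iot.
Qed.

(** In raised form this is a double contraction of [H]. That array is symmetric because partial
    derivatives commute and [cgamma] is closed, while contractions anticommute. *)
Lemma codiff_codiff A x : V x -> sform V A -> codiff g (codiff g A) x = 0.
Proof.
move=> Vx sA; apply: (@raise_inj (codiff g (codiff g A)) (fun=> 0)) => //.
have sR := sform_raise sA; set B := raise A in sR *.
rewrite raise_codiff //; last exact: sform_codiff.
rewrite [RHS]linear0.
pose C z := \sum_k iot k (pdx k B z + cgamma k z *: B z).
have CE y : V y -> raise (codiff g A) y = C y by move=> Vy; rewrite raise_codiff.
have [D DE] : exists D, forall j k, pdx j (pdx k B) x = D j k by eexists.
have Ds j k : D j k = D k j by rewrite -!DE; exact: (pdx_sym hV).
have [c cE] : exists c, forall j k, pd j (cgamma k) x = c j k by eexists.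
have cs j k : c j k = c k j by rewrite -!cE; apply: pd_cgamma_sym.
pose H j k := D j k + (c j k *: B x + cgamma k x *: pdx j B x)
   + cgamma j x *: (pdx k B x + cgamma k x *: B x).
have dC j : pdx j (raise (codiff g A)) x =
    \sum_k iot k (D j k + (c j k *: B x + cgamma k x *: pdx j B x)).
  apply: (pdxE hV Vx).
  have HC : is_pdx j C x (\sum_k iot k (D j k + (c j k *: B x + cgamma k x *: pdx j B x))).
    apply: is_pdx_sum => k; apply: (is_pdx_lin (T := @iot R n k)); apply: is_pdxD.
      by rewrite -DE; apply: sform_is_pdx Vx; apply: sform_pdx.
    apply: is_pdxZ; last exact: sform_is_pdx.
    by rewrite -cE; apply: smooth_is_pd Vx; apply: smooth_cgamma.
  by move=> S; apply: (is_pd_local hV Vx _ (HC S)) => y Vy; rewrite CE.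
transitivity (\sum_j \sum_k iot j (iot k (H j k))).
  apply: eq_bigr => j _; rewrite dC CE // /C scaler_sumr -big_split.
  rewrite (linear_sum (@iot R n j)); apply: eq_bigr => k _ /=.
  by rewrite /H [in RHS](linearD (@iot R n k)) linearZ.
apply: sum_iot_iot_sym => j k; rewrite /H Ds cs.
move: (D k j) (B x) (pdx j B x) (pdx k B x) => a b a' b'.
by apply/ffunP => S; rewrite !(extDE, extNE, extZE); ring.
Qed.

End CodiffSquare.

(** * Ricci curvature and the Einstein equation *)

Section RicciAlgebra.
Variables (R : realType) (n : nat).
Local Notation idx := 'I_n.+1.
Implicit Types (i j k l m : idx).
Variables (G : idx -> idx -> idx -> R) (gm dY : idx -> idx -> R) (Y U : idx -> R).
Hypothesis Gs : forall l i j, G l i j = G l j i.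
Hypothesis gs : forall i j, gm i j = gm j i.
Hypothesis gU : forall i, \sum_l gm i l * U l = Y i.
Hypothesis dYs : forall i j, dY i j = dY j i.
Local Notation d := (n.+1%:R : R).

(* G, gm, Y, dY and U stand for the values at a point of the Christoffel symbols,
   the metric g, the covector d (log Om), its partial derivatives and its gradient;
   conf_diff is the change of the Christoffel symbols from g to Om^2 g. *)
Definition conf_diff l i j : R :=
  (l == i)%:R * Y j + (l == j)%:R * Y i - gm i j * U l.
Local Notation C := conf_diff.

Lemma conf_diff_contract (a : idx -> R) i j :
  \sum_m a m * C m i j = a i * Y j + a j * Y i - gm i j * \sum_m a m * U m.
Proof.
rewrite /C mulr_sumr -(sum_deltar (fun m => a m * Y j) i).
rewrite -(sum_deltar (fun m => a m * Y i) j) -big_split -sumrB.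
by apply: eq_bigr => m _ /=; ring.
Qed.

Lemma conf_diff_tr m : \sum_l C l l m = d * Y m.
Proof.
rewrite /C; under eq_bigr => l _ do rewrite eqxx mul1r.
rewrite sumrB big_split /= sumr_const card_ord sum_deltar.
have -> : \sum_l gm l m * U l = Y m.
  by rewrite -gU; apply: eq_bigr => l _; rewrite gs.
by rewrite addrK mulr_natl.
Qed.

Lemma conf_diff_left (F : idx -> idx -> R) j : \sum_l \sum_m C l j m * F m l =
  \sum_m Y m * F m j + Y j * (\sum_l F l l) - \sum_l \sum_m gm j m * U l * F m l.
Proof.
transitivity (\sum_l (l == j)%:R * (\sum_m Y m * F m l) +
   Y j * (\sum_l \sum_m (l == m)%:R * F m l) - \sum_l \sum_m gm j m * U l * F m l).
  rewrite mulr_sumr -big_split -sumrB; apply: eq_bigr => l _ /=.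
  rewrite !mulr_sumr -big_split -sumrB; apply: eq_bigr => m _ /=.
  by rewrite /C; ring.
rewrite sum_deltar; congr (_ + _ * _ - _); apply: eq_bigr => l _.
exact: sum_deltal.
Qed.

Lemma conf_diff_right (F : idx -> idx -> R) i : \sum_l \sum_m F l m * C m l i =
  Y i * (\sum_l F l l) + \sum_l F l i * Y l - \sum_l \sum_m F l m * gm l i * U m.
Proof.
rewrite mulr_sumr -big_split -sumrB; apply: eq_bigr => l _ /=.
rewrite conf_diff_contract [Y i * _]mulrC mulr_sumr; congr (_ - _).
by apply: eq_bigr => m _; ring.
Qed.

(** The hypothesis on [dg] is metric compatibility: it turns the derivative of [g] inside
    [conf_diff] into the terms [K], which cancel against the cross terms of [P2]. The terms in
    [gamma i] and [gamma j] cancel between [P1] and [P2]. The surviving linear terms form a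
    covariant Hessian and a divergence. *)
Lemma ricci_conf_alg i j (dg : idx -> R) (dU : idx -> idx -> R) :
  (forall l, dg l = \sum_m G m l i * gm m j + \sum_m G m l j * gm i m) ->
  let gamma m := \sum_l G l l m in
  \sum_l ((l == i)%:R * dY l j + (l == j)%:R * dY l i - (dg l * U l + gm i j * dU l l))
  - d * dY j i
  + (\sum_l \sum_m ((G l l m + C l l m) * (G m i j + C m i j)
       - (G l j m + C l j m) * (G m l i + C m l i)))
  = \sum_l \sum_m (G l l m * G m i j - G l j m * G m l i)
    - (d - 2) * (dY i j - \sum_m G m i j * Y m - Y i * Y j)
    - gm i j * (\sum_l dU l l + \sum_m gamma m * U m + (d - 2) * \sum_m Y m * U m).
Proof.
move=> dgE gamma.
pose YG := \sum_m G m i j * Y m.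
pose N := \sum_m Y m * U m.
pose K a b := \sum_l \sum_m gm a m * U l * G m l b.
have gammaE m : \sum_l G l m l = gamma m by apply: eq_bigr => l _; rewrite Gs.
have -> : \sum_l ((l == i)%:R * dY l j + (l == j)%:R * dY l i -
     (dg l * U l + gm i j * dU l l)) =
    dY i j + dY j i - (K j i + K i j + gm i j * \sum_l dU l l).
  rewrite sumrB !big_split /= !sum_deltar mulr_sumr; congr (_ - (_ + _)).
  rewrite /K -big_split; apply: eq_bigr => l _ /=.
  rewrite dgE mulrDl !mulr_suml; congr (_ + _); apply: eq_bigr => m _.
    by rewrite (gs m j); ring.
  by ring.
have P1 : \sum_l \sum_m (G l l m + C l l m) * (G m i j + C m i j) =
    \sum_l \sum_m G l l m * G m i j + (gamma i * Y j + gamma j * Y i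
      - gm i j * \sum_m gamma m * U m) + d * YG + d * (Y i * Y j + Y j * Y i - gm i j * N).
  rewrite exchange_big /=.
  transitivity (\sum_m (gamma m + d * Y m) * (G m i j + C m i j)).
    by apply: eq_bigr => m _; rewrite -mulr_suml big_split /= conf_diff_tr.
  rewrite -(conf_diff_contract gamma) -(conf_diff_contract Y) [\sum_l \sum_m G l l m * _]exchange_big.
  rewrite /YG !mulr_sumr -!big_split; apply: eq_bigr => m _ /=.
  by rewrite -mulr_suml -/(gamma m); ring.
have P2 : \sum_l \sum_m (G l j m + C l j m) * (G m l i + C m l i) =
    \sum_l \sum_m G l j m * G m l i + (Y i * gamma j + YG - K i j) +
    (YG + Y j * gamma i - K j i) + ((d + 2) * (Y i * Y j) - 2 * gm i j * N).
  have Q1 := conf_diff_right (fun l m => G l j m) i.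
  have Q2 := conf_diff_left (fun m l => G m l i) j.
  have Q3 := conf_diff_left (fun m l => C m l i) j.
  have -> : \sum_l \sum_m (G l j m + C l j m) * (G m l i + C m l i) =
     \sum_l \sum_m G l j m * G m l i + \sum_l \sum_m G l j m * C m l i
     + \sum_l \sum_m C l j m * G m l i + \sum_l \sum_m C l j m * C m l i.
    rewrite -!big_split; apply: eq_bigr => l _; rewrite -!big_split.
    by apply: eq_bigr => m _ /=; ring.
  rewrite Q1 Q2 Q3 gammaE conf_diff_tr.
  have -> : \sum_l G l j i * Y l = YG by apply: eq_bigr => l _; rewrite Gs.
  have -> : \sum_m Y m * G m j i = YG by apply: eq_bigr => l _; rewrite Gs mulrC.
  have -> : \sum_l \sum_m G l j m * gm l i * U m = K i j.
    rewrite exchange_big; apply: eq_bigr => m _; apply: eq_bigr => l _ /=.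
    by rewrite Gs (gs l i); ring.
  have -> : \sum_m Y m * C m j i = Y j * Y i + Y i * Y j - gm j i * N.
    by rewrite conf_diff_contract.
  have -> : \sum_l \sum_m gm j m * U l * C m l i = gm i j * N.
    transitivity (\sum_l U l * (gm j l * Y i + gm j i * Y l - gm l i * Y j)).
      apply: eq_bigr => l _; rewrite -(gU j) -conf_diff_contract mulr_sumr.
      by apply: eq_bigr => m _; ring.
    transitivity (Y i * (\sum_l gm j l * U l) + gm j i * N - Y j * (\sum_l gm i l * U l)).
      rewrite /N !mulr_sumr -big_split -sumrB; apply: eq_bigr => l _ /=.
      by rewrite (gs l i); ring.
    by rewrite !gU (gs j i); ring.
  by rewrite -/(gamma i) -/(K j i) (gs j i); ring.
have -> : \sum_l \sum_m ((G l l m + C l l m) * (G m i j + C m i j)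
       - (G l j m + C l j m) * (G m l i + C m l i)) =
  \sum_l \sum_m (G l l m + C l l m) * (G m i j + C m i j) -
  \sum_l \sum_m (G l j m + C l j m) * (G m l i + C m l i).
  by rewrite -sumrB; apply: eq_bigr => l _; rewrite sumrB.
have -> : \sum_l \sum_m (G l l m * G m i j - G l j m * G m l i) =
  \sum_l \sum_m G l l m * G m i j - \sum_l \sum_m G l j m * G m l i.
  by rewrite -sumrB; apply: eq_bigr => l _; rewrite sumrB.
rewrite P1 P2 -/YG -/N (dYs j i); ring.
Qed.

End RicciAlgebra.

(** * Conformal change of the Ricci tensor *)

Section ConformalRicci.
Variables (R : realType) (n : nat).
Local Notation pt := 'rV[R]_n.+1.
Local Notation idx := 'I_n.+1.
Implicit Types (i j k l m : idx) (x : pt).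
Variables (V : set pt) (g gh : pt -> 'M[R]_n.+1) (Om : pt -> R).
Hypothesis hV : relopen V.
Hypothesis hg : local_metric V g.
Hypothesis Om_smooth : smooth_on V Om.
Hypothesis Om_gt0 : forall x, V x -> 0 < Om x.
Hypothesis ghE : forall x, V x -> gh x = (Om x) ^+ 2 *: g x.
Local Notation Y := (dlog Om).
Local Notation U := (up g (dlog Om)).

Let sY : scov V Y. Proof. exact: (scov_dlog hV Om_smooth Om_gt0). Qed.
Let sU : scov V U. Proof. exact: (scov_up hV hg sY). Qed.

Lemma up_dlog_contract x i : V x -> \sum_l g x i l * U x l = Y x i.
Proof.
move=> Vx; rewrite /up -[RHS](sum_deltal (Y x)).
under [RHS]eq_bigr => j _ do rewrite -(ginvR hg i j Vx) mulr_suml.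
rewrite exchange_big; apply: eq_bigr => l _ /=.
by rewrite mulr_sumr; apply: eq_bigr => j _; rewrite mulrA.
Qed.

Lemma is_pd_christoffel_gh k l i j x : V x ->
  is_pd k (christoffel gh l i j) x (pd k (christoffel g l i j) x +
    ((l == i)%:R * pd k (fun z => Y z j) x + (l == j)%:R * pd k (fun z => Y z i) x
    - (pd k (fun z => g z i j) x * U x l + g x i j * pd k (fun z => U z l) x))).
Proof.
move=> Vx; have [sg _ _] := hg.
have dY m : is_pd k (fun z => Y z m) x (pd k (fun z => Y z m) x).
  exact: smooth_is_pd (sY m) Vx.
have H := is_pdD (smooth_is_pd (i := k) (smooth_christoffel hV hg l i j) Vx)
  (is_pdB (is_pdD (is_pdZ (a := (l == i)%:R) (dY j)) (is_pdZ (a := (l == j)%:R) (dY i)))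
    (is_pdM (smooth_is_pd (i := k) (sg i j) Vx) (smooth_is_pd (i := k) (sU l) Vx))).
apply: (is_pd_local hV Vx _ H) => y Vy.
by rewrite (christoffel_gh hV hg Om_smooth Om_gt0 ghE).
Qed.

(** By [pd_ginv], the coordinate divergence of the gradient is the trace of the covariant Hessian.
    This makes the last term of [ricci_conf_alg] covariant. *)
Lemma div_up_dlog x : V x ->
  \sum_l pd l (fun z => U z l) x + \sum_m (\sum_l christoffel g l l m x) * U x m =
  \sum_i \sum_j ginv g x i j * nabv g i Y x j.
Proof.
move=> Vx.
have E l : pd l (fun z => U z l) x =
    \sum_j (pd l (fun z => ginv g z l j) x * Y x j +
            ginv g x l j * pd l (fun z => Y z j) x).
  apply: (is_pd_on hV Vx); apply: is_pd_sum => j _; apply: is_pdM.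
    exact: smooth_is_pd (smooth_ginv hV hg l j) Vx.
  exact: smooth_is_pd (sY j) Vx.
have E2 l : pd l (fun z => U z l) x =
  \sum_j ginv g x l j * nabv g l Y x j - \sum_p christoffel g l l p x * U x p.
  rewrite E big_split /=.
  have -> : \sum_j pd l (fun z => ginv g z l j) x * Y x j =
     - (\sum_p christoffel g l l p x * U x p) -
       \sum_j ginv g x l j * (\sum_p christoffel g p l j x * Y x p).
    have -> : \sum_j ginv g x l j * (\sum_p christoffel g p l j x * Y x p) =
       \sum_j (\sum_p christoffel g j l p x * ginv g x l p) * Y x j.
      under eq_bigr => j _ do rewrite mulr_sumr.
      rewrite exchange_big; apply: eq_bigr => p _ /=.
      by rewrite mulr_suml; apply: eq_bigr => j _; ring.
    have -> : \sum_p christoffel g l l p x * U x p =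
       \sum_j (\sum_p christoffel g l l p x * ginv g x p j) * Y x j.
      under eq_bigr => p _ do rewrite /up mulr_sumr.
      rewrite exchange_big; apply: eq_bigr => p _ /=.
      by rewrite mulr_suml; apply: eq_bigr => j _; ring.
    rewrite -!sumrN -big_split; apply: eq_bigr => j _ /=.
    by rewrite (pd_ginv hV hg) //; ring.
  rewrite /nabv; under [in RHS]eq_bigr => j _ do rewrite mulrBr.
  by rewrite sumrB; ring.
under eq_bigr => l _ do rewrite E2.
rewrite sumrB.
have -> : \sum_m (\sum_l christoffel g l l m x) * U x m =
    \sum_l \sum_p christoffel g l l p x * U x p.
  by rewrite exchange_big; apply: eq_bigr => m _; rewrite mulr_suml.
by rewrite subrK.
Qed.

Lemma ricci_gh x i j : V x -> ricci gh x i j = ricci g x i j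
  - (n.+1%:R - 2) * (nabv g i Y x j - Y x i * Y x j)
  - g x i j * (\sum_a \sum_b ginv g x a b * nabv g a Y x b
               + (n.+1%:R - 2) * \sum_m Y x m * U x m).
Proof.
move=> Vx; rewrite /ricci !mxE.
have [pG pGE] : exists pG, forall k l a b, pd k (christoffel g l a b) x = pG k l a b.
  by eexists.
have [dY dYE] : exists dY, forall k m, pd k (fun z => Y z m) x = dY k m by eexists.
have [dU dUE] : exists dU, forall k m, pd k (fun z => U z m) x = dU k m by eexists.
have [dg dgE] : exists dg, forall k, pd k (fun z => g z i j) x = dg k by eexists.
have dYs a b : dY a b = dY b a.
  rewrite -!dYE; exact: pd_sym _ _ hV Vx (smooth_lnOm hV Om_smooth Om_gt0).
pose C := conf_diff (g x) (Y x) (U x).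
have chE l a b : christoffel gh l a b x = christoffel g l a b x + C l a b.
  exact: (christoffel_gh hV hg Om_smooth Om_gt0 ghE).
(* By [conf_diff_tr] the trace of the new symbols is the old trace plus d times Upsilon, so a single
   derivative of that closed form is enough. *)
have tr_sum : \sum_l pd j (christoffel gh l l i) x =
    \sum_l pG j l l i + n.+1%:R * dY j i.
  have H1 : is_pd j (fun z => \sum_l christoffel gh l l i z) x
      (\sum_l pd j (christoffel gh l l i) x).
    apply: is_pd_sum => l _; have H := @is_pd_christoffel_gh j l l i x Vx.
    by rewrite (is_pd_on hV Vx H).
  have H2 : is_pd j (fun z => \sum_l christoffel g l l i z + n.+1%:R * Y z i) x
      (\sum_l pG j l l i + n.+1%:R * dY j i).
    apply: is_pdD.
      apply: is_pd_sum => l _; rewrite -pGE.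
      exact: smooth_is_pd (smooth_christoffel hV hg l l i) Vx.
    by apply: is_pdZ; rewrite -dYE; apply: smooth_is_pd (sY i) Vx.
  rewrite -(is_pd_on hV Vx H1); apply: (is_pd_on hV Vx).
  apply: (is_pd_local hV Vx _ H2) => y Vy.
  rewrite -(conf_diff_tr (gm := g y) (U := U y)); first last.
  - by move=> a; apply: up_dlog_contract.
  - by move=> a b; apply: (g_sym hg).
  rewrite -big_split; apply: eq_bigr => l _ /=; apply: esym.
  exact: (christoffel_gh hV hg Om_smooth Om_gt0 ghE).
have first_sum : \sum_l pd l (christoffel gh l i j) x = \sum_l pG l l i j +
   \sum_l ((l == i)%:R * dY l j + (l == j)%:R * dY l i - (dg l * U x l + g x i j * dU l l)).
  rewrite -big_split; apply: eq_bigr => l _ /=.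
  rewrite -pGE -!dYE -dUE -dgE.
  exact: (is_pd_on hV Vx (@is_pd_christoffel_gh l l i j x Vx)).
have -> : \sum_l (pd l (christoffel gh l i j) x - pd j (christoffel gh l l i) x) =
   \sum_l pd l (christoffel gh l i j) x - \sum_l pd j (christoffel gh l l i) x.
  by rewrite -sumrB.
have -> : \sum_l (pd l (christoffel g l i j) x - pd j (christoffel g l l i) x) =
   \sum_l pG l l i j - \sum_l pG j l l i.
  by rewrite -sumrB; apply: eq_bigr => l _; rewrite -!pGE.
rewrite first_sum tr_sum.
have dgP l : dg l = \sum_m christoffel g m l i x * g x m j +
    \sum_m christoffel g m l j x * g x i m.
  by rewrite -dgE (pd_g hV hg).
have H := @ricci_conf_alg R n (fun l a b => christoffel g l a b x) (g x) dY (Y x) (U x)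
  (fun l a b => christoffel_sym hV hg l a b Vx) (fun a b => g_sym hg a b Vx)
  (fun a => up_dlog_contract a Vx) dYs i j dg dU dgP.
have -> : \sum_l \sum_m (christoffel gh l l m x * christoffel gh m i j x -
    christoffel gh l j m x * christoffel gh m l i x) =
  \sum_l \sum_m ((christoffel g l l m x + C l l m) * (christoffel g m i j x + C m i j)
   - (christoffel g l j m x + C l j m) * (christoffel g m l i x + C m l i)).
  by apply: eq_bigr => l _; apply: eq_bigr => m _; rewrite !chE.
have D := div_up_dlog Vx.
have -> : nabv g i Y x j = dY i j - \sum_m christoffel g m i j x * Y x m.
  by rewrite /nabv dYE.
rewrite -D; under [\sum_l pd l _ x]eq_bigr => l _ do rewrite dUE.
move: H; rewrite /= -/C.
set S1 := \sum_l ((l == i)%:R * dY l j + _ - _).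
set S2 := \sum_l \sum_m (_ - _ : R); set S3 := \sum_l \sum_m (_ - _ : R).
set S4 := \sum_l pG l l i j; set S5 := \sum_l pG j l l i.
set S6 := \sum_l dU l l; set S7 := \sum_m (\sum_l _) * _.
set S8 := \sum_m _ * U x m; set S9 := \sum_m _.
move=> H.
have -> : S4 + S1 - (S5 + n.+1%:R * dY j i) + S2 = S4 - S5 + (S1 - n.+1%:R * dY j i + S2).
  ring.
rewrite H; ring.
Qed.

End ConformalRicci.

(** * The Einstein equation in terms of sigma *)

Section Einstein.
Variables (R : realType) (n : nat).
Local Notation pt := 'rV[R]_n.+1.
Local Notation idx := 'I_n.+1.
Implicit Types (i j k l m : idx) (x : pt).
Variables (V : set pt) (g : pt -> 'M[R]_n.+1) (s : pt -> R).
Hypothesis hn : (2 <= n)%N.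
Hypothesis hV : relopen V.
Hypothesis hg : local_metric V g.
Hypothesis s_smooth : smooth_on V s.
Hypothesis s_gt0 : forall x, V x -> 0 < s x.
Hypothesis einstein : forall x, V x ->
  ricci (fun z => s z ^- 2 *: g z) x = - n%:R *: (s x ^- 2 *: g x).
Local Notation nu := (dfun s).
Local Notation d := (n.+1%:R : R).

Definition hess i x j : R := nabv g i nu x j.
Definition nu2 x : R := \sum_i up g nu x i * nu x i.
Definition lap_s x : R := \sum_i \sum_j ginv g x i j * hess i x j.

Let Om := fun z : pt => (s z)^-1.

Let Om_smooth : smooth_on V Om.
Proof. by apply: smoothV => // x Vx; rewrite gt_eqF // s_gt0. Qed.

Let Om_gt0 x : V x -> 0 < Om x. Proof. by move=> Vx; rewrite invr_gt0 s_gt0. Qed.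

Lemma dlog_inv i x : V x -> dlog Om x i = - (s x)^-1 * nu x i.
Proof.
move=> Vx; have s0 : s x != 0 by rewrite gt_eqF // s_gt0.
have := pd_Om hV Om_smooth Om_gt0 i Vx.
rewrite /Om (is_pd_on hV Vx (is_pdV s0 (smooth_is_pd s_smooth Vx))) => E.
apply: (mulfI (invr_neq0 s0)); rewrite -E /dfun.
by move: (pd i s x) => a; ring.
Qed.

Lemma nabv_dlog_inv i j x : V x -> nabv g i (dlog Om) x j =
  - (s x)^-1 * hess i x j + (s x)^-1 ^+ 2 * (nu x i * nu x j).
Proof.
move=> Vx; have s0 : s x != 0 by rewrite gt_eqF // s_gt0.
rewrite /hess /nabv.
have H : is_pd i (fun z => - (s z)^-1 * nu z j) x
   (- (- nu x i * (s x)^-1 * (s x)^-1) * nu x j +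
    - (s x)^-1 * pd i (fun z => nu z j) x).
  apply: is_pdM; last exact: smooth_is_pd (scov_dfun s_smooth j) Vx.
  by apply: is_pdN; apply: is_pdV => //; apply: smooth_is_pd s_smooth Vx.
have {}H := is_pd_local hV Vx (fun y Vy => esym (dlog_inv j Vy)) H.
rewrite (is_pd_on hV Vx H).
have -> : \sum_l christoffel g l i j x * dlog Om x l =
    - (s x)^-1 * \sum_l christoffel g l i j x * nu x l.
  by rewrite mulr_sumr; apply: eq_bigr => l _; rewrite dlog_inv //; ring.
by move: (pd i _ x) (\sum_l _) (nu x i) (nu x j) => a b c e; ring.
Qed.

(** This is [ricci_gh] for the conformal factor 1 / s. The products of two components of [nu] coming
    from the Hessian of log s and from the square of Upsilon cancel. *)
Lemma einstein_eq i j x : V x -> ricci g x i j + (d - 2) * (s x)^-1 * hess i x j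
   + g x i j * ((s x)^-1 * lap_s x - n%:R * (s x)^-1 ^+ 2 * nu2 x) =
   - n%:R * (s x)^-1 ^+ 2 * g x i j.
Proof.
move=> Vx.
have ghE y : V y -> s y ^- 2 *: g y = Om y ^+ 2 *: g y.
  by move=> Vy; rewrite /Om exprVn.
have := @ricci_gh R n V g _ Om hV hg Om_smooth Om_gt0 ghE x i j Vx.
rewrite einstein // mxE mxE nabv_dlog_inv // !dlog_inv //.
have -> : \sum_a \sum_b ginv g x a b * nabv g a (dlog Om) x b =
    - (s x)^-1 * lap_s x + (s x)^-1 ^+ 2 * nu2 x.
  rewrite /lap_s /nu2 !mulr_sumr -big_split; apply: eq_bigr => a _ /=.
  rewrite /up mulr_suml !mulr_sumr -big_split; apply: eq_bigr => b _ /=.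
  by rewrite nabv_dlog_inv //; ring.
have -> : \sum_m dlog Om x m * up g (dlog Om) x m = (s x)^-1 ^+ 2 * nu2 x.
  rewrite /nu2 mulr_sumr; apply: eq_bigr => a _; rewrite dlog_inv // /up.
  have -> : \sum_j ginv g x a j * dlog Om x j = - (s x)^-1 * \sum_j ginv g x a j * nu x j.
    by rewrite mulr_sumr; apply: eq_bigr => b _; rewrite dlog_inv //; ring.
  by ring.
have -> : s x ^- 2 = (s x)^-1 ^+ 2 by rewrite exprVn.
have -> : d = n%:R + 1 by rewrite -natr1.
move: (ricci g x i j) (hess i x j) (lap_s x) (nu2 x) (nu x i) (nu x j) (g x i j) (s x)^-1.
move=> r h L N a b c t H.
have -> : r = - n%:R * (t ^+ 2 * c) + (n%:R + 1 - 2) *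
    (- t * h + t ^+ 2 * (a * b) - - t * a * (- t * b)) +
    c * (- t * L + t ^+ 2 * N + (n%:R + 1 - 2) * (t ^+ 2 * N)) by rewrite H; ring.
ring.
Qed.

Lemma rhoE x : rho g s x = - d^-1 * (lap_s x + Jtrace g x * s x).
Proof. by []. Qed.

Lemma ginv_trace x : V x -> \sum_i \sum_j ginv g x i j * g x i j = d.
Proof.
move=> Vx; transitivity (\sum_(i : idx) (1 : R)).
  apply: eq_bigr => i _; apply: etrans (etrans _ (ginvL hg i i Vx)) _.
    2: by rewrite eqxx.
  by apply: eq_bigr => j _; rewrite (g_sym hg i j Vx).
by rewrite sumr_const card_ord.
Qed.

Let n0 : n%:R != 0 :> R. Proof. by rewrite pnatr_eq0; case: (n) hn. Qed.
Let d0 : d != 0. Proof. by rewrite pnatr_eq0. Qed.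
Let d2 : d - 2 != 0.
Proof.
rewrite -natr1; have -> : n%:R + 1 - 2 = (n%:R - 1 : R) by ring.
by rewrite subr_eq0 -[1]/(1%:R) eqr_nat; case: (n) hn => [|[]].
Qed.

(** The trace of [einstein_eq]: the Ricci tensor contributes 2 n J, and the two Laplacian terms
    contribute (d - 2) + d = 2 n times [lap_s] over [s]. Division by 2 n gives the claim. *)
Lemma einstein_trace x : V x ->
  Jtrace g x + (s x)^-1 * lap_s x = d / 2 * (s x)^-1 ^+ 2 * (nu2 x - 1).
Proof.
move=> Vx; have := ginv_trace Vx; have E := fun i j => einstein_eq i j Vx.
have JE : \sum_i \sum_j ginv g x i j * ricci g x i j = 2 * n%:R * Jtrace g x.
  rewrite /Jtrace mulrA divff ?mul1r // mulf_neq0 // pnatr_eq0 //.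
have := erefl (\sum_i \sum_j ginv g x i j * (- n%:R * (s x)^-1 ^+ 2 * g x i j)).
rewrite -{1}(eq_bigr _ (fun i _ => eq_bigr _ (fun j _ => congr1 (fun t => ginv g x i j * t) (E i j)))).
have -> : \sum_i \sum_j ginv g x i j * (ricci g x i j + (d - 2) * (s x)^-1 * hess i x j +
     g x i j * ((s x)^-1 * lap_s x - n%:R * (s x)^-1 ^+ 2 * nu2 x)) =
   \sum_i \sum_j ginv g x i j * ricci g x i j + (d - 2) * (s x)^-1 * lap_s x +
   (\sum_i \sum_j ginv g x i j * g x i j) *
     ((s x)^-1 * lap_s x - n%:R * (s x)^-1 ^+ 2 * nu2 x).
  set K := (s x)^-1 * _ - _.
  transitivity (\sum_i \sum_j (ginv g x i j * ricci g x i j +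
     (d - 2) * (s x)^-1 * (ginv g x i j * hess i x j) + ginv g x i j * g x i j * K)).
    by apply: eq_bigr => i _; apply: eq_bigr => j _; ring.
  under eq_bigr => i _ do rewrite !big_split /=.
  rewrite !big_split /=; congr (_ + _ + _).
    by rewrite mulr_sumr; apply: eq_bigr => i _; rewrite mulr_sumr.
  by rewrite mulr_suml; apply: eq_bigr => i _; rewrite mulr_suml.
have -> : \sum_i \sum_j ginv g x i j * (- n%:R * (s x)^-1 ^+ 2 * g x i j) =
   - n%:R * (s x)^-1 ^+ 2 * \sum_i \sum_j ginv g x i j * g x i j.
  by rewrite mulr_sumr; apply: eq_bigr => i _; rewrite mulr_sumr; apply: eq_bigr => j _; ring.
rewrite JE => H T; rewrite T in H.
apply: (mulfI (_ : 2 * n%:R != 0)); first by rewrite mulf_neq0 // pnatr_eq0.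
have E1 : d = n%:R + 1 by rewrite -natr1.
rewrite E1 in H *.
move: (Jtrace g x) (lap_s x) (nu2 x) (s x)^-1 H => J L N t H.
have -> : 2 * n%:R * (J + t * L) = - n%:R * t ^+ 2 * (n%:R + 1) +
   (n%:R + 1) * (n%:R * t ^+ 2 * N).
  by rewrite -H; ring.
by field.
Qed.

(** Inserting [einstein_trace] into the definition of [rho] gives rho = (1 - |nu|^2) / (2 s). *)
Lemma nu2_rho x : V x -> nu2 x + 2 * (s x * rho g s x) = 1.
Proof.
move=> Vx; have s0 : s x != 0 by rewrite gt_eqF // s_gt0.
have T := einstein_trace Vx; rewrite rhoE.
have -> : lap_s x + Jtrace g x * s x = s x * (Jtrace g x + (s x)^-1 * lap_s x).
  by field.
rewrite T; move: (n.+1%:R : R) d0 => D D0.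
by field; rewrite D0 s0.
Qed.

(** The trace identity eliminates |nu|^2 from [einstein_eq]. What remains is (d - 2) / s times the
    claim, and d - 2 is nonzero by [hn]. *)
Lemma almost_einstein i j x : V x ->
  hess i x j + s x * schouten g x i j + rho g s x * g x i j = 0.
Proof.
move=> Vx; have s0 : s x != 0 by rewrite gt_eqF // s_gt0.
have T := einstein_trace Vx; have E := einstein_eq i j Vx.
have -> : schouten g x i j = (d - 2)^-1 * (ricci g x i j - Jtrace g x * g x i j).
  rewrite /schouten mxE; congr (_ * _); rewrite mxE; congr (_ + _).
  by rewrite mxE; congr (- _); rewrite mxE.
have N : n%:R * (s x)^-1 ^+ 2 * (nu2 x - 1) = 2 * n%:R / d * (Jtrace g x + (s x)^-1 * lap_s x).
  rewrite T; move: (n.+1%:R : R) d0 => D D0.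
  by field; rewrite D0 s0.
rewrite rhoE; apply: (mulfI (_ : (d - 2) * (s x)^-1 != 0)).
  by rewrite mulf_neq0 // invr_neq0.
have E1 : d = n%:R + 1 by rewrite -natr1.
have d0' := d0; have d2' := d2.
move: (ricci g x i j) (Jtrace g x) (hess i x j) (lap_s x) (nu2 x) (g x i j) N E {T} => r J h L N c HN E.
have -> : r = - n%:R * (s x)^-1 ^+ 2 * c - (d - 2) * (s x)^-1 * h -
   c * ((s x)^-1 * L - n%:R * (s x)^-1 ^+ 2 * N) by rewrite -E; ring.
have -> : - n%:R * (s x)^-1 ^+ 2 * c - (d - 2) * (s x)^-1 * h -
   c * ((s x)^-1 * L - n%:R * (s x)^-1 ^+ 2 * N) =
   - (d - 2) * (s x)^-1 * h - c * ((s x)^-1 * L)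
   + c * (n%:R * (s x)^-1 ^+ 2 * (N - 1)) by ring.
rewrite HN; have N2 : 2 * n%:R = 2 * d - 2 by rewrite E1; ring.
rewrite N2; move: (n.+1%:R : R) d0' d2' => D D0 D2.
by field; rewrite D0 s0 D2.
Qed.

End Einstein.

(** * The slots of D_[3] and D^*_[3] *)

Section HoloOperators.
Variables (R : realType) (n : nat).
Local Notation pt := 'rV[R]_n.+1.
Local Notation idx := 'I_n.+1.
Local Notation ext := (ext R n).
Local Notation lform := (lform R n).
Implicit Types (i j l m : idx) (x : pt) (A B E N : lform) (v c : R).

(* holo_eps is the east slot of D_[3]; holo_iot and holo_div are the west and
   south slots of D^*_[3] on a tractor concentrated in the east slot. *)
Definition holo_eps (g : pt -> 'M[R]_n.+1) (s : pt -> R) v N A : lform := fun x =>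
  v *: ewf (dfun s x) (A x) - s x *: ext_d g A x - ewf (dfun s x) (ext_d g N x).

Definition holo_iot (g : pt -> 'M[R]_n.+1) (s : pt -> R) c E : lform := fun x =>
  c *: iwf (up g (dfun s) x) (E x) - s x *: codiff g E x.

Definition holo_div (g : pt -> 'M[R]_n.+1) (s : pt -> R) E : lform := fun x =>
  - codiff g (fun z => iwf (up g (dfun s) z) (E z)) x.

Lemma ext_deg_ewfS (k : int) (f : idx -> R) (C : ext) :
  ext_deg (k - 1) C -> ext_deg k (ewf f C).
Proof. by move=> dC; rewrite -[k](subrK 1); apply: ext_deg_ewf. Qed.

Lemma ext_deg_iwfS (k : int) (f : idx -> R) (C : ext) :
  ext_deg (k + 1) C -> ext_deg k (iwf f C).
Proof. by move=> dC; rewrite -[k](addrK 1); apply: ext_deg_iwf. Qed.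

Section OneMetric.
Variables (V : set pt) (g : pt -> 'M[R]_n.+1) (s : pt -> R).
Hypothesis hV : relopen V.
Hypothesis hg : local_metric V g.
Hypothesis s_smooth : smooth_on V s.
Local Notation nu := (dfun s).

Let snu : scov V nu. Proof. exact: scov_dfun. Qed.

Lemma sform_holo_eps v N A : sform V N -> sform V A -> sform V (holo_eps g s v N A).
Proof.
move=> sN sA; apply: sformB => //; last first.
  by apply: sform_ewf => //; apply: sform_ext_d.
apply: sformB => //; last by apply: sformZ => //; apply: sform_ext_d.
by apply: sformZ => //; [exact: smooth_cst|exact: sform_ewf].
Qed.

Lemma sform_Iota E : sform V E -> sform V (fun x => iwf (up g nu x) (E x)).
Proof. by move=> sE; apply: sform_iwf => //; apply: scov_up. Qed.

Lemma sform_holo_iot c E : sform V E -> sform V (holo_iot g s c E).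
Proof.
move=> sE; apply: sformB => //; last by apply: sformZ => //; apply: sform_codiff.
by apply: sformZ => //; [exact: smooth_cst|exact: sform_Iota].
Qed.

Lemma sform_holo_div E : sform V E -> sform V (holo_div g s E).
Proof. by move=> sE; apply: sformN => //; apply: sform_codiff => //; apply: sform_Iota. Qed.

Lemma holo_divE E x : V x -> sform V E ->
  holo_div g s E x = iwf (up g nu x) (codiff g E x).
Proof.
move=> Vx sE; rewrite /holo_div (codiff_iwf hV hg) ?opprK //.
exact: (sym_nab_dfun hV hg).
Qed.

Lemma Iota_holo_iot c E x : V x -> sform V E ->
  iwf (up g nu x) (holo_iot g s c E x) = - s x *: holo_div g s E x.
Proof.
move=> Vx sE; rewrite holo_divE // /holo_iot linearB !linearZ /= iwf_same.
by rewrite scaler0 add0r scalerN scaleNr.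
Qed.

Lemma Iota_holo_div E x : V x -> sform V E ->
  iwf (up g nu x) (holo_div g s E x) = 0.
Proof. by move=> Vx sE; rewrite holo_divE // iwf_same. Qed.

Lemma codiff_holo_div E x : V x -> sform V E -> codiff g (holo_div g s E) x = 0.
Proof.
move=> Vx sE; rewrite /holo_div (codiffN _ hV) //; last first.
  by apply: sform_codiff => //; apply: sform_Iota.
by rewrite (codiff_codiff hV hg) ?oppr0 //; apply: sform_Iota.
Qed.

(** As delta delta = 0, the second summand reduces to the derivative of [s], that is, to contraction
    of [codiff g E] with [nu]. Since [nu] is closed, both summands are multiples of [holo_div], with
    coefficients - c and - 1. *)
Lemma codiff_holo_iot c E x : V x -> sform V E ->
  codiff g (holo_iot g s c E) x = - (c + 1) *: holo_div g s E x.
Proof.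
move=> Vx sE; have sI := sform_Iota sE; have sd := sform_codiff hV hg sE.
have -> : codiff g (holo_iot g s c E) x =
   c *: codiff g (fun z => iwf (up g nu z) (E z)) x -
   codiff g (fun z => s z *: codiff g E z) x.
  rewrite (codiffB _ hV) //; first by rewrite (codiffZ _ hV).
    by apply: sformZ => //; apply: smooth_cst.
  exact: sformZ.
rewrite (codiffM _ hV) // (codiff_codiff hV hg) // scaler0 addr0 -holo_divE //.
rewrite /holo_div; move: (codiff g _ x) => C.
by apply/ffunP => S; rewrite !(extDE, extNE, extZE); ring.
Qed.

Lemma ext_deg_pdx k A i x : (forall y, V y -> ext_deg k (A y)) -> V x ->
  ext_deg k (pdx i A x).
Proof.
move=> dA Vx; apply/ext_degP => S Sk; rewrite pdxSE; apply: (is_pd_on hV Vx).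
apply: (is_pd_local hV Vx _ (is_pd_cst i 0 x)) => y Vy.
by have /ext_degP dAy := dA y Vy; rewrite dAy.
Qed.

Lemma ext_deg_gl k (H : idx -> idx -> R) (C : ext) : ext_deg k C -> ext_deg k (gl H C).
Proof.
move=> dC; rewrite glE; apply: ext_deg_sum => l.
exact/ext_deg_ewfS/ext_deg_iot.
Qed.

Lemma ext_deg_nabla k A i x : (forall y, V y -> ext_deg k (A y)) -> V x ->
  ext_deg k (nabla g i A x).
Proof.
move=> dA Vx; rewrite nablaE; apply: ext_degD; first exact: ext_deg_pdx.
by apply/ext_degN/ext_deg_gl/dA.
Qed.

Lemma ext_deg_ext_d k A x : (forall y, V y -> ext_deg k (A y)) -> V x ->
  ext_deg (k + 1) (ext_d g A x).
Proof. by move=> dA Vx; apply: ext_deg_sum => i; apply/ext_deg_eps/ext_deg_nabla. Qed.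

Lemma ext_deg_codiff k A x : (forall y, V y -> ext_deg k (A y)) -> V x ->
  ext_deg (k - 1) (codiff g A x).
Proof.
move=> dA Vx; rewrite codiffE; apply: ext_deg_sum => i.
exact/ext_deg_iwf/ext_deg_nabla.
Qed.

Lemma ext_deg_holo_eps k v N A x : (forall y, V y -> ext_deg (k - 1) (N y)) ->
  (forall y, V y -> ext_deg k (A y)) -> V x -> ext_deg (k + 1) (holo_eps g s v N A x).
Proof.
move=> dN dA Vx; apply: ext_degD; last first.
  apply/ext_degN/ext_deg_ewf; rewrite -[k](subrK 1); exact: ext_deg_ext_d.
apply: ext_degD; first by apply/ext_degZ/ext_deg_ewf/dA.
exact/ext_degN/ext_degZ/ext_deg_ext_d.
Qed.

Lemma ext_deg_holo_iot k c E x : (forall y, V y -> ext_deg (k + 1) (E y)) -> V x ->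
  ext_deg k (holo_iot g s c E x).
Proof.
move=> dE Vx; apply: ext_degD.
  by apply/ext_degZ/ext_deg_iwfS/dE.
apply/ext_degN/ext_degZ; rewrite -[k](addrK 1); exact: ext_deg_codiff.
Qed.

Lemma ext_deg_holo_div k E x : (forall y, V y -> ext_deg (k + 1) (E y)) -> V x ->
  ext_deg (k - 1) (holo_div g s E x).
Proof.
move=> dE Vx; apply: ext_degN; apply: ext_deg_codiff => // y Vy.
exact/ext_deg_iwfS/dE.
Qed.

Lemma holo_epsD v A B x : V x -> sform V A -> sform V B ->
  holo_eps g s v (fun=> 0) (fun z => A z + B z) x =
  holo_eps g s v (fun=> 0) A x + holo_eps g s v (fun=> 0) B x.
Proof.
move=> Vx sA sB; rewrite /holo_eps (ext_d0 _ hV) // (ext_dD _ hV) // linear0 linearD /=.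
move: (ewf _ (A x)) (ewf _ (B x)) (ext_d g A x) (ext_d g B x) => a b a' b'.
by apply/ffunP => S; rewrite !(extDE, extNE, extZE, ext0E); ring.
Qed.

Lemma holo_epsZ v r A x : V x -> sform V A ->
  holo_eps g s v (fun=> 0) (fun z => r *: A z) x = r *: holo_eps g s v (fun=> 0) A x.
Proof.
move=> Vx sA; rewrite /holo_eps (ext_d0 _ hV) // (ext_dZ _ hV) // linear0 linearZ /=.
move: (ewf _ (A x)) (ext_d g A x) => a a'.
by apply/ffunP => S; rewrite !(extDE, extNE, extZE, ext0E); ring.
Qed.

Lemma holo_iotD c A B x : V x -> sform V A -> sform V B ->
  holo_iot g s c (fun z => A z + B z) x = holo_iot g s c A x + holo_iot g s c B x.
Proof.
move=> Vx sA sB; rewrite /holo_iot (codiffD _ hV) // linearD /=.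
move: (iwf _ (A x)) (iwf _ (B x)) (codiff g A x) (codiff g B x) => a b a' b'.
by apply/ffunP => S; rewrite !(extDE, extNE, extZE, ext0E); ring.
Qed.

Lemma holo_iotZ c r A x : V x -> sform V A ->
  holo_iot g s c (fun z => r *: A z) x = r *: holo_iot g s c A x.
Proof.
move=> Vx sA; rewrite /holo_iot (codiffZ _ hV) // linearZ /=.
move: (iwf _ (A x)) (codiff g A x) => a a'.
by apply/ffunP => S; rewrite !(extDE, extNE, extZE, ext0E); ring.
Qed.

Lemma holo_eps_local v N A N' A' x : V x -> sform V N -> sform V A ->
  (forall y, V y -> N y = N' y) -> (forall y, V y -> A y = A' y) ->
  holo_eps g s v N' A' x = holo_eps g s v N A x.
Proof.
move=> Vx sN sA EN EA; rewrite /holo_eps (ext_d_local _ hV Vx EN sN).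
by rewrite (ext_d_local _ hV Vx EA sA) EA.
Qed.

Lemma holo_iot_local c E E' x : V x -> sform V E -> (forall y, V y -> E y = E' y) ->
  holo_iot g s c E' x = holo_iot g s c E x.
Proof. by move=> Vx sE EE; rewrite /holo_iot (codiff_local _ hV Vx EE sE) EE. Qed.

Lemma holo_div_local E E' x : V x -> sform V E -> (forall y, V y -> E y = E' y) ->
  holo_div g s E' x = holo_div g s E x.
Proof.
move=> Vx sE EE; rewrite /holo_div.
rewrite (@codiff_local _ _ V g hV (fun z => iwf (up g nu z) (E z))) //.
  by move=> y Vy; rewrite EE.
exact: sform_Iota.
Qed.

Section Tangential.
Hypothesis s_gt0 : forall x, V x -> 0 < s x.

Lemma powR_pred (b : R) x : V x -> s x * s x `^ (b - 1) = s x `^ b.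
Proof.
move=> Vx; have s0 := s_gt0 Vx.
rewrite -[in RHS](subrK 1 b) (@powRD _ (s x) (b - 1) 1) ?powRr1 ?(ltW s0) //.
  exact: mulrC.
by rewrite (gt_eqF s0) implybT.
Qed.

Lemma pd_powR_s b i x : V x ->
  pd i (fun z => s z `^ b) x = b * s x `^ (b - 1) * nu x i.
Proof.
move=> Vx; apply: (is_pd_on hV Vx).
exact: is_pd_powR (s_gt0 Vx) (smooth_is_pd s_smooth Vx).
Qed.

Lemma smooth_powR_s b : smooth_on V (fun z => s z `^ b).
Proof. exact: smooth_powR. Qed.

Lemma ewf_dpowR b (C : ext) x : V x -> ewf (dfun (fun z => s z `^ b) x) C =
  (b * s x `^ (b - 1)) *: ewf (nu x) C.
Proof.
move=> Vx; rewrite -ewfZ; apply: eq_ewf => i; exact: pd_powR_s.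
Qed.

Lemma iwf_dpowR b (C : ext) x : V x -> iwf (up g (dfun (fun z => s z `^ b)) x) C =
  (b * s x `^ (b - 1)) *: iwf (up g nu x) C.
Proof.
move=> Vx; rewrite -iwfZ; apply: eq_iwf => i; rewrite /up mulr_sumr.
by apply: eq_bigr => j _; rewrite [dfun _ _ _]pd_powR_s //; ring.
Qed.

(** Differentiating s^b produces b s^(b-1) nu, and the prefactor [s] of [ext_d] makes it b s^b nu:
    precisely what the shift of [v] by [b] compensates. The same mechanism works for [holo_iot]. *)
Lemma holo_eps_tangential v b A x : V x -> sform V A ->
  holo_eps g s (v + b) (fun=> 0) (fun z => s z `^ b *: A z) x =
  s x `^ b *: holo_eps g s v (fun=> 0) A x.
Proof.
move=> Vx sA; rewrite /holo_eps (ext_d0 _ hV) // (ext_dM _ hV) //; last exact: smooth_powR_s.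
rewrite linear0 linearZ /= ewf_dpowR // scalerDr scalerA [s x * (b * _)]mulrCA powR_pred //.
move: (ewf _ (A x)) (ext_d g A x) => a a'.
by apply/ffunP => S; rewrite !(extDE, extNE, extZE, ext0E); ring.
Qed.

Lemma holo_iot_tangential c b E x : V x -> sform V E ->
  holo_iot g s (c + b) (fun z => s z `^ b *: E z) x = s x `^ b *: holo_iot g s c E x.
Proof.
move=> Vx sE; rewrite /holo_iot (codiffM _ hV) //; last exact: smooth_powR_s.
rewrite linearZ /= iwf_dpowR // scalerDr scalerA [s x * (b * _)]mulrCA powR_pred //.
move: (iwf _ (E x)) (codiff g E x) => a a'.
by apply/ffunP => S; rewrite !(extDE, extNE, extZE, ext0E); ring.
Qed.

End Tangential.
End OneMetric.
End HoloOperators.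

(** * Naturality of the slot operators under changes of charts *)

Section HoloTransition.
Variables (R : realType) (n : nat).
Local Notation pt := 'rV[R]_n.+1.
Local Notation idx := 'I_n.+1.
Local Notation lform := (lform R n).
Implicit Types (i j l m : idx) (x : pt) (A B E N : lform) (v c : R).
Variables (Va Vb : set pt) (ga gb : pt -> 'M[R]_n.+1) (phi : pt -> pt).
Variables (sa sb : pt -> R).
Hypothesis hVa : relopen Va.
Hypothesis hVb : relopen Vb.
Hypothesis hga : local_metric Va ga.
Hypothesis hgb : local_metric Vb gb.
Hypothesis phiV : forall x, Va x -> Vb (phi x).
Hypothesis phi_smooth : forall j, smooth_on Va (fun z => phi z ord0 j).
Local Notation J := (jac_mx phi).
Hypothesis gaE : forall x, Va x -> ga x = J x *m gb (phi x) *m (J x)^T.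
Hypothesis sb_smooth : smooth_on Vb sb.
Hypothesis saE : forall x, Va x -> sa x = sb (phi x).

Lemma dfun_transition x i : Va x -> dfun sa x i = \sum_p J x i p * dfun sb (phi x) p.
Proof.
move=> Vx; apply: (is_pd_on hVa Vx).
have H : is_pd i (fun z => sb (phi z)) x (\sum_p J x i p * pd p sb (phi x)).
  exact: (is_pd_phi hVa hVb phiV phi_smooth (f := sb)).
by apply: (is_pd_local hVa Vx _ H) => y Vy; rewrite saE.
Qed.

Lemma holo_eps_transition v N A N' A' : sform Vb N' -> sform Vb A' ->
  forms_match Va phi N N' -> forms_match Va phi A A' ->
  forms_match Va phi (holo_eps ga sa v N A) (holo_eps gb sb v N' A').
Proof.
move=> sN sA mN mA x Vx; rewrite /holo_eps.
rewrite (ext_d_transition hVa hVb hga hgb phiV phi_smooth gaE mN) //.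
rewrite (ext_d_transition hVa hVb hga hgb phiV phi_smooth gaE mA) //.
rewrite mA // saE // !(ewf_transition (v := dfun sb)); try by move=> i; apply: dfun_transition.
by rewrite linearB linearB !linearZ.
Qed.

Lemma holo_iot_transition c E E' : sform Vb E' -> forms_match Va phi E E' ->
  forms_match Va phi (holo_iot ga sa c E) (holo_iot gb sb c E').
Proof.
move=> sE mE x Vx; rewrite /holo_iot.
rewrite (codiff_transition hVa hVb hga hgb phiV phi_smooth gaE mE) // mE // saE //.
rewrite (iwf_up_transition hga hgb phiV gaE (v := dfun sb)) //; last first.
  by move=> i; apply: dfun_transition.
by rewrite linearB !linearZ.
Qed.

Lemma holo_div_transition E E' : sform Vb E' -> forms_match Va phi E E' ->
  forms_match Va phi (holo_div ga sa E) (holo_div gb sb E').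
Proof.
move=> sE mE x Vx; rewrite /holo_div.
rewrite (codiff_transition hVa hVb hga hgb phiV phi_smooth gaE
  (B := fun z => iwf (up gb (dfun sb) z) (E' z))) //.
- by rewrite linearN.
- move=> y Vy; rewrite mE // (iwf_up_transition hga hgb phiV gaE (v := dfun sb)) //.
  by move=> i; apply: dfun_transition.
- by apply: sform_iwf => //; apply: scov_up => //; apply: scov_dfun.
Qed.

End HoloTransition.

Lemma iwf_scale (R : realType) n (f : 'I_n.+1 -> R) r (C : ext R n) :
  iwf f (r *: C) = r *: iwf f C.
Proof. exact: linearZ. Qed.

Lemma iwf_addr (R : realType) n (f : 'I_n.+1 -> R) (C D : ext R n) :
  iwf f (C + D) = iwf f C + iwf f D.
Proof. exact: linearD. Qed.

Lemma iwf_oppr (R : realType) n (f : 'I_n.+1 -> R) (C : ext R n) :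
  iwf f (- C) = - iwf f C.
Proof. exact: linearN. Qed.

Lemma iwf_subr (R : realType) n (f : 'I_n.+1 -> R) (C D : ext R n) :
  iwf f (C - D) = iwf f C - iwf f D.
Proof. exact: linearB. Qed.

(** * Behaviour of the slot operators under changes of scale *)

Section HoloConformal.
Variables (R : realType) (n : nat).
Local Notation pt := 'rV[R]_n.+1.
Local Notation idx := 'I_n.+1.
Local Notation ext := (ext R n).
Local Notation lform := (lform R n).
Implicit Types (i j l m : idx) (x : pt) (A B E N : lform) (v c : R).
Variables (V : set pt) (g gh : pt -> 'M[R]_n.+1) (Om s sh : pt -> R).
Hypothesis hV : relopen V.
Hypothesis hg : local_metric V g.
Hypothesis Om_smooth : smooth_on V Om.
Hypothesis Om_gt0 : forall x, V x -> 0 < Om x.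
Hypothesis ghE : forall x, V x -> gh x = (Om x) ^+ 2 *: g x.
Hypothesis s_smooth : smooth_on V s.
Hypothesis shE : forall x, V x -> sh x = Om x * s x.
Local Notation Y := (dlog Om).

Let sY : scov V Y. Proof. exact: (scov_dlog hV Om_smooth Om_gt0). Qed.
Let snu : scov V (dfun s). Proof. exact: scov_dfun. Qed.
Let symY x : V x -> sym_nab g Y x.
Proof. by move=> Vx; apply: (sym_nab_dfun hV hg) => //; apply: smooth_lnOm. Qed.

Lemma powR_Om v b x : V x -> Om x `^ (v + b) = Om x `^ v * Om x `^ b.
Proof. by move=> Vx; rewrite powRD // (gt_eqF (Om_gt0 Vx)) implybT. Qed.

Lemma powR_Om1 x : V x -> Om x `^ 1 = Om x.
Proof. by move=> Vx; rewrite powRr1 // ltW // Om_gt0. Qed.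

Lemma powR_Om2 x : V x -> Om x `^ (-2) = Om x ^- 2.
Proof. by move=> Vx; rewrite powRN -(powR_mulrn 2) // ltW // Om_gt0. Qed.

Lemma smooth_powOm v : smooth_on V (fun z => Om z `^ v).
Proof. exact: smooth_powR. Qed.

Lemma ewf_dpowOm v (C : ext) x : V x -> ewf (dfun (fun z => Om z `^ v) x) C =
  (v * Om x `^ v) *: ewf (Y x) C.
Proof.
move=> Vx; rewrite -ewfZ; apply: eq_ewf => i; exact: (pd_powR_Om hV Om_smooth Om_gt0).
Qed.

Lemma iwf_dpowOm v (C : ext) x : V x -> iwf (up g (dfun (fun z => Om z `^ v)) x) C =
  (v * Om x `^ v) *: iwf (up g Y x) C.
Proof.
move=> Vx; rewrite -iwfZ; apply: eq_iwf => i; rewrite /up mulr_sumr.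
by apply: eq_bigr => j _; rewrite [dfun _ _ _](pd_powR_Om hV Om_smooth Om_gt0) //; ring.
Qed.

Lemma dfun_sh x i : V x -> dfun sh x i = Om x * (dfun s x i + s x * Y x i).
Proof.
move=> Vx; apply: (is_pd_on hV Vx).
have H := is_pdM (smooth_is_pd (i := i) Om_smooth Vx) (smooth_is_pd (i := i) s_smooth Vx).
apply: is_pd_val (is_pd_local hV Vx _ H) _; first by move=> y Vy; rewrite shE.
rewrite (pd_Om hV Om_smooth Om_gt0) // /dfun.
move: (pd i s x) (Y x i) => a b; ring.
Qed.

Lemma ewf_sh (C : ext) x : V x -> ewf (dfun sh x) C =
  Om x *: (ewf (dfun s x) C + s x *: ewf (Y x) C).
Proof.
move=> Vx; rewrite -ewfZ -ewfD -ewfZ; apply: eq_ewf => i; exact: dfun_sh.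
Qed.

Lemma iwf_sh (C : ext) x : V x -> iwf (up gh (dfun sh) x) C =
  (Om x)^-1 *: (iwf (up g (dfun s) x) C + s x *: iwf (up g Y x) C).
Proof.
move=> Vx; have O0 : Om x != 0 by rewrite gt_eqF // Om_gt0.
rewrite -iwfZ -iwfD -iwfZ; apply: eq_iwf => i; rewrite /up mulr_sumr -big_split mulr_sumr.
apply: eq_bigr => j _ /=; rewrite dfun_sh // (ginv_gh hg Om_gt0 ghE) //.
move: (dfun s x j) (Y x j) (ginv g x i j) (Om x) O0 => a b c o o0.
by field.
Qed.

Lemma holo_eps_conf v N A Nh Ah x : V x -> sform V N -> sform V A ->
  (forall y, V y -> Nh y = Om y `^ v *: N y) ->
  (forall y, V y -> Ah y = Om y `^ v *: (A y + ewf (Y y) (N y))) ->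
  holo_eps gh sh v Nh Ah x = Om x `^ (v + 1) *: holo_eps g s v N A x.
Proof.
move=> Vx sN sA NhE AhE.
have sYN : sform V (fun y => ewf (Y y) (N y)) by apply: sform_ewf.
have sAN := sformD hV sA sYN.
rewrite /holo_eps !(ext_d_gh hV hg Om_smooth Om_gt0 ghE) //.
have -> : ext_d g Nh x = (v * Om x `^ v) *: ewf (Y x) (N x) + Om x `^ v *: ext_d g N x.
  rewrite (ext_d_local _ hV Vx (fun y Vy => esym (NhE y Vy))); last first.
    by apply: sformZ => //; apply: smooth_powOm.
  by rewrite (ext_dM _ hV) //; [rewrite ewf_dpowOm|exact: smooth_powOm].
have -> : ext_d g Ah x = (v * Om x `^ v) *: ewf (Y x) (A x) +
     Om x `^ v *: (ext_d g A x - ewf (Y x) (ext_d g N x)).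
  rewrite (ext_d_local _ hV Vx (fun y Vy => esym (AhE y Vy))); last first.
    by apply: sformZ => //; apply: smooth_powOm.
  rewrite (ext_dM _ hV) //; last exact: smooth_powOm.
  rewrite ewf_dpowOm // (ext_dD _ hV) // (ext_d_ewf hV) //; last exact: symY.
  by rewrite linearD /= ewf_same addr0.
have lin f r (C D : ext) : ewf f (r *: (C + D)) = r *: (ewf f C + ewf f D).
  by rewrite linearZ linearD.
have lin2 f r r' (C D : ext) : ewf f (r *: C + r' *: D) = r *: ewf f C + r' *: ewf f D.
  by rewrite linearD; congr (_ + _); rewrite linearZ.
rewrite AhE // shE // !ewf_sh // powR_Om // powR_Om1 // !lin !lin2 !ewf_same.
move: (ewf (dfun s x) (ewf (Y x) (N x))) (ewf (dfun s x) (A x)) (ewf (Y x) (A x)).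
move: (ext_d g A x) (ewf (Y x) (ext_d g N x)) (ewf (dfun s x) (ext_d g N x)).
move: (Om x `^ v) (Om x) (s x) => t o r D1 D2 D3 a b e.
by apply/ffunP => S; rewrite !(extDE, extNE, extZE, ext0E); ring.
Qed.

Lemma codiff_conf (k : int) v E x : V x -> sform V E -> ext_deg k (E x) ->
  codiff gh (fun z => Om z `^ v *: E z) x = (Om x `^ v * Om x ^- 2) *:
   (codiff g E x + (v + n.+1%:R - 2 * k%:~R) *: iwf (up g Y x) (E x)).
Proof.
move=> Vx sE dE.
rewrite (codiff_gh hV hg Om_smooth Om_gt0 ghE Vx (k := k)); last exact: ext_degZ.
rewrite (codiffM _ hV) //; last exact: smooth_powOm.
rewrite iwf_dpowOm // iwf_scale.
move: (iwf _ (E x)) (codiff g E x) (Om x `^ v) (Om x ^- 2) => a b t o.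
by apply/ffunP => S; rewrite !(extDE, extNE, extZE, ext0E); ring.
Qed.

(** The constant n + v - 2 k is the coefficient of Upsilon that [codiff_conf] produces for a (k +
    1)-form of weight v + 1. With it, the contributions of the change of [nu] and of delta
    cancel. *)
Lemma holo_iot_conf (k : int) v E Eh x : V x -> sform V E ->
  (forall y, V y -> ext_deg (k + 1) (E y)) ->
  (forall y, V y -> Eh y = Om y `^ (v + 1) *: E y) ->
  holo_iot gh sh (n%:R + v - 2 * k%:~R) Eh x =
  Om x `^ v *: holo_iot g s (n%:R + v - 2 * k%:~R) E x.
Proof.
move=> Vx sE dE EhE; have O0 : Om x != 0 by rewrite gt_eqF // Om_gt0.
rewrite /holo_iot.
rewrite (codiff_local _ hV Vx (fun y Vy => esym (EhE y Vy))); last first.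
  by apply: sformZ => //; apply: smooth_powOm.
rewrite (codiff_conf (k := k + 1)) //; last exact: dE.
rewrite EhE // shE // iwf_sh // !iwf_scale powR_Om // powR_Om1 //.
have -> : v + 1 + n.+1%:R - 2 * (k + 1)%:~R = n%:R + v - 2 * k%:~R :> R.
  by rewrite intrD -natr1; ring.
move: (iwf _ (E x)) (iwf _ (E x)) (codiff g E x) (Om x `^ v) (Om x) O0 => a b D t o o0.
by apply/ffunP => S; rewrite !(extDE, extNE, extZE, ext0E); field.
Qed.

(** The correction is minus the contraction of the west slot with Upsilon, which is the law of a
    south slot when north and east vanish. Contracting with the new [nu] adds s times the
    contraction with Upsilon; the derivative of [s] and [codiff_conf] then supply the terms of
    [holo_iot]. *)
Lemma holo_div_conf (k : int) v E Eh x : V x -> sform V E ->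
  (forall y, V y -> ext_deg (k + 1) (E y)) ->
  (forall y, V y -> Eh y = Om y `^ (v + 1) *: E y) ->
  holo_div gh sh Eh x = Om x `^ (v - 2) *: (holo_div g s E x -
    iwf (up g Y x) (holo_iot g s (n%:R + v - 2 * k%:~R) E x)).
Proof.
move=> Vx sE dE EhE.
pose IE z := iwf (up g (dfun s) z) (E z); pose JE z := iwf (up g Y z) (E z).
pose F z := IE z + s z *: JE z.
have sIE : sform V IE by apply: sform_iwf => //; apply: scov_up.
have sJE : sform V JE by apply: sform_iwf => //; apply: scov_up.
have ssJ : sform V (fun z => s z *: JE z) by apply: sformZ.
have sF : sform V F by apply: sformD.
have dF y : V y -> ext_deg k (F y).
  move=> Vy; apply: ext_degD; last apply: ext_degZ; apply: ext_deg_iwfS; exact: dE.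
have FE y : V y -> Om y `^ v *: F y = iwf (up gh (dfun sh) y) (Eh y).
  move=> Vy; have O0 : Om y != 0 by rewrite gt_eqF // Om_gt0.
  rewrite iwf_sh // EhE // !iwf_scale powR_Om // powR_Om1 // /F /IE /JE.
  move: (iwf _ (E y)) (iwf _ (E y)) (Om y `^ v) (Om y) O0 => a b t o o0.
  by apply/ffunP => S; rewrite !(extDE, extNE, extZE, ext0E); field.
rewrite {1}/holo_div (codiff_local _ hV Vx FE); last first.
  by apply: sformZ => //; apply: smooth_powOm.
rewrite (codiff_conf (k := k)) //; last exact: dF.
have -> : codiff g F x = - holo_div g s E x + (iwf (up g (dfun s) x) (JE x) -
   s x *: iwf (up g Y x) (codiff g E x)).
  rewrite (codiffD _ hV) // (codiffM _ hV) // /holo_div opprK; congr (_ + (_ + _)).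
  by rewrite /JE (codiff_iwf hV hg) ?scalerN //; apply: symY.
have -> : iwf (up g Y x) (F x) = iwf (up g Y x) (IE x).
  by rewrite /F linearD linearZ /= /JE iwf_same scaler0 addr0.
rewrite {1}/JE iwf_iwf -/(IE x) powR_Om // powR_Om2 // /holo_iot -/(IE x).
rewrite (linearB (iwf (up g Y x))) /= !iwf_scale -natr1.
move: (iwf (up g Y x) (IE x)) (holo_div g s E x) (iwf (up g Y x) (codiff g E x)) => a b D.
move: (Om x `^ v) (Om x ^- 2) (s x) => t o r.
by apply/ffunP => S; rewrite !(extDE, extNE, extZE, ext0E); ring.
Qed.

End HoloConformal.

(** * The operator y on the kernel of I^*, D-hat^* and X^* *)

Section YOperator.
Variables (R : realType) (n : nat).
Local Notation pt := 'rV[R]_n.+1.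
Local Notation idx := 'I_n.+1.
Local Notation ext := (ext R n).
Local Notation lform := (lform R n).
Implicit Types (i j l m : idx) (x : pt) (A B E N : lform).

Lemma epsv_dcov (s : pt -> R) A x : epsv (dcov s) A x = ewf (dfun s x) (A x).
Proof. by apply: eq_bigr => i _; rewrite mxE. Qed.

Lemma iotv_dcov g (s : pt -> R) A x :
  iotv g (dcov s) A x = iwf (up g (dfun s) x) (A x).
Proof.
apply: eq_bigr => i _; rewrite /up scaler_suml; apply: eq_bigr => j _.
by rewrite mxE.
Qed.

Variables (V : set pt) (g : pt -> 'M[R]_n.+1) (s : pt -> R).
Hypothesis hV : relopen V.
Hypothesis hg : local_metric V g.

Lemma ext_d_zero A x : V x -> (forall y, V y -> A y = 0) -> ext_d g A x = 0.
Proof.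
move=> Vx A0; rewrite (@ext_d_local _ _ V g hV (fun=> 0)) ?(ext_d0 _ hV) //.
- by move=> y Vy; rewrite A0.
- exact: sform_cst.
Qed.

Lemma codiff_zero A x : V x -> (forall y, V y -> A y = 0) -> codiff g A x = 0.
Proof.
move=> Vx A0; rewrite (@codiff_local _ _ V g hV (fun=> 0)) ?(codiff0 _ hV) //.
- by move=> y Vy; rewrite A0.
- exact: sform_cst.
Qed.

Lemma form_lap_zero A x : V x -> (forall y, V y -> A y = 0) -> form_lap g A x = 0.
Proof.
move=> Vx A0; rewrite /form_lap ext_d_zero ?codiff_zero ?addr0 // => y Vy.
  exact: ext_d_zero.
exact: codiff_zero.
Qed.

Lemma schouten_extE A x : schouten_ext g A x =
  gl (fun j i => (ginv g x *m schouten g x) i j) (A x).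
Proof. by rewrite /gl exchange_big. Qed.

Lemma JmP_zero A x : A x = 0 -> JmP g A x = 0.
Proof. by move=> A0; rewrite /JmP schouten_extE A0 (linear0 (gl _)) !scaler0 subr0. Qed.

Definition slots_zero (V : set pt) (F : slots R n) :=
  forall x, V x -> [/\ north F x = 0, west F x = 0, east F x = 0 & south F x = 0].

(** Vanishing on a relatively open set passes to all derivatives there. Hence on the kernel of
    [Istar_loc] the second summand of [yop_loc] drops out. *)
Lemma Dop_loc_zero (k : int) (w : R) F : slots_zero V F -> slots_zero V (Dop_loc g k w F).
Proof.
move=> F0 x Vx.
have Nz y (Vy : V y) : north F y = 0 by have [] := F0 y Vy.
have Wz y (Vy : V y) : west F y = 0 by have [] := F0 y Vy.
have Ez y (Vy : V y) : east F y = 0 by have [] := F0 y Vy.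
have Sz y (Vy : V y) : south F y = 0 by have [] := F0 y Vy.
split; rewrite /=.
- by rewrite Wz // ext_d_zero // scaler0 subr0 scaler0.
- by rewrite ext_d_zero // scaler0.
- rewrite form_lap_zero // JmP_zero ?Nz // codiff_zero // ext_d_zero // Sz //.
  by rewrite !(scaler0, addr0, subr0).
- rewrite (JmP_zero (A := ext_d g (north F))) ?ext_d_zero // => [|y Vy]; last first.
    by rewrite JmP_zero ?Nz.
  by rewrite form_lap_zero // JmP_zero ?Wz // !scaler0 addr0 subrr !subr0.
Qed.

Hypothesis hn : (2 <= n)%N.
Hypothesis s_smooth : smooth_on V s.
Hypothesis s_gt0 : forall x, V x -> 0 < s x.
Hypothesis einstein : forall x, V x ->
  ricci (fun z => s z ^- 2 *: g z) x = - n%:R *: (s x ^- 2 *: g x).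
Variables (k : int) (w : R) (F : slots R n).
Hypothesis north0 : forall x, V x -> north F x = 0.
Hypothesis east0 : forall x, V x -> east F x = 0.
Hypothesis west_smooth : sform V (west F).
Hypothesis south_smooth : sform V (south F).
Hypothesis west_deg : forall x, V x -> ext_deg k (west F x).
Local Notation nu := (dfun s).
Hypothesis iota_west : forall x, V x ->
  iwf (up g nu x) (west F x) = - s x *: south F x.
Hypothesis iota_south : forall x, V x -> iwf (up g nu x) (south F x) = 0.
Local Notation d := (n.+1%:R : R).
Local Notation r := (k%:~R : R).
Hypothesis codiff_west : forall x, V x ->
  codiff g (west F) x = - (d + w - r) *: south F x.

Lemma Istar_loc_zero : slots_zero V (Istar_loc g s F).
Proof.
move=> x Vx; split; rewrite /= !iotv_dcov ?north0 ?east0 //.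
- by rewrite (linear0 (iwf _)) !(scaler0, oppr0, addr0).
- by rewrite scaler0 add0r iota_west // scaleNr addNr.
- exact: (linear0 (iwf _)).
- by rewrite scaler0 iota_south // subr0.
Qed.

Let c1 := (d + 2 * w - 2) * (w + r).

Lemma north_Dop x : V x -> north (Dop_loc g k w F) x = c1 *: west F x.
Proof.
by move=> Vx; rewrite /= ext_d_zero // subr0 scalerA.
Qed.

Lemma west_Dop x : V x -> west (Dop_loc g k w F) x = (d + 2 * w - 2) *: ext_d g (west F) x.
Proof. by []. Qed.

(** The equation for [codiff] of the west slot adds 2 (d + w - k) to (d + 2 w)(w + k - 2), and the
    sum is [c1]. North and east thus carry the same factor, which makes the north slot of y
    cancel. *)
Lemma east_Dop x : V x -> east (Dop_loc g k w F) x = c1 *: south F x.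
Proof.
move=> Vx; rewrite /= form_lap_zero // JmP_zero ?north0 // ext_d_zero // codiff_west //.
move: (south F x) => C; rewrite /c1.
by apply/ffunP => S; rewrite !(extDE, extNE, extZE, ext0E); ring.
Qed.

Lemma south_Dop x : V x -> south (Dop_loc g k w F) x =
  - codiff g (ext_d g (west F)) x - (w + r) *: JmP g (west F) x
  - (w + r) *: ext_d g (south F) x.
Proof.
move=> Vx.
have z1 : JmP g (ext_d g (north F)) x = 0 by apply: JmP_zero; apply: ext_d_zero.
have z2 : ext_d g (JmP g (north F)) x = 0.
  by apply: ext_d_zero => // y Vy; rewrite JmP_zero ?north0.
rewrite /= z1 z2.
have -> : form_lap g (west F) x =
    - (d + w - r) *: ext_d g (south F) x + codiff g (ext_d g (west F)) x.
  rewrite /form_lap; congr (_ + _); rewrite -(ext_dZ _ hV) //.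
  rewrite (@ext_d_local _ _ V g hV (fun z => - (d + w - r) *: south F z)) //.
    by move=> y Vy; rewrite codiff_west.
  by apply: sformZ => //; apply: smooth_cst.
move: (codiff g _ x) (JmP g _ x) (ext_d g _ x) => a b e.
by apply/ffunP => S; rewrite !(extDE, extNE, extZE, ext0E); ring.
Qed.

Lemma north_yop x : V x -> north (yop_loc g s k w F) x = 0.
Proof.
move=> Vx; have [D0 _ _ _] := Dop_loc_zero (k - 1) w Istar_loc_zero Vx.
rewrite -[LHS]/(-1 *: (north (Istar_loc g s (Dop_loc g k w F)) x +
   north (Dop_loc g (k - 1) w (Istar_loc g s F)) x)) D0 addr0.
rewrite -[north _ x]/(- iotv g (dcov s) (north (Dop_loc g k w F)) x -
   s x *: east (Dop_loc g k w F) x).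
rewrite iotv_dcov north_Dop // east_Dop // iwf_scale iota_west //.
move: (south F x) => C.
by apply/ffunP => S; rewrite !(extDE, extNE, extZE, ext0E); ring.
Qed.

Lemma east_yop x : V x -> east (yop_loc g s k w F) x = 0.
Proof.
move=> Vx; have [_ _ D0 _] := Dop_loc_zero (k - 1) w Istar_loc_zero Vx.
rewrite -[LHS]/(-1 *: (east (Istar_loc g s (Dop_loc g k w F)) x +
   east (Dop_loc g (k - 1) w (Istar_loc g s F)) x)) D0 addr0.
rewrite -[east _ x]/(iotv g (dcov s) (east (Dop_loc g k w F)) x).
by rewrite iotv_dcov east_Dop // iwf_scale iota_south // !scaler0.
Qed.

Lemma west_yop x : V x -> west (yop_loc g s k w F) x =
  s x *: codiff g (ext_d g (west F)) x
  - (d + 2 * w - 2) *: iwf (up g nu x) (ext_d g (west F) x)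
  + (w + r) *: (s x *: JmP g (west F) x - (rho g s x * (d + 2 * w - 2)) *: west F x
     + s x *: ext_d g (south F) x).
Proof.
move=> Vx; have [_ D0 _ _] := Dop_loc_zero (k - 1) w Istar_loc_zero Vx.
rewrite -[LHS]/(-1 *: (west (Istar_loc g s (Dop_loc g k w F)) x +
   west (Dop_loc g (k - 1) w (Istar_loc g s F)) x)) D0 addr0.
rewrite -[west _ x]/(rho g s x *: north (Dop_loc g k w F) x +
  iotv g (dcov s) (west (Dop_loc g k w F)) x + s x *: south (Dop_loc g k w F) x).
rewrite iotv_dcov north_Dop // west_Dop // south_Dop // iwf_scale /c1.
move: (codiff g _ x) (JmP g _ x) (ext_d g (south F) x) (iwf _ _) (west F x) => a b e C D.
by apply/ffunP => S; rewrite !(extDE, extNE, extZE, ext0E); ring.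
Qed.

(** The relation between west and south in the kernel of [Istar_loc] persists for y F. Off the
    boundary it recovers the south slot of y F from the west slot. *)
Lemma south_yop x : V x ->
  iwf (up g nu x) (west (yop_loc g s k w F) x) = - s x *: south (yop_loc g s k w F) x.
Proof.
move=> Vx; have [_ _ _ D0] := Dop_loc_zero (k - 1) w Istar_loc_zero Vx.
have -> : south (yop_loc g s k w F) x = -1 *: (rho g s x *: east (Dop_loc g k w F) x -
   iwf (up g nu x) (south (Dop_loc g k w F) x)).
  have yE G1 G2 : south (slots_scale (fun=> -1) (slots_add G1 G2)) x =
    -1 *: (south G1 x + south G2 x) :> ext by [].
  have IE G : south (Istar_loc g s G) x =
    rho g s x *: east G x - iotv g (dcov s) (south G) x by [].
  apply: etrans (yE _ _) _.
  apply: etrans (congr1 (fun C => -1 *: (south (Istar_loc g s (Dop_loc g k w F)) x + C)) D0) _.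
  by rewrite addr0 IE iotv_dcov.
rewrite west_yop // east_Dop // south_Dop //.
have lin a b e u v t (C1 C2 C3 C4 C5 : ext) :
   iwf (up g nu x) (a *: C1 - b *: C2 + e *: (u *: C3 - v *: C4 + t *: C5)) =
   a *: iwf (up g nu x) C1 - b *: iwf (up g nu x) C2 + e *: (u *: iwf (up g nu x) C3
    - v *: iwf (up g nu x) C4 + t *: iwf (up g nu x) C5).
  by rewrite iwf_addr iwf_subr !iwf_scale iwf_addr iwf_subr !iwf_scale.
rewrite lin iwf_same iota_west //.
have -> : iwf (up g nu x) (- codiff g (ext_d g (west F)) x - (w + r) *: JmP g (west F) x
  - (w + r) *: ext_d g (south F) x) =
   - iwf (up g nu x) (codiff g (ext_d g (west F)) x)
   - (w + r) *: iwf (up g nu x) (JmP g (west F) x)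
   - (w + r) *: iwf (up g nu x) (ext_d g (south F) x).
  by rewrite 2!iwf_subr iwf_oppr !iwf_scale.
rewrite /c1.
move: (iwf _ (codiff g _ x)) (iwf _ (JmP g _ x)) (iwf _ (ext_d g (south F) x)) (south F x).
move=> a b e C.
by apply/ffunP => S; rewrite !(extDE, extNE, extZE, ext0E); ring.
Qed.

Let snu : scov V nu. Proof. exact: scov_dfun. Qed.

(** By [almost_einstein] the Hessian of sigma is - s P - rho g, and the identity endomorphism acts
    on k-forms as multiplication by [k]. *)
Lemma gl_hess x (C : ext) : V x -> ext_deg k C ->
  gl (fun j i => \sum_l ginv g x i l * nabv g l nu x j) C =
  - s x *: gl (fun j i => (ginv g x *m schouten g x) i j) C - (rho g s x * r) *: C.
Proof.
move=> Vx dC.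
have -> : - s x *: gl (fun j i => (ginv g x *m schouten g x) i j) C - (rho g s x * r) *: C
  = gl (fun j i => - s x * (ginv g x *m schouten g x) i j + - rho g s x * (j == i)%:R) C.
  rewrite (glD (fun j i => - s x * (ginv g x *m schouten g x) i j)).
  by rewrite !glZ gl_delta (sum_eps_iot dC) scalerA mulNr !scaleNr.
apply: eq_gl => j i; rewrite [(_ *m _) i j]mxE mulr_sumr.
rewrite [j == i]eq_sym -(ginvL hg i j Vx) mulr_sumr -big_split; apply: eq_bigr => l _ /=.
have H : nabv g l nu x j = - (s x * schouten g x l j + rho g s x * g x l j).
  apply/eqP; rewrite -addr_eq0 addrA; apply/eqP.
  exact: (almost_einstein hn hV hg s_smooth s_gt0 einstein l j Vx).
by rewrite H; ring.
Qed.

Lemma lap_sE x : V x -> \sum_i \sum_j ginv g x i j * nabv g i nu x j =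
  - (s x * Jtrace g x) - d * rho g s x.
Proof.
move=> Vx; rewrite rhoE /lap_s /hess; have D0 : d != 0 by rewrite pnatr_eq0.
move: (\sum_i _) (Jtrace g x) (s x) (n.+1%:R : R) D0 => a b c D D0.
by field.
Qed.

(** This is [lie_codiff] for [nu]: the Hessian terms become [JmP] and [rho], while the kernel
    equations replace the codifferential and the contraction of the west slot by multiples of the
    south slot. *)
Lemma codiff_ewf_nu x : V x -> codiff g (fun z => ewf (nu z) (west F z)) x =
  (n%:R + w - r) *: ewf (nu x) (south F x) + iwf (up g nu x) (ext_d g (west F) x)
  - s x *: ext_d g (south F) x - s x *: JmP g (west F) x
  - ((d - 2 * r) * rho g s x) *: west F x.
Proof.
move=> Vx; have sy := sym_nab_dfun hV hg Vx s_smooth.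
have := lie_codiff hV hg Vx snu west_smooth sy.
rewrite lap_sE // gl_hess //; last exact: west_deg.
rewrite codiff_west //.
have -> : ext_d g (fun z => iwf (up g nu z) (west F z)) x =
   - (ewf (nu x) (south F x) + s x *: ext_d g (south F) x).
  rewrite (@ext_d_local _ _ V g hV (fun z => - (s z *: south F z))) //.
  - by rewrite (ext_dN _ hV) ?(ext_dM _ hV) //; apply: sformZ.
  - by move=> y Vy; rewrite iota_west // scaleNr.
  - by apply: sformN => //; apply: sformZ.
have -> : ewf (nu x) (- (d + w - r) *: south F x) =
  - (d + w - r) *: ewf (nu x) (south F x) by exact: linearZ.
rewrite /JmP schouten_extE => H.
(* The terms other than the codifferential of the product are moved to the right-hand side. *)
have {}H := congr1 (fun C => C + (d + w - r) *: ewf (nu x) (south F x) +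
  iwf (up g nu x) (ext_d g (west F) x) - (ewf (nu x) (south F x) + s x *: ext_d g (south F) x)) H.
have E : d = n%:R + 1 by rewrite -natr1.
move: H; rewrite E.
move: (gl (fun j => (ginv g x *m schouten g x) ^~ j) (west F x)) => f.
move: (codiff g _ x) (ewf (nu x) (south F x)) (iwf (up g nu x) (ext_d g (west F) x)) => a b e.
move: (ext_d g (south F) x) (west F x).
move=> D h H; apply: etrans (etrans _ H) _.
  by apply/ffunP => S; rewrite !(extDE, extNE, extZE, ext0E); ring.
by apply/ffunP => S; rewrite !(extDE, extNE, extZE, ext0E); ring.
Qed.

(** Contracting nu /\ A with nu gives |nu|^2 A = (1 - 2 s rho) A, up to a multiple of nu wedged with
    the south slot. The constant 1 yields the scalar kappa. The part in [rho] combines with that of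
    [codiff_ewf_nu] to the coefficient d + 2 w - 2 of [west_yop], and the terms with the south slot
    cancel. *)
Lemma west_yop_holo x : V x -> s x *: west (yop_loc g s k w F) x =
  holo_iot g s (n%:R + w - r) (holo_eps g s (w + r) (fun=> 0) (west F)) x -
  ((w + r) * (n%:R + w - r)) *: west F x.
Proof.
move=> Vx.
have sda : sform V (ext_d g (west F)) by apply: sform_ext_d.
have sea : sform V (fun z => ewf (nu z) (west F z)) by apply: sform_ewf.
have HE y : V y -> (w + r) *: ewf (nu y) (west F y) - s y *: ext_d g (west F) y =
    holo_eps g s (w + r) (fun=> 0) (west F) y.
  by move=> Vy; rewrite /holo_eps (ext_d0 _ hV) // (linear0 (ewf _)) subr0.
have svea : sform V (fun z => (w + r) *: ewf (nu z) (west F z)).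
  by apply: sformZ => //; apply: smooth_cst.
have ssda : sform V (fun z => s z *: ext_d g (west F) z) by apply: sformZ.
rewrite west_yop // /holo_iot (codiff_local _ hV Vx HE); last exact: sformB.
rewrite -HE // (codiffB _ hV) // (codiffZ _ hV) // (codiffM _ hV) //.
rewrite codiff_ewf_nu // iwf_subr !iwf_scale iwf_ewf -/(nu2 g s x) iota_west //.
have -> : ewf (nu x) (- s x *: south F x) = - s x *: ewf (nu x) (south F x).
  exact: linearZ.
have -> : nu2 g s x = 1 - 2 * (s x * rho g s x).
  exact: (canRL (addrK _) (nu2_rho hn hV hg s_smooth s_gt0 einstein Vx)).
rewrite -natr1.
move: (codiff g _ x) (ewf _ _) (iwf _ _) (ext_d g (south F) x) (JmP g _ x) (west F x).
move=> a b e D f h.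
by apply/ffunP => S; rewrite !(extDE, extNE, extZE, ext0E); ring.
Qed.

End YOperator.

(** * The statement in one chart and one scale *)

Section LocalTheorem.
Variables (R : realType) (n : nat).
Local Notation pt := 'rV[R]_n.+1.
Local Notation idx := 'I_n.+1.
Local Notation lform := (lform R n).
Implicit Types (i j m : idx) (x : pt) (E N : lform).

(** [Pi_loc] without its scalar factor. At the weight of [B] the denominator of that factor may
    vanish, whereas the composition is meaningful at every weight. *)
Definition D3star_D3 (g : pt -> 'M[R]_n.+1) s (k : int) (w : R) (F : slots R n) :=
  D3star_loc g s (k + 3) w (D3_loc g s k w F).

Lemma east_D3 g s (k : int) (w : R) (F : slots R n) :
  east (D3_loc g s k w F) = holo_eps g s (w + k%:~R) (north F) (west F).
Proof. by apply/funext => x; rewrite /= /eps_tilde !epsv_dcov. Qed.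

Lemma south_D3star_D3 g s (k : int) (w : R) (F : slots R n) :
  south (D3star_D3 g s k w F) =
  holo_div g s (holo_eps g s (w + k%:~R) (north F) (west F)).
Proof.
apply/funext => x; rewrite /= -/(east (D3_loc g s k w F)) east_D3 /holo_div.
by congr (- codiff g _ x); apply/funext => z; rewrite iotv_dcov.
Qed.

Variables (V : set pt) (g : pt -> 'M[R]_n.+1) (s : pt -> R).
Hypothesis hV : relopen V.
Hypothesis hg : local_metric V g.

(** On a (k + 1)-form of weight w + k + 1 the coefficient of [iot_tilde] is d + (w + k + 1) - 2 (k +
    1) = n + w - k. *)
Lemma west_D3star_D3 (k : int) (w : R) (F : slots R n) x : V x ->
  west (D3star_D3 g s k w F) x = holo_iot g s (n%:R + w - k%:~R)
    (holo_eps g s (w + k%:~R) (north F) (west F)) x.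
Proof.
move=> Vx; rewrite -east_D3; set G := D3_loc _ _ _ _ _.
rewrite -[LHS]/(iot_tilde g s (k + 3 - 2) (w + (k + 3)%:~R - 2) (east G) x -
  codiff g (iotv g (dcov s) (fun=> 0)) x).
rewrite (codiff_zero _ hV Vx) ?subr0; last first.
  by move=> y _; rewrite iotv_dcov (linear0 (iwf _)).
rewrite /iot_tilde /holo_iot iotv_dcov; congr (_ *: _ - _).
by rewrite !(intrD, intrB) -natr1 -!pmulrn; ring.
Qed.

Hypothesis hn : (2 <= n)%N.
Hypothesis s_smooth : smooth_on V s.
Hypothesis s_gt0 : forall x, V x -> 0 < s x.
Hypothesis einstein : forall x, V x ->
  ricci (fun z => s z ^- 2 *: g z) x = - n%:R *: (s x ^- 2 *: g x).
Variables (k : int) (w0 l : R) (A B : slots R n).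
Local Notation W := (- w0 - n%:R).
Local Notation d := (n.+1%:R : R).
Local Notation r := (k%:~R : R).
Local Notation nu := (dfun s).
Let b : R := d + 2 * w0 - 1.
Let kap : R := (W + r) * (n%:R + W - r).
Hypothesis kap0 : kap != 0.
Hypothesis north0 : forall x, V x -> north A x = 0.
Hypothesis east0 : forall x, V x -> east A x = 0.
Hypothesis west_smooth : sform V (west A).
Hypothesis south_smooth : sform V (south A).
Hypothesis west_deg : forall x, V x -> ext_deg k (west A x).
Hypothesis iota_west : forall x, V x ->
  iwf (up g nu x) (west A x) = - s x *: south A x.
Hypothesis iota_south : forall x, V x -> iwf (up g nu x) (south A x) = 0.
Hypothesis codiff_west : forall x, V x ->
  codiff g (west A) x = - (d + W - r) *: south A x.
Hypothesis B_west_smooth : sform V (west B).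
Hypothesis yA : forall x, V x -> slots_at (yop_loc g s k W A) x =
  slots_at (slots_scale (fun z => s z `^ l) B) x.

Let E := holo_eps g s (W + r) (fun=> 0) (west A).
Let c := n%:R + W - r.
Let Abar := slots_scale (fun z => s z `^ b) (Pi_loc g s k W A).

Let sE : sform V E. Proof. by apply: sform_holo_eps => //; apply: sform_cst. Qed.

Let EA x : V x -> holo_eps g s (W + r) (north A) (west A) x = E x.
Proof.
move=> Vx; apply: (holo_eps_local _ _ hV) => //; first exact: sform_cst.
by move=> y Vy; rewrite north0.
Qed.

Lemma west_Abar x : V x -> west Abar x = s x `^ b *: (kap^-1 *: holo_iot g s c E x).
Proof.
move=> Vx; rewrite -[LHS]/(s x `^ b *: (kap^-1 *: west (D3star_D3 g s k W A) x)).
apply: (congr1 (fun C => s x `^ b *: (kap^-1 *: C))).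
rewrite (west_D3star_D3 _ _ _ Vx).
apply: (holo_iot_local _ _ hV _ Vx sE) => y Vy; exact/esym/EA.
Qed.

Lemma south_Abar x : V x -> south Abar x = s x `^ b *: (kap^-1 *: holo_div g s E x).
Proof.
move=> Vx; rewrite -[LHS]/(s x `^ b *: (kap^-1 *: south (D3star_D3 g s k W A) x)).
apply: (congr1 (fun C => s x `^ b *: (kap^-1 *: C))).
rewrite south_D3star_D3.
apply: (holo_div_local hV hg s_smooth Vx sE) => y Vy; exact/esym/EA.
Qed.

Lemma north_Abar x : north Abar x = 0.
Proof. by rewrite /= !scaler0. Qed.

Lemma east_Abar x : east Abar x = 0.
Proof. by rewrite /= !scaler0. Qed.

(** [X] and [Z] agree on [V] with the west and south slots of Pi A; unlike these, they no longer
    mention the north slot. *)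
Let X z := kap^-1 *: holo_iot g s c E z.
Let Z z := kap^-1 *: holo_div g s E z.
Let sX : sform V X.
Proof. by apply: sformZ => //; [exact: smooth_cst|exact: sform_holo_iot]. Qed.
Let sZ : sform V Z.
Proof. by apply: sformZ => //; [exact: smooth_cst|exact: sform_holo_div]. Qed.
Let spow := smooth_powR_s hV s_smooth s_gt0.

Lemma sform_west_Abar : sform V (west Abar).
Proof.
by apply: (sform_eq hV) (sformZ hV (spow b) sX) => x Vx; rewrite west_Abar.
Qed.

Lemma sform_south_Abar : sform V (south Abar).
Proof.
by apply: (sform_eq hV) (sformZ hV (spow b) sZ) => x Vx; rewrite south_Abar.
Qed.

Lemma iota_west_Abar x : V x ->
  iwf (up g nu x) (west Abar x) = - s x *: south Abar x.
Proof.
move=> Vx; rewrite west_Abar // south_Abar // !iwf_scale (Iota_holo_iot hV hg s_smooth) //.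
by rewrite !scalerA; congr (_ *: _); ring.
Qed.

Lemma iota_south_Abar x : V x -> iwf (up g nu x) (south Abar x) = 0.
Proof.
by move=> Vx; rewrite south_Abar // !iwf_scale (Iota_holo_div hV hg s_smooth) // !scaler0.
Qed.

Let codiffX x : V x -> codiff g X x = - (c + 1) *: Z x.
Proof.
move=> Vx; rewrite /X (codiffZ _ hV) //; last exact: sform_holo_iot.
rewrite (codiff_holo_iot hV hg s_smooth) // !scalerA; congr (_ *: _); ring.
Qed.

Let codiffZ0 x : V x -> codiff g Z x = 0.
Proof.
move=> Vx; rewrite /Z (codiffZ _ hV) //; last exact: sform_holo_div.
by rewrite (codiff_holo_div hV hg s_smooth) // scaler0.
Qed.

(** Differentiating s^b contributes - b, because the contraction of [X] with [nu] is - s Z, and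
    [codiffX] contributes - (c + 1). Their sum is - (d + w0 - k), the coefficient required at weight
    [w0], by the choice b = h0 - 1. *)
Lemma codiff_west_Abar x : V x ->
  codiff g (west Abar) x = - (d + w0 - r) *: south Abar x.
Proof.
move=> Vx; rewrite south_Abar // -/(Z x).
rewrite (@codiff_local _ _ V g hV (fun z => s z `^ b *: X z)) //; first last.
- by apply: sformZ.
- by move=> y Vy; rewrite west_Abar.
rewrite (codiffM _ hV) // codiffX // (iwf_dpowR _ hV s_smooth s_gt0) //.
have -> : iwf (up g nu x) (X x) = - s x *: Z x.
  rewrite /X iwf_scale (Iota_holo_iot hV hg s_smooth) // !scalerA; congr (_ *: _); ring.
rewrite !scalerA -scalerDl; congr (_ *: _).
have P := powR_pred s_gt0 b Vx.
have -> : b * s x `^ (b - 1) * - s x = - b * s x `^ b by rewrite -P; ring.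
by move: (s x `^ b) => t; rewrite /b /c -natr1; ring.
Qed.

Lemma codiff_south_Abar x : V x -> codiff g (south Abar) x = 0.
Proof.
move=> Vx; have SE y (Vy : V y) : s y `^ b *: Z y = south Abar y.
  exact/esym/south_Abar.
rewrite (codiff_local _ hV Vx SE (sformZ hV (spow b) sZ)).
rewrite (codiffM _ hV Vx (spow b) sZ) (codiffZ0 Vx) (iwf_dpowR _ hV s_smooth s_gt0 _ _ Vx).
rewrite scaler0 addr0 /Z iwf_scale (Iota_holo_div hV hg s_smooth Vx sE).
by rewrite !scaler0.
Qed.

Lemma west_deg_Abar x : V x -> ext_deg k (west Abar x).
Proof.
move=> Vx; rewrite west_Abar //; do 2!apply: ext_degZ.
apply: (ext_deg_holo_iot hV) => // y Vy; apply: (ext_deg_holo_eps hV) => //.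
by move=> *; apply: ext_deg0.
Qed.

(** Nothing is assumed about the slots of [B]. The north slot of y A vanishes, and off the boundary
    the factor s^l can be divided out. *)
Let north_B x : V x -> north B x = 0.
Proof.
move=> Vx.
have : north (yop_loc g s k W A) x = s x `^ l *: north B x.
  exact: (congr1 (fun t => t.1.1.1) (yA Vx)).
rewrite (north_yop hV north0 east0 iota_west iota_south codiff_west Vx).
move/esym/eqP; rewrite scaler_eq0 => /orP[|/eqP //].
by rewrite powR_eq0 (gt_eqF (s_gt0 Vx)).
Qed.

Let west_yA x : V x -> west (yop_loc g s k W A) x = s x `^ l *: west B x.
Proof. move=> Vx; exact: (congr1 (fun t => t.1.1.2) (yA Vx)). Qed.

(** The coefficients of [holo_eps] and [holo_iot] at the weight W - 1 - l of [B]. Adding l + 1 to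
    them gives the coefficients at weight [W], as tangentiality requires for s^(l+1) B. *)
Local Notation v' := (W - 1 - l + r).
Local Notation c' := (n%:R + (W - 1 - l) - r).
Let E' := holo_eps g s v' (fun=> 0) (west B).

Let sE' : sform V E'.
Proof. by apply: (sform_holo_eps hV hg) => //; apply: sform_cst. Qed.

Let spow_mul a a' x : V x -> s x `^ (a + a') = s x `^ a * s x `^ a'.
Proof. by move=> Vx; rewrite powRD // (gt_eqF (s_gt0 Vx)) implybT. Qed.

Let XE x : V x -> west A x + kap^-1 *: (s x `^ (l + 1) *: west B x) = X x.
Proof.
move=> Vx.
have := west_yop_holo hV hg hn s_smooth s_gt0 einstein north0 east0 west_smooth
  south_smooth west_deg iota_west iota_south codiff_west Vx.
rewrite west_yA // -/E -/c -/kap scalerA -{1}[s x](@powRr1 _ (s x)) ?ltW ?s_gt0 //.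
rewrite -spow_mul // [1 + l]addrC => ->.
rewrite scalerBr scalerA mulVf // scale1r addrC subrK.
by [].
Qed.

Let EX x : V x -> holo_eps g s (W + r) (fun=> 0) X x = E x + kap^-1 *: (s x `^ (l + 1) *: E' x).
Proof.
move=> Vx; have sB : sform V (fun z => s z `^ (l + 1) *: west B z) by exact: sformZ.
have skB : sform V (fun z => kap^-1 *: (s z `^ (l + 1) *: west B z)).
  by apply: sformZ => //; apply: smooth_cst.
rewrite (holo_eps_local _ _ hV _ Vx (sform_cst hV 0) (sformD hV west_smooth skB)
  (fun _ _ => erefl) XE).
rewrite (holo_epsD _ _ hV _ Vx west_smooth skB) (holo_epsZ _ _ hV _ _ Vx sB) -/E.
have -> : W + r = v' + (l + 1) by ring.
by rewrite (holo_eps_tangential _ hV s_smooth s_gt0 _ _ Vx B_west_smooth).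
Qed.

(** [west_yop_holo] is applied at weight [w0]. Moving s^b out of both operators leaves Q applied to
    X = A + kap^-1 s^(l+1) B. The contribution of [A] cancels against the term kappa times [Abar],
    and dividing the rest by [s] lowers the exponent b + l + 1 to b + l. *)
Lemma west_yop_Abar x : V x -> west (yop_loc g s k w0 Abar) x =
  s x `^ (l + b) *: (kap^-1 *: holo_iot g s c' E' x).
Proof.
move=> Vx.
have := west_yop_holo hV hg hn s_smooth s_gt0 einstein (fun y _ => north_Abar y)
  (fun y _ => east_Abar y) sform_west_Abar sform_south_Abar west_deg_Abar
  iota_west_Abar iota_south_Abar codiff_west_Abar Vx.
pose QX z := E z + kap^-1 *: (s z `^ (l + 1) *: E' z).
have ssE' : sform V (fun z => s z `^ (l + 1) *: E' z) by exact: sformZ.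
have skE' : sform V (fun z => kap^-1 *: (s z `^ (l + 1) *: E' z)).
  by apply: sformZ => //; apply: smooth_cst.
have sQX : sform V QX by apply: sformD.
have E1 y : V y -> s y `^ b *: QX y = holo_eps g s (w0 + r) (fun=> 0) (west Abar) y.
  move=> Vy; have WE z (Vz : V z) : s z `^ b *: X z = west Abar z by exact/esym/west_Abar.
  rewrite (holo_eps_local _ _ hV _ Vy (sform_cst hV 0) (sformZ hV (spow b) sX)
    (fun _ _ => erefl) WE).
  have -> : w0 + r = W + r + b by rewrite /b -natr1; ring.
  by rewrite (holo_eps_tangential _ hV s_smooth s_gt0 _ _ Vy sX) (EX Vy).
rewrite (holo_iot_local _ _ hV _ Vx (sformZ hV (spow b) sQX) E1) (west_Abar Vx).
have -> : n%:R + w0 - r = c + b by rewrite /b /c -natr1; ring.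
rewrite (holo_iot_tangential _ hV s_smooth s_gt0 _ _ Vx sQX).
have -> : holo_iot g s c QX x = holo_iot g s c E x +
    kap^-1 *: (s x `^ (l + 1) *: holo_iot g s c' E' x).
  rewrite (holo_iotD _ _ hV _ Vx sE skE') (holo_iotZ _ _ hV _ _ Vx ssE').
  have -> : c = c' + (l + 1) by rewrite /c; ring.
  by rewrite (holo_iot_tangential _ hV s_smooth s_gt0 _ _ Vx sE').
(* The first factor is minus the second factor of [kap], and the second is minus the first. *)
have -> : (w0 + r) * (c + b) = kap by rewrite /kap /c /b -natr1; ring.
have s0 : s x != 0 by rewrite gt_eqF ?s_gt0.
have P : s x `^ (l + b) * s x = s x `^ b * s x `^ (l + 1).
  rewrite -spow_mul //; have -> : b + (l + 1) = l + b + 1 by ring.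
  by rewrite [RHS]spow_mul // powRr1 // ltW ?s_gt0.
move=> H; apply: (scalerI s0); rewrite H; move: P kap0.
move: (holo_iot g s c E x) (holo_iot g s c' E' x) (s x `^ b) (s x `^ (l + 1)).
move: (s x `^ (l + b)) (s x) kap => t o q C D t1 t2 P q0.
apply/ffunP => S; rewrite !(extDE, extNE, extZE, ext0E).
transitivity (t1 * t2 * (q^-1 * D S)); first by field.
by rewrite -P; ring.
Qed.

Lemma south_yop_Abar x : V x -> south (yop_loc g s k w0 Abar) x =
  s x `^ (l + b) *: (kap^-1 *: holo_div g s E' x).
Proof.
move=> Vx.
have := south_yop hV (k := k) (w := w0) (fun y _ => north_Abar y)
  (fun y _ => east_Abar y) sform_south_Abar
  iota_west_Abar iota_south_Abar codiff_west_Abar Vx.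
rewrite (west_yop_Abar Vx) !iwf_scale (Iota_holo_iot hV hg s_smooth _ Vx sE').
move: (south _ x) (holo_div g s E' x) (s x `^ _) => C D t H.
have s0 : - s x != 0 by rewrite oppr_eq0 gt_eqF ?s_gt0.
apply: (scalerI s0); rewrite -H !scalerA.
by congr (_ *: _); ring.
Qed.

(** The right-hand side uses the full [D3star_D3] of [B], north slot included, since this is what
    defines a smooth tractor on all of M. On [V] it reduces to the operators applied to [E'] by
    [north_B]. *)
Lemma yop_Abar x : V x -> slots_at (yop_loc g s k w0 Abar) x =
  slots_at (slots_scale (fun z => s z `^ (l + (d + 2 * w0) - 1))
    (slots_scale (fun=> kap^-1) (D3star_D3 g s k (W - 1 - l) B))) x.
Proof.
move=> Vx; rewrite /slots_at.
have -> : north (yop_loc g s k w0 Abar) x = 0.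
  apply: (north_yop hV (fun y _ => north_Abar y) (fun y _ => east_Abar y)
  iota_west_Abar iota_south_Abar codiff_west_Abar Vx).
have -> : east (yop_loc g s k w0 Abar) x = 0.
  apply: (east_yop hV (fun y _ => north_Abar y) (fun y _ => east_Abar y)
  iota_west_Abar iota_south_Abar codiff_west_Abar Vx).
rewrite (west_yop_Abar Vx) (south_yop_Abar Vx).
have -> : l + b = l + (d + 2 * w0) - 1 by rewrite /b; ring.
have EB y : V y -> E' y = holo_eps g s v' (north B) (west B) y.
  move=> Vy; apply/esym; apply: (holo_eps_local _ _ hV _ Vy (sform_cst hV 0) B_west_smooth) => //.
  by move=> z Vz; rewrite north_B.
have EW := west_D3star_D3 k (W - 1 - l) B Vx.
have ES := congr1 (fun F => F x) (south_D3star_D3 g s k (W - 1 - l) B).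
rewrite (holo_iot_local _ _ hV _ Vx sE' EB) in EW.
rewrite (holo_div_local hV hg s_smooth Vx sE' EB) in ES.
rewrite -EW -ES /=.
by rewrite !scaler0.
Qed.

End LocalTheorem.

(** * Tractor fields on the manifold *)

Section Charts.
Variables (R : realType) (n : nat).
Local Notation pt := 'rV[R]_n.+1.

Lemma relopen_preimage (T : topologicalType) (V : set pt) (f : pt -> T) (O : set T) :
  relopen V -> {within V, continuous f} -> open O -> relopen (V `&` f @^-1` O).
Proof.
move=> [W oW VE] /subspace_continuousP cf oO.
(* The interior of the set where membership in [V] forces membership in the preimage: an open set of
   the ambient space whose trace on [V] is the preimage. *)
exists (W `&` [set x | V x -> O (f x)]^°).
  by apply: openI => //; apply: open_interior.
rewrite eqEsubset; split=> x /=.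
  move=> [Vx Ofx]; have /= Nx := cf _ Vx _ (open_nbhs_nbhs (conj oO Ofx)).
  by move: (Vx); rewrite {1}VE => -[Wx hx].
move=> [[Wx /interior_subset /= Ix] hx].
have Vx : V x by rewrite VE.
by split=> //; exact: Ix.
Qed.

Variable M : manifold R n.
Implicit Types (a b : chart_index M) (U : set M) (p : M).

Lemma chart_imP a U x : chart_im a U x ->
  exists p, [/\ dom a p, U p, x = chart a p & chart_inv a x = p].
Proof. by move=> [p [ap Up] <-]; exists p; rewrite chartK. Qed.

Lemma chart_im_chart a U p : dom a p -> U p -> chart_im a U (chart a p).
Proof. by move=> ap Up; exists p. Qed.

Lemma chart_imS a U U' : U `<=` U' -> chart_im a U `<=` chart_im a U'.
Proof. by move=> UU x [p [ap /UU Up] <-]; exists p. Qed.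

Lemma relopen_chart_imT a : relopen (chart_im a setT).
Proof. by rewrite /chart_im setIT; exact: chart_im_open. Qed.

Definition overlap a b U : set pt := chart a @` (dom a `&` dom b `&` U).

Lemma relopen_overlap a b U : relopen (chart_im a U) -> relopen (overlap a b U).
Proof.
move=> oU.
have oI : relopen (chart a @` dom a `&` chart_inv a @^-1` dom b).
  apply: relopen_preimage; last exact: dom_open.
  - exact: chart_im_open.
  - exact: chart_inv_continuous.
rewrite (_ : overlap a b U = chart_im a U `&` (chart a @` dom a `&` chart_inv a @^-1` dom b)).
  exact: relopenI.
rewrite eqEsubset; split=> x /=.
  move=> [p [[ap bp] Up] <-]; split; first by exists p.
  by split; [exists p|rewrite chartK].
move=> [/chart_imP [p [ap Up xE pE]] [_]]; rewrite pE => bp.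
by exists p.
Qed.

Lemma posdef_unit (g : 'M[R]_n.+1) :
  (forall u : 'rV_n.+1, u != 0 -> 0 < (u *m g *m u^T) ord0 ord0) -> g \in unitmx.
Proof.
move=> gp; rewrite unitmxE unitfE; apply/negP => /det0P [u u0 ug].
by have := gp u u0; rewrite ug mul0mx mxE ltxx.
Qed.

Lemma metric_local g a U : is_metric g -> local_metric (chart_im a U) (g a).
Proof.
move=> [sg gT gp _]; split.
- by move=> i j; apply: smooth_onW (sg a i j); apply: chart_imS.
- by move=> x [p [ap _] <-]; apply: gT.
- by move=> x [p [ap _] <-]; apply: posdef_unit => u u0; apply: gp.
Qed.

Lemma in_chart_chart (f : M -> R) a p : dom a p -> in_chart f a (chart a p) = f p.
Proof. by move=> ap; rewrite /in_chart chartK. Qed.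

End Charts.

(** * Differential forms given by their components in all charts *)

Section Forms.
Variables (R : realType) (n : nat) (M : manifold R n) (U : set M).
Implicit Types (a b : chart_index M) (p : M) (j : int) (A B E N : form_field M).
Hypothesis hU : forall a, relopen (chart_im a U).

Local Notation trans a b := (fun z => chart b (chart_inv a z)).

Lemma is_form_intro j A : (forall a, sform (chart_im a U) (A a)) ->
  (forall a x, chart_im a U x -> ext_deg j (A a x)) ->
  (forall a b, forms_match (overlap a b U) (trans a b) (A a) (A b)) ->
  is_form U j A.
Proof.
move=> sA dA mA; split; first exact: sA.
- by move=> a p S ap Up; apply: dA; apply: chart_im_chart.
- move=> a b p ap bp Up; rewrite (mA a b); last by exists p.
  by rewrite chartK.
Qed.

Section Elim.
Variables (j : int) (A : form_field M).
Hypothesis fA : is_form U j A.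

Lemma is_form_sform a : sform (chart_im a U) (A a).
Proof. by have [sA _ _] := fA; apply: sA. Qed.

Lemma is_form_deg a x : chart_im a U x -> ext_deg j (A a x).
Proof. by have [_ dA _] := fA; move=> [p [ap Up] <-] S; apply: dA. Qed.

Lemma is_form_match a b : forms_match (overlap a b U) (trans a b) (A a) (A b).
Proof.
have [_ _ mA] := fA; move=> x [p [[ap bp] Up] <-].
by rewrite (mA a b) // chartK.
Qed.

End Elim.

Lemma is_form_eq j A B : (forall a x, chart_im a U x -> A a x = B a x) ->
  is_form U j A -> is_form U j B.
Proof.
move=> AB fA; apply: is_form_intro.
- by move=> a; apply: (sform_eq (hU a)) (is_form_sform fA a); apply: AB.
- by move=> a x Vx; rewrite -AB //; apply: (is_form_deg fA).
- move=> a b x Vx; have := is_form_match fA Vx.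
  by case: Vx => p [[ap bp] Up] <-; rewrite chartK // !AB //; apply: chart_im_chart.
Qed.

Lemma is_form0 j : is_form U j (fun _ _ => 0).
Proof.
apply: is_form_intro => [a|a x _|a b x _]; first exact: sform_cst.
  exact: ext_deg0.
by rewrite (linear0 (pullback _)).
Qed.

Lemma is_formZ (f : M -> R) j A : (forall a, smooth_on (chart_im a U) (in_chart f a)) ->
  is_form U j A -> is_form U j (fun a x => in_chart f a x *: A a x).
Proof.
move=> sf fA; apply: is_form_intro.
- by move=> a; apply: sformZ => //; apply: (is_form_sform fA).
- by move=> a x Vx; apply: ext_degZ; apply: (is_form_deg fA).
- move=> a b x Vx; rewrite (is_form_match fA Vx) linearZ /=.
  by case: Vx => p [[ap bp] Up] <-; rewrite chartK // !in_chart_chart.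
Qed.

Variables (g : metric_field M) (s : M -> R).
Hypothesis hg : is_metric g.
Hypothesis hs : smooth_fun s.

Let sa a : smooth_on (chart_im a U) (in_chart s a).
Proof. by apply: smooth_onW (hs a); apply: chart_imS. Qed.
Let ga a : local_metric (chart_im a U) (g a). Proof. exact: metric_local. Qed.

Section Overlap.
Variables a b : chart_index M.

Let oV : relopen (overlap a b U). Proof. exact: relopen_overlap. Qed.
Let oS : overlap a b U `<=` chart_im a U.
Proof. by move=> x [p [[ap _] Up] <-]; apply: chart_im_chart. Qed.
Let og : local_metric (overlap a b U) (g a).
Proof.
have [sg gT gu] := ga a; split; first by move=> i j; apply: smooth_onW (sg i j).
  by move=> x /oS; apply: gT.
by move=> x /oS; apply: gu.
Qed.
Let ophi x : overlap a b U x -> chart_im b U (trans a b x).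
Proof. by move=> [p [[ap bp] Up] <-]; rewrite chartK //; apply: chart_im_chart. Qed.
Let ophi_smooth (j : 'I_n.+1) : smooth_on (overlap a b U) (fun z => trans a b z ord0 j).
Proof.
apply: smooth_onW (@transition_smooth _ _ M a b j) => x [p [abp Up] <-].
by exists p.
Qed.
Let ogE x : overlap a b U x ->
  g a x = jac_mx (trans a b) x *m g b (trans a b x) *m (jac_mx (trans a b) x)^T.
Proof.
have [_ _ _ tg] := hg.
by move=> [p [[ap bp] Up] <-]; rewrite (tg a b p ap bp) chartK.
Qed.
Let osE x : overlap a b U x -> in_chart s a x = in_chart s b (trans a b x).
Proof. by move=> [p [[ap bp] Up] <-]; rewrite chartK // !in_chart_chart. Qed.

Definition holo_eps_overlap := holo_eps_transition oV (hU b) og (ga b) ophi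
  ophi_smooth ogE (sa b) osE.
Definition holo_iot_overlap := holo_iot_transition oV (hU b) og (ga b) ophi
  ophi_smooth ogE (sa b) osE.
Definition holo_div_overlap := holo_div_transition oV (hU b) og (ga b) ophi
  ophi_smooth ogE (sa b) osE.
End Overlap.

Local Notation sg a := (in_chart s a).

Lemma is_form_holo_eps v k N A : is_form U (k - 1) N -> is_form U k A ->
  is_form U (k + 1) (fun a => holo_eps (g a) (sg a) v (N a) (A a)).
Proof.
move=> fN fA; have [sN sA] := (is_form_sform fN, is_form_sform fA).
apply: is_form_intro.
- by move=> a; apply: sform_holo_eps.
- move=> a x Vx; apply: (ext_deg_holo_eps (hU a)) Vx => y; first exact: is_form_deg.
  exact: is_form_deg.
- by move=> a b; apply: holo_eps_overlap => //; apply: is_form_match; eassumption.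
Qed.

Lemma is_form_holo_iot v k E : is_form U (k + 1) E ->
  is_form U k (fun a => holo_iot (g a) (sg a) v (E a)).
Proof.
move=> fE; have sE := is_form_sform fE.
apply: is_form_intro.
- by move=> a; apply: sform_holo_iot.
- move=> a x Vx; apply: (ext_deg_holo_iot (hU a)) Vx => y; exact: is_form_deg.
- by move=> a b; apply: holo_iot_overlap => //; apply: is_form_match; eassumption.
Qed.

Lemma is_form_holo_div k E : is_form U (k + 1) E ->
  is_form U (k - 1) (fun a => holo_div (g a) (sg a) (E a)).
Proof.
move=> fE; have sE := is_form_sform fE.
apply: is_form_intro.
- by move=> a; apply: sform_holo_div.
- move=> a x Vx; apply: (ext_deg_holo_div (hU a)) Vx => y; exact: is_form_deg.
- by move=> a b; apply: holo_div_overlap => //; apply: is_form_match; eassumption.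
Qed.

End Forms.

Lemma tractor_change_west_south (R : realType) n (g : 'rV[R]_n.+1 -> 'M[R]_n.+1)
    Om k w (F Fh : slots R n) x :
  (north F = fun=> 0) -> (east F = fun=> 0) -> north Fh x = 0 -> east Fh x = 0 ->
  west Fh x = Om x `^ (w + k%:~R) *: west F x ->
  south Fh x = Om x `^ (w + k%:~R - 2) *: (south F x - iwf (up g (dlog Om) x) (west F x)) ->
  slots_at Fh x = slots_at (tractor_change g Om k w F) x.
Proof.
move=> N0 E0 Nh Eh Wh Sh; rewrite /slots_at Nh Eh Wh Sh /= N0 E0.
have I0 : iotv g (dcov (fun z => ln (Om z))) (fun=> 0) = fun=> 0.
  by apply/funext => z; rewrite iotv_dcov (linear0 (iwf _)).
have E0' : epsv (dcov (fun z => ln (Om z))) (fun=> 0) = fun=> 0.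
  by apply/funext => z; rewrite epsv_dcov (linear0 (ewf _)).
rewrite !(I0, E0') iotv_dcov -/(dlog Om).
by rewrite !(subr0, scaler0, addr0).
Qed.

(** A change of scale involves no derivative of [F], so it is linear over functions and only the
    powers of Omega have to be compared. *)
Lemma tractor_change_scale (R : realType) n (g : 'rV[R]_n.+1 -> 'M[R]_n.+1)
    Om f k w (b : R) (F : slots R n) x : 0 < Om x ->
  slots_at (tractor_change g Om k (w + b) (slots_scale f F)) x =
  slots_at (slots_scale (fun z => Om z `^ b * f z) (tractor_change g Om k w F)) x.
Proof.
move=> O0.
have powD a : Om x `^ (a + b) = Om x `^ b * Om x `^ a.
  by rewrite mulrC powRD // (gt_eqF O0) implybT.
have eE u A z : epsv u (fun y => f y *: A y) z = f z *: epsv u A z.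
  by rewrite /epsv scaler_sumr; apply: eq_bigr => i _; rewrite linearZ /= !scalerA mulrC.
have iE u A z : iotv g u (fun y => f y *: A y) z = f z *: iotv g u A z.
  rewrite /iotv scaler_sumr; apply: eq_bigr => i _; rewrite scaler_sumr.
  by apply: eq_bigr => j _; rewrite linearZ /= !scalerA mulrC.
rewrite /slots_at /=.
have -> : w + b + k%:~R = w + k%:~R + b by ring.
have -> : w + k%:~R + b - 2 = w + k%:~R - 2 + b by ring.
rewrite !powD; move: (dcov _) => u; rewrite !eE !iE.
have -> : iotv g u (epsv u (fun y => f y *: north F y)) x = f x *: iotv g u (epsv u (north F)) x.
  by rewrite -iE; congr (iotv g u _ x); apply/funext => z; apply: eE.
have -> : epsv u (iotv g u (fun y => f y *: north F y)) x = f x *: epsv u (iotv g u (north F)) x.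
  by rewrite -eE; congr (epsv u _ x); apply/funext => z; apply: iE.
move: (epsv _ _ x) (epsv _ _ x) (epsv _ _ x) (iotv _ _ _ x) (iotv _ _ _ x) (iotv _ _ _ x).
move=> a1 a2 a3 a4 a5 a6.
congr (_, _, _, _); apply/ffunP => S; rewrite !(extDE, extNE, extZE, ext0E); ring.
Qed.

(** * Tractor fields obtained by applying Q or multiplying by densities *)

Section Tractors.
Variables (R : realType) (n : nat) (M : manifold R n) (c : set (metric_field M)).
Variables (sigma : density_field M) (U : set M).
Implicit Types (a b : chart_index M) (p : M) (k : int) (w : R) (F : tractor_field M).
Hypothesis hU : forall a, relopen (chart_im a U).
Hypothesis hc : conformal_class c.
Hypothesis hs : is_density c 1 sigma.

Lemma class_metric g : c g -> is_metric g.
Proof. by have [g0 _ cE] := hc; move/cE => []. Qed.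

Lemma density_smooth g : c g -> smooth_fun (sigma g).
Proof. by have [ss _] := hs; apply: ss. Qed.

Lemma chart_smooth (f : M -> R) a : smooth_fun f -> smooth_on (chart_im a U) (in_chart f a).
Proof. by move=> sf; apply: smooth_onW (sf a); apply: chart_imS. Qed.

Section Rescaling.
Variables (g gh : metric_field M) (Om : M -> R) (a : chart_index M).
Hypotheses (cg : c g) (cgh : c gh) (resc : rescales Om g gh).

Let V := chart_im a U.
Let hV : relopen V. Proof. exact: hU. Qed.
Let lg : local_metric V (g a). Proof. exact/metric_local/class_metric. Qed.
Let sOm : smooth_on V (in_chart Om a).
Proof. by have [sOm _ _] := resc; apply: chart_smooth. Qed.
Let Om_gt0 x : V x -> 0 < in_chart Om a x.
Proof. by have [_ Op _] := resc => _; apply: Op. Qed.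
Let ghE x : V x -> gh a x = in_chart Om a x ^+ 2 *: g a x.
Proof.
have [_ _ gE] := resc; move=> [p [ap _] <-].
by rewrite in_chart_chart // gE.
Qed.
Let ssg : smooth_on V (in_chart (sigma g) a).
Proof. exact/chart_smooth/density_smooth. Qed.
Let shE x : V x ->
  in_chart (sigma gh) a x = in_chart Om a x * in_chart (sigma g) a x.
Proof.
have [_ sE] := hs; have [_ Op _] := resc; move=> [p [ap _] <-].
by rewrite !in_chart_chart // (sE g gh Om) // powRr1 // ltW.
Qed.

Definition holo_eps_rescale := holo_eps_conf hV lg sOm Om_gt0 ghE ssg shE.
Definition holo_iot_rescale := holo_iot_conf hV lg sOm Om_gt0 ghE ssg shE.
Definition holo_div_rescale := holo_div_conf hV lg sOm Om_gt0 ghE ssg shE.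
End Rescaling.

Definition holo_field k w F : tractor_field M :=
  fun g a => D3star_D3 (g a) (in_chart (sigma g) a) k w (F g a).

Section HoloTractor.
Variables (k : int) (w : R) (F : tractor_field M).
Hypothesis tF : is_tractor c U k w F.
Local Notation r := (k%:~R : R).
Let E (g : metric_field M) a := holo_eps (g a) (in_chart (sigma g) a) (w + r)
  (north (F g a)) (west (F g a)).

Let fE g : c g -> is_form U (k + 1) (E g).
Proof.
move=> cg; have [/(_ g cg) [fN fW _ _] _] := tF.
exact: (is_form_holo_eps hU (class_metric cg) (density_smooth cg)).
Qed.

Let west_holo g a x : c g -> chart_im a U x -> west (holo_field k w F g a) x =
  holo_iot (g a) (in_chart (sigma g) a) (n%:R + w - r) (E g a) x.
Proof. by move=> cg Vx; apply: (west_D3star_D3 _ _ (hU a)). Qed.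

Lemma is_tractor_holo : is_tractor c U k w (holo_field k w F).
Proof.
split=> [g cg|g gh Om cg cgh resc a p ap Up].
  have [mg sg] := (class_metric cg, density_smooth cg).
  split.
  - exact: is_form0.
  - apply: (is_form_eq hU (A := fun a => holo_iot (g a) (in_chart (sigma g) a)
      (n%:R + w - r) (E g a))) => [a x Vx|]; first by rewrite west_holo.
    exact: (is_form_holo_iot hU mg sg _ (fE cg)).
  - exact: is_form0.
  - apply: (is_form_eq hU (A := fun a => holo_div (g a) (in_chart (sigma g) a)
      (E g a))) => [a x Vx|]; first by rewrite /holo_field south_D3star_D3.
    exact: (is_form_holo_div hU mg sg (fE cg)).
have Vx := chart_im_chart ap Up; set x := chart a p in Vx *.
have sE := is_form_sform (fE cg) a; have dE := is_form_deg (fE cg) (a := a).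
have EhE y : chart_im a U y -> E gh a y = in_chart Om a y `^ (w + r + 1) *: E g a y.
  move=> Vy; have [/(_ g cg) [fN fW _ _] FE] := tF.
  have Fch z : chart_im a U z -> slots_at (F gh a) z =
      slots_at (tractor_change (g a) (in_chart Om a) k w (F g a)) z.
    by move=> [q [aq Uq] <-]; apply: FE.
  apply: (holo_eps_rescale cg cgh resc Vy (is_form_sform fN a) (is_form_sform fW a)).
    by move=> z Vz; exact: (congr1 (fun t => t.1.1.1) (Fch z Vz)).
  move=> z Vz; apply: etrans (congr1 (fun t => t.1.1.2) (Fch z Vz)) _.
  by rewrite /= epsv_dcov.
(* The coefficient is rewritten in terms of the weight v = w + k of the west slot, the form in which
   [holo_iot_conf] and [holo_div_conf] produce it. *)
have nE : n%:R + w - r = n%:R + (w + r) - 2 * r by ring.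
have HW := holo_iot_rescale cg cgh resc Vx sE dE EhE.
have HS := holo_div_rescale cg cgh resc Vx sE dE EhE.
rewrite -nE in HW HS.
have WE := west_holo cg Vx; have WhE := west_holo cgh Vx.
have SE := congr1 (fun A => A x) (south_D3star_D3 (g a) (in_chart (sigma g) a) k w (F g a)).
have ShE := congr1 (fun A => A x) (south_D3star_D3 (gh a) (in_chart (sigma gh) a) k w (F gh a)).
apply: (tractor_change_west_south (F := holo_field k w F g a) (Fh := holo_field k w F gh a) erefl erefl erefl erefl).
  apply: etrans WhE _; apply: etrans HW _.
  exact: (congr1 ( *:%R _) (esym WE)).
apply: etrans ShE _; apply: etrans HS _.
by rewrite WE SE.
Qed.

End HoloTractor.

(** [f] behaves as a density of weight [b] over [U]. It is applied to constants, where [b] is 0, and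
    to powers of sigma. *)
Lemma is_tractor_scale (f : metric_field M -> M -> R) k w (b : R) F :
  (forall g a, c g -> smooth_on (chart_im a U) (in_chart (f g) a)) ->
  (forall g gh Om, c g -> c gh -> rescales Om g gh ->
     forall p, U p -> f gh p = Om p `^ b * f g p) ->
  is_tractor c U k w F ->
  is_tractor c U k (w + b) (fun g a => slots_scale (in_chart (f g) a) (F g a)).
Proof.
move=> sf fE [fF tF]; split=> [g cg|g gh Om cg cgh resc a p ap Up].
  have [fN fW fS fT] := fF g cg; have sfg a := sf g a cg.
  by split; apply: is_formZ.
have Op : 0 < in_chart Om a (chart a p) by have [_ Op _] := resc; apply: Op.
apply: etrans (esym (tractor_change_scale _ _ _ _ _ _ Op)).
have := tF g gh Om cg cgh resc a p ap Up; rewrite /slots_at /= => -[-> -> -> ->].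
by rewrite !in_chart_chart // (fE g gh Om).
Qed.

Lemma is_tractor_cst (r : R) k w F : is_tractor c U k w F ->
  is_tractor c U k w (fun g a => slots_scale (fun=> r) (F g a)).
Proof.
move=> tF; rewrite -[w]addr0.
apply: (@is_tractor_scale (fun _ _ => r)) => // *; first exact: smooth_cst.
by rewrite powRr0 mul1r.
Qed.

Lemma is_tractor_sigma_pow (b : R) k w F : (forall g p, c g -> U p -> 0 < sigma g p) ->
  is_tractor c U k w F -> is_tractor c U k (w + b) (sigma_pow sigma b F).
Proof.
move=> s_gt0 tF; apply: (@is_tractor_scale (fun g p => sigma g p `^ b)) => //.
  move=> g a cg; apply: (smooth_powR (hU a)); last exact/chart_smooth/density_smooth.
  by move=> x [p [ap Up] <-]; rewrite chartK // s_gt0.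
move=> g gh Om cg cgh resc p Up; have [_ Op _] := resc; have [_ sE] := hs.
by rewrite (sE g gh Om) // powRr1 ?powRM ?ltW ?s_gt0 // .
Qed.
End Tractors.

(** * Restriction to the interior *)

Section Interior.
Variables (R : realType) (n : nat) (M : manifold R n) (c : set (metric_field M)).
Variables (sigma : density_field M).
Implicit Types (a b : chart_index M) (p : M) (k : int) (w : R) (F : tractor_field M).

Lemma conformal_class_inh : conformal_class c -> exists g, c g.
Proof.
move=> [g0 mg0 cE]; exists g0; apply/cE; split=> //; exists (fun=> 1); split=> //.
- by move=> a; apply: smooth_cst; apply: relopen_chart_imT.
- by move=> a p _; rewrite expr1n scale1r.
Qed.

Lemma is_tractorW (U U' : set M) k w F : U `<=` U' ->
  is_tractor c U' k w F -> is_tractor c U k w F.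
Proof.
move=> UU [fF tF].
have fW j (A : form_field M) : is_form U' j A -> is_form U j A.
  move=> [sA dA mA]; split.
  - by move=> a S; apply: smooth_onW (sA a S); apply: chart_imS.
  - by move=> a p S ap /UU; apply: dA.
  - by move=> a b p ap bp /UU; apply: mA.
split=> [g /fF [? ? ? ?]|g gh Om cg cgh resc a p ap /UU]; last exact: tF.
by split; apply: fW.
Qed.

Hypothesis hPE : poincare_einstein c sigma.

Lemma PE_class : conformal_class c. Proof. by have [[]] := hPE. Qed.
Lemma PE_density : is_density c 1 sigma. Proof. by have [[]] := hPE. Qed.
Lemma PE_gt0 g p : c g -> interior_pts M p -> 0 < sigma g p.
Proof. by have [_ H _ _ _] := hPE; apply: H. Qed.

(** The boundary is defined by the existence of some chart with vanishing first coordinate, from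
    which openness of the complement in another chart is not immediate. In every scale, however, the
    interior is the set where the continuous function sigma is positive. *)
Lemma relopen_interior a : relopen (chart_im a (interior_pts M)).
Proof.
have [g cg] := conformal_class_inh PE_class.
have [_ s_gt0 s0 _ _] := hPE; have hT := relopen_chart_imT a.
have cs := Ck_on_within (density_smooth PE_density cg a 0).
rewrite (_ : chart_im a _ = chart_im a setT `&` in_chart (sigma g) a @^-1` [set t | 0 < t]).
  by apply: relopen_preimage => //; apply: open_gt.
rewrite eqEsubset; split=> x.
  move=> [p [ap ip] <-]; split; first exact: chart_im_chart.
  by rewrite /= in_chart_chart // s_gt0.
move=> [[p [ap _] <-]]; rewrite /= in_chart_chart // => sp.
apply: chart_im_chart => // bp; by move: sp; rewrite (s0 g p) // ltxx.
Qed.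

End Interior.

Lemma slots_zero_at (R : realType) n V (F : slots R n) x : slots_zero V F -> V x ->
  slots_at F x = (0, 0, 0, 0).
Proof. by move=> F0 /F0 [n0 w0 e0 s0]; rewrite /slots_at n0 w0 e0 s0. Qed.
Theorem theorem5p18 (R : realType) (n : nat) (hn : (2 <= n)%N)
    (M : manifold R n) (c : set (metric_field M)) (sigma : density_field M)
    (hPE : poincare_einstein c sigma)
    (k : nat) (w0 l : R) (hw0 : w0 != - k%:R) (hw0' : w0 != k%:R - n%:R)
    (A : tractor_field M)
    (hA : is_tractor c setT k%:Z (- w0 - n%:R) A)
    (hyA : is_Osigma c sigma k%:Z (- w0 - n%:R - 1) l
             (yop sigma k%:Z (- w0 - n%:R) A))
    (hIA : vanishes c setT (Istar sigma A))
    (hDA : vanishes c setT (Dhat_star k%:Z (- w0 - n%:R) A))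
    (hXA : vanishes c setT (Xstar A)) :
  let h0 : R := n.+1%:R + 2 * w0 in
  let Abar := sigma_pow sigma (h0 - 1) (holo_proj sigma k%:Z (- w0 - n%:R) A) in
  [/\ is_tractor c (interior_pts M) k%:Z w0 Abar,
      is_Osigma c sigma k%:Z (w0 - 1) (l + h0 - 1) (yop sigma k%:Z w0 Abar),
      vanishes c (interior_pts M) (Istar sigma Abar),
      vanishes c (interior_pts M) (Dhat_star k%:Z w0 Abar)
    & vanishes c (interior_pts M) (Xstar Abar)].
Proof.
move=> h0 Abar; rewrite /Abar /h0 {Abar h0}.
have hc := PE_class hPE; have hs := PE_density hPE.
have hI := relopen_interior hPE; have hT := @relopen_chart_imT _ _ M.
set W := - w0 - n%:R in hA hyA hDA *.
have kE : k%:Z%:~R = k%:R :> R by rewrite -pmulrn.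
pose kap := (W + k%:Z%:~R) * (n%:R + W - k%:Z%:~R).
(* The factors of [kap] are - (w0 - (k - n)) and - (w0 + k): each of the two excluded weights
   accounts for one of them. *)
have kap0 : kap != 0.
  rewrite /kap kE (_ : W + _ = - (w0 - (k%:R - n%:R))); last by rewrite /W; ring.
  rewrite (_ : n%:R + W - _ = - (w0 - - k%:R)); last by rewrite /W; ring.
  by rewrite mulf_neq0 // oppr_eq0 subr_eq0.
have tA := is_tractorW (@subsetT _ (interior_pts M)) hA.
have tAbar : is_tractor c (interior_pts M) k%:Z w0
    (sigma_pow sigma (n.+1%:R + 2 * w0 - 1) (holo_proj sigma k%:Z W A)).
  (* The weight w0 is reached because the exponent h0 - 1 is the difference w0 - W. *)
  rewrite [X in is_tractor _ _ _ X](_ : w0 = W + (n.+1%:R + 2 * w0 - 1)); last first.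
    by rewrite /W -natr1; ring.
  apply: (is_tractor_sigma_pow hI hs); first exact: (PE_gt0 hPE).
  exact: (is_tractor_cst hI _ (is_tractor_holo hI hc hs tA)).
have [B tB yE] := hyA.
have tBi := is_tractorW (@subsetT _ (interior_pts M)) tB.
have loc g a p : c g -> dom a p -> interior_pts M p ->
    [/\ slots_at (yop sigma k%:Z w0 (sigma_pow sigma (n.+1%:R + 2 * w0 - 1)
            (holo_proj sigma k%:Z W A)) g a) (chart a p) =
         slots_at (sigma_pow sigma (l + (n.+1%:R + 2 * w0) - 1) (fun g a =>
            slots_scale (fun=> kap^-1) (holo_field sigma k%:Z (W - 1 - l) B g a)) g a)
            (chart a p),
        slots_at (Istar sigma (sigma_pow sigma (n.+1%:R + 2 * w0 - 1)
            (holo_proj sigma k%:Z W A)) g a) (chart a p) = (0, 0, 0, 0),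
        slots_at (Dhat_star k%:Z w0 (sigma_pow sigma (n.+1%:R + 2 * w0 - 1)
            (holo_proj sigma k%:Z W A)) g a) (chart a p) = (0, 0, 0, 0)
      & slots_at (Xstar (sigma_pow sigma (n.+1%:R + 2 * w0 - 1)
            (holo_proj sigma k%:Z W A)) g a) (chart a p) = (0, 0, 0, 0)].
  move=> cg ap ip; set V := chart_im a (interior_pts M); set s := in_chart (sigma g) a.
  have Vx : V (chart a p) by apply: chart_im_chart.
  have hV : relopen V := hI a.
  have lg : local_metric V (g a) := metric_local a _ (class_metric hc cg).
  have ss : smooth_on V s := chart_smooth _ a (density_smooth hs cg).
  have sp x : V x -> 0 < s x.
    by move=> [q [aq iq] <-]; rewrite /s in_chart_chart // (PE_gt0 hPE).
  have ein x : V x -> ricci (fun z => s z ^- 2 *: g a z) x = - n%:R *: (s x ^- 2 *: g a x).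
    by have [_ _ _ _ H] := hPE; move=> [q [aq iq] <-]; apply: H.
  have [/(_ g cg) [_ fW _ fS] _] := tA.
  have [/(_ g cg) [_ gW _ _] _] := tBi.
  have zI x : V x -> slots_at (Istar sigma A g a) x = (0, 0, 0, 0).
    by move=> [q [aq _] <-]; apply: hIA.
  have zD x : V x -> slots_at (Dhat_star k%:Z W A g a) x = (0, 0, 0, 0).
    by move=> [q [aq _] <-]; apply: hDA.
  have zX x : V x -> slots_at (Xstar A g a) x = (0, 0, 0, 0).
    by move=> [q [aq _] <-]; apply: hXA.
  have N0 x : V x -> north (A g a) x = 0.
    by move=> Vy; exact: (congr1 (fun t => t.1.1.2) (zX x Vy)).
  have E0 x : V x -> east (A g a) x = 0.
    by move=> Vy; exact: (congr1 (fun t => t.2) (zX x Vy)).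
  have iW x : V x -> iwf (up (g a) (dfun s) x) (west (A g a) x) = - s x *: south (A g a) x.
    move=> Vy; have H : rho (g a) s x *: north (A g a) x + iotv (g a) (dcov s) (west (A g a)) x
        + s x *: south (A g a) x = 0 by exact: (congr1 (fun t => t.1.1.2) (zI x Vy)).
    by move: H; rewrite N0 // scaler0 add0r iotv_dcov scaleNr => /eqP; rewrite addr_eq0 => /eqP.
  have iS x : V x -> iwf (up (g a) (dfun s) x) (south (A g a) x) = 0.
    move=> Vy; have H : rho (g a) s x *: east (A g a) x - iotv (g a) (dcov s) (south (A g a)) x
        = 0 by exact: (congr1 (fun t => t.2) (zI x Vy)).
    by move: H; rewrite E0 // scaler0 add0r iotv_dcov => /eqP; rewrite oppr_eq0 => /eqP.
  have cW x : V x -> codiff (g a) (west (A g a)) x =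
      - (n.+1%:R + W - k%:Z%:~R) *: south (A g a) x.
    move=> Vy; have H : codiff (g a) (west (A g a)) x +
        (n.+1%:R + W - k%:Z%:~R) *: south (A g a) x = 0.
      by exact: (congr1 (fun t => t.1.1.2) (zD x Vy)).
    by move: H => /eqP; rewrite addr_eq0 scaleNr => /eqP.
  have yA x : V x -> slots_at (yop_loc (g a) s k%:Z W (A g a)) x =
      slots_at (slots_scale (fun z => s z `^ l) (B g a)) x.
    by move=> [q [aq iq] <-]; apply: yE.
  have sW := is_form_sform fW a; have sS := is_form_sform fS a.
  split.
  - exact: (yop_Abar hV lg hn ss sp ein kap0 N0 E0 sW sS (is_form_deg fW (a := a)) iW iS cW
      (is_form_sform gW a) yA Vx).
  - apply: slots_zero_at Vx; apply: Istar_loc_zero.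
    + by move=> x _; apply: north_Abar.
    + by move=> x _; apply: east_Abar.
    + exact: (iota_west_Abar hV lg ss _ w0 N0 sW).
    + exact: (iota_south_Abar hV lg ss _ w0 N0 sW).
  - apply: slots_zero_at Vx => x Vy; split=> //.
    + have H := codiff_west_Abar hV lg ss sp k%:Z w0 N0 sW Vy.
      by apply: etrans (congr1 (+%R^~ _) H) _; rewrite scaleNr addNr.
    + have H := codiff_south_Abar hV lg ss sp k%:Z w0 N0 sW Vy.
      by apply: etrans (congr1 -%R H) _; rewrite oppr0.
  - apply: slots_zero_at Vx => x Vy; split=> //; first exact: north_Abar.
    exact: east_Abar.
split; first exact: tAbar.
- exists (fun g a => slots_scale (fun=> kap^-1) (holo_field sigma k%:Z (W - 1 - l) B g a)).
    (* The weight demanded by the new exponent l + h0 - 1 is the weight of [B], so Q preserves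
       it. *)
    rewrite (_ : w0 - 1 - _ = W - 1 - l); last by rewrite /W -natr1; ring.
    exact: (is_tractor_cst hT _ (is_tractor_holo hT hc hs tB)).
  by move=> g a p cg ap ip; have [] := loc g a p cg ap ip.
- by move=> g a p cg ap ip; have [] := loc g a p cg ap ip.
- by move=> g a p cg ap ip; have [] := loc g a p cg ap ip.
- by move=> g a p cg ap ip; have [] := loc g a p cg ap ip.
Qed.
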